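(* Let $X$ be a closed interval of $\mathbb R$, let $T:X\to X$ be a Gibbs–Markov piecewise expanding interval map, and let $\mu$ be a Gibbs probability measure for $T$ admitting exponential decay of correlations for $L^1$ against $\mathcal{BV}$ observables. Let $\Lambda$ be the repeller of $T$ and for $x\in X$, $n\ge2$, put $$m_n(x)=\min_{0\le i<j\le n-1}|T^ix-T^jx|.$$ (i) If the upper correlation dimension satisfies $\overline D_2=\overline D_2(\mu)>0$, then $$\liminf_{n\to\infty}\frac{\log m_n(x)}{-\log n}\ge\frac{2}{\overline D_2}\qquad\text{for }\mu\text{-almost every }x\in\Lambda.$$ (ii) If $\mu$ is absolutely continuous with respect to Lebesgue measure, then $\underline D_2(\mu)=\overline D_2(\mu)=1$, and, writing $D_2$ for this common value, $$\lim_{n\to\infty}\frac{\log m_n(x)}{-\log n}=\frac{2}{D_2}\qquad\text{for }\mu\text{-almost every }x.$$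
   Context: $m$ denotes Lebesgue measure on $X$, $|J|$ the length of an interval $J$, and $\log 0=-\infty$. Piecewise expanding interval map: there is an at most countable partition $\mathcal P=\{I_1,I_2,\dots\}$ for $T$ consisting of pairwise disjoint subintervals of $X$ (points of $X$ outside $\bigcup\mathcal P$ are allowed) such that $T$ is differentiable on each $I_k$ and $|DT|_{I_k}|>\gamma$ for a uniform constant $\gamma>0$. Put $\mathcal P_n=\bigvee_{j=0}^{n-1}T^{-j}\mathcal P$; its nonempty elements $\bigcap_{i=0}^{n-1}T^{-i}P_{x_i}$ ($P_{x_i}\in\mathcal P$) are the $n$-cylinders. Bounded distortion is required: there is $C_{bd}>0$ with $C_{bd}^{-1}\le DT^n(x)/DT^n(y)\le C_{bd}$ for all $n$, all $I\in\mathcal P_n$ and $x,y\in I$. A point $x$ has symbolic representation $\underline x=(x_0,x_1,\dots)$ if $x\in\bigcap_{i\ge0}T^{-i}P_{x_i}$. Symbolic metric: $d_s(x,y)=e^{-\underline x\wedge\underline y}$, where $\underline x\wedge\underline y=\min\{j\ge0:x_j\ne y_j\}$. Gibbs–Markov: (a) for each $P\in\mathcal P$, $T(P)$ is a union of elements of $\mathcal P$ and $T|_P$ is injective; (b) with $g=\frac{dm}{d(m\circ T)}$, $\log g|_P$ is Lipschitz with respect to $d_s$ for each $P\in\mathcal P$; (c) if $\mathcal P$ is infinite, there is $\delta_0>0$ with $|T^n(I)|\ge\delta_0$ for all $I\in\mathcal P_n$ and all $n\ge1$; if $\mathcal P$ is finite, there is $\delta_0>0$ with $|I|\ge\delta_0$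 for all $I\in\mathcal P$ (big image property). Repeller: $\Lambda=\{x\in X: T^k(x)\in\bigcup_{P\in\mathcal P}P\ \text{for all } k\ge0\}$. Gibbs measure: a $T$-invariant Borel probability measure $\mu$ such that for some potential $\varphi$ that is locally Hölder in the symbolic coding (there are $M_\varphi>0$, $\zeta\in(0,1)$ with $|\varphi(x)-\varphi(y)|\le M_\varphi\zeta^k$ whenever $x,y$ lie in the same $k$-cylinder, $k\ge1$) there are $c>0$, $P\in\mathbb R$ with $c^{-1}\le\mu(C)/\exp(-nP+\sum_{i=0}^{n-1}\varphi(T^ix))\le c$ for all $n$, all $n$-cylinders $C$ and all $x\in C\cap\Lambda$. Exponential decay of correlations for $\mathcal{BV}$ against $L^1$: there are $C_1,c_1>0$ such that for all $f\in\mathcal{BV}$, $g\in L^1(\mu)$ and $n\in\mathbb N$, $\left|\int f\cdot g\circ T^n\,d\mu-\int f\,d\mu\int g\,d\mu\right|\le C_1e^{-c_1n}\|f\|_{\mathcal{BV}}\|g\|_1$. Here $\mathcal{BV}$ is the set of $f\in L^1(m)$ of bounded variation, $\|f\|_{\mathcal{BV}}=\|f\|_1+TV(f)$ with $TV$ the total variation. Correlation dimensions: $\underline D_2(\mu)=\liminf_{r\to0}\frac{\log\int\mu(B(x,r))\,d\mu(x)}{\log r}$ and $\overline D_2(\mu)=\limsup_{r\to0}\frac{\log\int\mu(B(x,r))\,d\mu(x)}{\log r}$; $D_2(\mu)$ denotes the common value when they coincide. *)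

(* Defs.v *)
From HB Require Import structures.
From mathcomp Require Import all_boot all_order all_algebra.
From mathcomp Require Import all_classical all_reals all_analysis.
Set Implicit Arguments.
Unset Strict Implicit.
Unset Printing Implicit Defensive.
Import Order.TTheory GRing.Theory Num.Theory.
Import numFieldNormedType.Exports.
Local Open Scope classical_set_scope.
Local Open Scope ring_scope.

Section piecewise_maps.
Context {R : realType}.
Implicit Types (f T : R -> R) (x y : R) (n k : nat) (I J C X : set R)
  (P : set (set R)).

(* Derivative of the restriction of [f] to [I]: it is one-sided at an endpoint
   that belongs to [I]. *)
Definition diff_quotient f x := fun y => (f y - f x) / (y - x).

Definition derivable_on I f x := cvg (diff_quotient f x @ within I x^').

Definition derive_on I f x : R := lim (diff_quotient f x @ within I x^').

(* The elements of P_n; the n-cylinder of the word (w 0, ..., w (n-1)). *)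
Definition cylinder X T P n C :=
  exists w : nat -> set R,
    [/\ forall i, (i < n)%N -> P (w i),
        C = [set x | X x /\ forall i, (i < n)%N -> w i (iter i T x)] &
        C !=set0].

Definition repeller X T P : set R :=
  [set x | X x /\ forall k, exists2 I, P I & I (iter k T x)].

Record piecewise_expanding X T P : Prop := {
  pe_map : set_fun X X T ;
  pe_nonempty : P !=set0 ;
  pe_countable : countable P ;
  pe_interval : forall I, P I ->
    [/\ is_interval I, I `<=` X & exists x y, [/\ I x, I y & x < y]] ;
  pe_disjoint : trivIset P id ;
  pe_derivable : forall I x, P I -> I x -> derivable_on I T x ;
  pe_expanding : exists2 gamma : R, 0 < gamma &
    forall I x, P I -> I x -> gamma < `|derive_on I T x| ;
  pe_distortion : exists2 Cbd : R, 0 < Cbd &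
    forall n C x y, (0 < n)%N -> cylinder X T P n C -> C x -> C y ->
      Cbd^-1 <= derive_on C (iter n T) x / derive_on C (iter n T) y <= Cbd
}.

Definition symbolic_repr T P x (u : nat -> set R) :=
  forall i, P (u i) /\ u i (iter i T x).

(* The infimum is the minimum of the paper when [u] and [v] differ, and is +oo,
   giving distance 0, when [u = v]. *)
Definition symbolic_dist (u v : nat -> set R) : \bar R :=
  expeR (- ereal_inf [set (j%:R : R)%:E | j in [set j | u j <> v j]])%E.

(* The set function A |-> m (T (A)) on the subsets of a set I on which T is
   injective. *)
Definition image_measure T I (A : set (measurableTypeR R)) : \bar R :=
  lebesgue_measure (T @` (A `&` I)).

(* g = dm/d(m o T). The first clause says that [g] is a density of m with
   respect to m o T; it determines [g] only up to a Lebesgue-null set, and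
   points having a symbolic representation may form such a set, so the second
   one selects the pointwise version 1/|DT| of this density. *)
Definition jacobian_density T P (g : R -> R) :=
  (forall I (A : set (measurableTypeR R)), P I -> measurable A -> A `<=` I ->
     lebesgue_measure A =
     integral (image_measure T I) A (fun x => (g x)%:E)) /\
  (forall I x, P I -> I x -> g x = `|derive_on I T x|^-1).

Record gibbs_markov X T P : Prop := {
  gm_expanding : piecewise_expanding X T P ;
  gm_markov : forall I, P I ->
    exists2 Q : set (set R), Q `<=` P & T @` I = \bigcup_(J in Q) J ;
  gm_injective : forall I, P I -> set_inj I T ;
  gm_lipschitz : exists2 g : R -> R, jacobian_density T P g &
    forall I, P I -> exists L : R, forall x y u v, I x -> I y ->
      symbolic_repr T P x u -> symbolic_repr T P y v ->
      (`|ln (g x) - ln (g y)|%:E <= L%:E * symbolic_dist u v)%E ;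
  gm_big_image_infinite : infinite_set P ->
    exists2 delta : R, 0 < delta & forall n C, (0 < n)%N ->
      cylinder X T P n C -> (delta%:E <= lebesgue_measure (iter n T @` C))%E ;
  gm_big_image_finite : finite_set P ->
    exists2 delta : R, 0 < delta & forall I, P I ->
      (delta%:E <= lebesgue_measure I)%E
}.

Definition locally_hoelder X T P (phi : R -> R) :=
  exists2 M : R, 0 < M & exists2 zeta : R, 0 < zeta < 1 &
    forall k C x y, (0 < k)%N -> cylinder X T P k C -> C x -> C y ->
      `|phi x - phi y| <= M * zeta ^+ k.

Definition gibbs_bound X T P (mu : set (measurableTypeR R) -> \bar R) :=
  exists2 phi : R -> R, locally_hoelder X T P phi &
  exists2 c : R, 0 < c & exists p : R,
    forall n C x, (0 < n)%N -> cylinder X T P n C -> C x ->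
      repeller X T P x ->
      c^-1 <= fine (mu C) /
        expR (- (n%:R * p) + \sum_(0 <= i < n) phi (iter i T x)) <= c.

(* mu is a probability on the line carried by X. *)
Record gibbs_measure X T P (mu : probability (measurableTypeR R) R) : Prop := {
  gb_carrier : mu X = 1%E ;
  gb_measurable : @measurable_fun _ _ (measurableTypeR R) (measurableTypeR R) X T ;
  gb_invariant : forall A : set (measurableTypeR R), measurable A ->
    mu (X `&` T @^-1` A) = mu A ;
  gb_bound : gibbs_bound X T P mu
}.

End piecewise_maps.

Section statistics.
Context {R : realType}.
Implicit Types (a b : R) (T : R -> R) (mu : probability (measurableTypeR R) R).

(* mu may be singular with respect to Lebesgue measure, so elements of BV are
   functions rather than Lebesgue classes, and the variation is pointwise. *)
Definition BV a b (f : R -> R) :=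
  (@lebesgue_measure R).-integrable `[a, b] (EFin \o f) /\
  bounded_variation a b f.

Definition BV_norm a b (f : R -> R) : R :=
  \int[@lebesgue_measure R]_(x in `[a, b]) `|f x| +
  fine (total_variation a b f).

Definition exp_decay_BV_L1 a b T mu :=
  exists C1 c1 : R, [/\ 0 < C1, 0 < c1 &
    forall (f g : R -> R) (n : nat),
      BV a b f -> mu.-integrable `[a, b] (EFin \o g) ->
      `| \int[mu]_(x in `[a, b]) (f x * g (iter n T x)) -
         (\int[mu]_(x in `[a, b]) f x) * (\int[mu]_(x in `[a, b]) g x) |
      <= C1 * expR (- (c1 * n%:R)) * BV_norm a b f *
         \int[mu]_(x in `[a, b]) `|g x| ].

Definition correlation_ratio (X : set R) mu (r : R) : \bar R :=
  (lne (\int[mu]_(x in X) mu (ball x r)) / (ln r)%:E)%E.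

Definition lower_correlation_dim X mu : \bar R :=
  limf_einf (correlation_ratio X mu) 0^'+.

Definition upper_correlation_dim X mu : \bar R :=
  limf_esup (correlation_ratio X mu) 0^'+.

(* m_n(x), in \bar R so that [lne] applies; finite for n >= 2. *)
Definition shortest_distance T (n : nat) (x : R) : \bar R :=
  \big[Order.min/+oo%E]_(0 <= j < n) \big[Order.min/+oo%E]_(0 <= i < j)
    `|iter i T x - iter j T x|%:E.

(* log m_n(x) / (- log n), where log 0 = -oo. *)
Definition shortest_distance_rate T (x : R) (n : nat) : \bar R :=
  (lne (shortest_distance T n x) / (- ln n%:R)%:E)%E.

End statistics.

(* Main.v *)
Require Import Defs.
From mathcomp Require Import all_boot all_order all_algebra.
From mathcomp Require Import all_classical all_reals all_analysis measurable_realfun.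
From mathcomp Require Import ring lra zify.
Set Implicit Arguments.
Unset Strict Implicit.
Unset Printing Implicit Defensive.
Import Order.TTheory GRing.Theory Num.Theory.
Import numFieldNormedType.Exports.
Local Open Scope classical_set_scope.
Local Open Scope ring_scope.

(** The lower bound on the rate is a birthday problem.  Cut [[a, b]] into cells
    of length [r] with probabilities [p k].  Two independent points fall into
    the same cell with probability [s = \sum_k p k ^+ 2], which is the
    correlation integral at scale [r] up to a factor 3
    ([correlation_integral_bounds]) and therefore at least of order
    [r `^ theta] for every [theta] above the upper correlation dimension.
    Among [N] independent points there are about [N ^+ 2 * s] collisions, so
    that some two points are [r]-close as soon as [r] is much larger than
    [N `^ (- 2 / theta)].  The points [T^i x] are not independent, but decay of
    correlations against indicators of intervals, whose norm in BV is bounded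
    ([BV_indic_interval]), makes times that are [L] apart independent up to an
    error exponentially small in [L].  Sampling the orbit at multiples of a
    sparse [L], the second moment method ([second_moment],
    [no_collision_moments], [no_collision_arith]) bounds the probability that
    no collision occurs, and Borel-Cantelli along a geometric sequence of times
    concludes ([eventually_not_far]).

    The upper bound on the rate is a first moment estimate: it suffices that
    [mu (|T^k x - x| < r) <= Kr * r] for all [k >= 1] ([return_prob]), since
    then the union bound over the pairs of times below [n] is [n ^+ 2 * Kr * r]
    ([eventually_far]).  This uses that [mu] is absolutely continuous and that
    [T] is Gibbs-Markov, as follows.

    - On a cylinder of level [n], bounded distortion and the mean value theorem
      make [T^n] bi-Lipschitz, and by the big image property its expansion is
      comparable with the inverse of the length of the cylinder
      ([cyl_geometry]).
    - Hence Lebesgue measure of [T^-n J] is at most a constant times [|J|], and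
      mixing transfers this bound to [mu]: the density of [mu] is bounded
      ([density_bound]).  This already gives both correlation dimensions the
      value 1 ([correlation_dims_eq1]).
    - Cylinders have small probability, by mixing ([cyl_prob_small]), and from
      this also small length ([cyl_shrink]).
    - On a short cylinder [T^k] expands by a factor at least 2, so the points
      that return [r]-close form a set of diameter proportional to [r] and to
      the length of the cylinder.  A close return inside a long cylinder is
      iterated: either it becomes a close return at a time whose cylinders are
      short, or the orbit passes near an endpoint of the cylinder. *)

(** * Real-valued probabilities *)

Lemma le_of_eq {R : numDomainType} (x y : R) : x = y -> x <= y.
Proof. by move=> ->. Qed.

Section prob.
Context {R : realType} (mu : probability (measurableTypeR R) R).
Implicit Types A B : set (measurableTypeR R).

Definition prob (A : set R) : R := fine (mu A).

Lemma prob_fin A : measurable A -> mu A \is a fin_num.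
Proof. by move=> mA; exact: fin_num_measure. Qed.

Lemma probE A : measurable A -> (prob A)%:E = mu A.
Proof. by move=> mA; rewrite /prob fineK// prob_fin. Qed.

Lemma prob_ge0 A : 0 <= prob A.
Proof. by rewrite /prob fine_ge0. Qed.

Lemma prob0 : prob set0 = 0.
Proof. by rewrite /prob measure0. Qed.

Lemma probT : prob setT = 1.
Proof. by rewrite /prob probability_setT. Qed.

Lemma prob_le1 A : measurable A -> prob A <= 1.
Proof. by move=> mA; rewrite -lee_fin probE// probability_le1. Qed.

Lemma prob_mono A B : measurable A -> measurable B -> A `<=` B ->
  prob A <= prob B.
Proof.
by move=> mA mB AB; rewrite -lee_fin !probE//; apply: le_measure; rewrite ?inE.
Qed.

Lemma probU_le A B : measurable A -> measurable B ->
  prob (A `|` B) <= prob A + prob B.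
Proof.
move=> mA mB; rewrite -lee_fin EFinD !probE//; last exact: measurableU.
exact: measureU2.
Qed.

Lemma probU A B : measurable A -> measurable B -> A `&` B = set0 ->
  prob (A `|` B) = prob A + prob B.
Proof.
move=> mA mB AB; apply: EFin_inj; rewrite EFinD !probE//; last exact: measurableU.
exact: measureU.
Qed.

Lemma probDI A B : measurable A -> measurable B ->
  prob A = prob (A `&` B) + prob (A `\` B).
Proof.
move=> mA mB; rewrite -probU.
- by rewrite setUIDK.
- exact: measurableI.
- exact: measurableD.
- by apply/seteqP; split=> x // [[_ ?] [_ ?]].
Qed.

Lemma probC A : measurable A -> prob (~` A) = 1 - prob A.
Proof.
move=> mA; have := probDI measurableT mA; rewrite probT setTI setTD => ->.
by rewrite addrC addKr.
Qed.

Lemma prob_bigU_le (I : Type) (s : seq I) (Q : pred I) (F : I -> set R) :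
  (forall i, measurable (F i : set (measurableTypeR R))) ->
  prob (\big[setU/set0]_(i <- s | Q i) F i) <= \sum_(i <- s | Q i) prob (F i).
Proof.
move=> mF; elim: s => [|i s IH]; first by rewrite !big_nil prob0.
rewrite !big_cons; case: (Q i) => //.
apply: le_trans (probU_le _ _) _ => //; last by rewrite lerD2l.
exact: bigsetU_measurable.
Qed.

Lemma prob_bigU_triv (F : nat -> set R) n :
  (forall i, measurable (F i : set (measurableTypeR R))) ->
  (forall k l x, F k x -> F l x -> k = l) ->
  prob (\big[setU/set0]_(i < n) F i) = \sum_(i < n) prob (F i).
Proof.
move=> mF dF; elim: n => [|n IH]; first by rewrite !big_ord0 prob0.
rewrite !big_ord_recr/= probU ?IH//; first exact: bigsetU_measurable.
apply/seteqP; split=> x //; rewrite -(bigcup_mkord n F) => -[[k /= kn Fk] Fn].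
by move: kn; rewrite (dF _ _ _ Fk Fn) ltnn.
Qed.

Lemma prob_eq1_mono A B : measurable A -> measurable B -> A `<=` B ->
  prob A = 1 -> prob B = 1.
Proof.
move=> mA mB AB A1; apply/eqP; rewrite eq_le prob_le1//=.
by rewrite -A1 prob_mono.
Qed.

Lemma probI1 A B : measurable A -> measurable B -> prob B = 1 ->
  prob (A `&` B) = prob A.
Proof.
move=> mA mB B1; rewrite [RHS](probDI mA mB).
suff -> : prob (A `\` B) = 0 by rewrite addr0.
apply/eqP; rewrite eq_le prob_ge0 andbT.
apply: le_trans (_ : prob (~` B) <= 0); last by rewrite probC// B1 subrr.
by apply: prob_mono; [exact: measurableD|exact: measurableC|move=> x []].
Qed.

Lemma prob_nondecreasing_limit (F : nat -> set R) (e : R) :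
  (forall i, measurable (F i : set (measurableTypeR R))) ->
  (forall i j, (i <= j)%N -> F i `<=` F j) -> 0 < e ->
  exists n, prob (\bigcup_i F i) - prob (F n) <= e.
Proof.
move=> mF ndF e0.
have mU : measurable (\bigcup_i F i : set (measurableTypeR R)) by exact: bigcupT_measurable.
have nd : nondecreasing_seq F by move=> i j ij; apply/subsetPset; exact: ndF.
have : (fun i => mu (F i)) @ \oo --> (prob (\bigcup_i F i))%:E.
  by rewrite probE//; exact: nondecreasing_cvg_mu.
move=> /fine_cvgP[_] /cvgrPdist_le /(_ e e0)[n _ Hn].
exists n; have := Hn n (leqnn n); rewrite /= ler_norml => /andP[_].
by [].
Qed.

End prob.

Section second_moment.
Context {R : realType} (mu : probability (measurableTypeR R) R).
Local Notation prob := (prob mu).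

Lemma expectation_indic_sum (I : Type) (s : seq I) (c : I -> R) (B : I -> set R) :
  (forall i, measurable (B i : set (measurableTypeR R))) ->
  mu.-integrable setT (EFin \o (fun x => \sum_(i <- s) c i * \1_(B i) x)) /\
  \int[mu]_x (\sum_(i <- s) c i * \1_(B i) x) = \sum_(i <- s) c i * prob (B i).
Proof.
move=> mB.
have intc k : mu.-integrable setT (EFin \o (\1_(B k) : R -> R)).
  apply: (@measurable_bounded_integrable _ (measurableTypeR R)) => //.
  - by apply: le_lt_trans (probability_le1 mu _) (ltry _).
  - exists 1; split => // M M1 x _ /=; rewrite indicE (le_trans _ (ltW M1))//.
    by case: (x \in B k); rewrite ?normr1 ?normr0.
elim: s => [|k s [IH1 IH2]].
  under eq_fun do rewrite big_nil.
  rewrite big_nil; split.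
    exact: (@integrable0 _ (measurableTypeR R)).
  by rewrite Rintegral_cst// mul0r.
have ick : mu.-integrable setT (EFin \o (fun x => c k * (\1_(B k) x : R))).
  exact: (@integrableZl _ (measurableTypeR R) _ mu setT _ (c k) _ (intc k)).
under eq_fun do rewrite big_cons.
split.
  exact: (@integrableD _ (measurableTypeR R) _ mu setT _ _ _ ick IH1).
rewrite RintegralD// IH2 big_cons RintegralZl//; congr (_ * _ + _).
by rewrite /Rintegral integral_indic// setIT.
Qed.

(** Pointwise inequalities between combinations of indicators become
    inequalities between probabilities. *)
Lemma prob_comb_ge0 (I : Type) (s : seq I) (c : I -> R) (B : I -> set R) :
  (forall i, measurable (B i : set (measurableTypeR R))) ->
  (forall x, 0 <= \sum_(i <- s) c i * \1_(B i) x) ->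
  0 <= \sum_(i <- s) c i * prob (B i).
Proof.
move=> mB H; have [_ <-] := expectation_indic_sum s c mB.
exact: Rintegral_ge0.
Qed.

(** Chebyshev's inequality for the number [S] of events [A i] that occur: [S]
    vanishes on [N], where [(S - e) ^+ 2] is therefore [e ^+ 2], while the
    integral of [(S - e) ^+ 2] is the right-hand side. *)
Lemma second_moment (I : finType) (A : I -> set R) (N : set R) (e : R) :
  (forall i, measurable (A i : set (measurableTypeR R))) ->
  measurable (N : set (measurableTypeR R)) ->
  (forall i x, N x -> ~ A i x) ->
  \sum_i prob (A i) = e ->
  prob N * e ^+ 2 <= \sum_i \sum_j prob (A i `&` A j) - e ^+ 2.
Proof.
move=> mA mN NA eE.
pose c (k : (I * I) + (I + bool)) : R :=
  match k with inl _ => 1 | inr (inl _) => - (2 * e) | inr (inr b) =>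
    if b then e ^+ 2 else - e ^+ 2 end.
pose B (k : (I * I) + (I + bool)) : set R :=
  match k with inl p => A p.1 `&` A p.2 | inr (inl i) => A i
  | inr (inr b) => if b then setT else N end.
have mB k : measurable (B k : set (measurableTypeR R)).
  by case: k => [p|[i|[]]] //=; exact: measurableI.
have E (F : (I * I) + (I + bool) -> R) : \sum_(k <- index_enum _) F k =
    \sum_i \sum_j F (inl (i, j)) + (\sum_i F (inr (inl i)) +
      (F (inr (inr true)) + F (inr (inr false)))).
  rewrite big_sumType big_sumType pair_bigA /=; congr (_ + (_ + _)).
    by apply: eq_bigr => -[].
  by rewrite big_bool.
have c0 x : 0 <= \sum_(k <- index_enum _) c k * \1_(B k) x.
  rewrite E /= -mulr_sumr.
  under eq_bigr => i _.
    under eq_bigr => j _ do rewrite mul1r indicI.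
    rewrite -mulr_sumr; over.
  rewrite -mulr_suml /= indicT.
  set S := \sum_i _.
  have [Nx|Nx] := pselect (N x).
    have -> : S = 0.
      by rewrite /S big1// => i _; rewrite indicE memNset//; exact: NA.
    by rewrite indicE mem_set//=; lra.
  have -> : (\1_N x : R) = 0 by rewrite indicE memNset.
  have := sqr_ge0 (S - e); rewrite /cst; nra.
have := prob_comb_ge0 mB c0; rewrite E /= -mulr_sumr eE probT.
under eq_bigr => i _ do under eq_bigr => j _ do rewrite mul1r.
nra.
Qed.

End second_moment.

Section Borel_Cantelli.
Context {R : realType} (mu : probability (measurableTypeR R) R).
Local Notation prob := (prob mu).

Lemma ae_imply (P Q : R -> Prop) : (forall x, P x -> Q x) ->
  {ae mu, forall x, P x} -> {ae mu, forall x, Q x}.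
Proof.
move=> PQ [N [mN N0 sub]]; exists N; split => // x nQ; apply: sub => Px.
exact: nQ (PQ x Px).
Qed.

Lemma Borel_Cantelli_geometric (F : nat -> set R) (K z : R) (i0 : nat) :
  0 < z < 1 -> (forall i, measurable (F i : set (measurableTypeR R))) ->
  (forall i, (i0 <= i)%N -> prob (F i) <= K * z ^+ i) ->
  {ae mu, forall x, exists i1, forall i, (i1 <= i)%N -> ~ F i x}.
Proof.
move=> /andP[z0 z1] mF H.
pose G i := F (i0 + i)%N.
have K0 : 0 <= K.
  have := le_trans (prob_ge0 mu _) (H i0 (leqnn _)).
  by rewrite pmulr_lge0// exprn_gt0.
have mG i : measurable (G i : set (measurableTypeR R)) by exact: mF.
have GK i : prob (G i) <= K * z ^+ i.
  apply: le_trans (H _ (leq_addr _ _)) _; rewrite ler_wpM2l// exprD ler_piMl//.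
    by rewrite exprn_ge0// ltW.
  by rewrite exprn_ile1// ltW.
have : mu (lim_sup_set G) = 0%E.
  apply: lim_sup_set_cvg0 => //.
  apply: (@le_lt_trans _ _ (K / (1 - z))%:E); last exact: ltry.
  apply: lime_le; first exact: is_cvg_nneseries.
  apply: nearW => n.
  apply: (@le_trans _ _ (\sum_(0 <= k < n) (geometric K z k)%:E)%E).
    by apply: lee_sum => k _; have := GK k; rewrite -lee_fin probE.
  rewrite sumEFin lee_fin; apply: geometric_le_lim => //.
  by rewrite ger0_norm ?ltW.
move=> L0; exists (lim_sup_set G); split => //.
  by apply: bigcapT_measurable => k; apply: bigcup_measurable.
move=> x /= Hx k _; apply: contrapT => Nk; apply: Hx.
exists (i0 + k)%N => i ki Fi; apply: Nk; exists (i - i0)%N => /=; first by lia.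
by rewrite /G subnKC//; lia.
Qed.

End Borel_Cantelli.

(** * Elementary estimates *)

Lemma archi_nat {R : realType} (x : R) : exists n0 : nat, forall n, (n0 <= n)%N -> x <= n%:R.
Proof.
exists (Num.truncn x).+1 => n h; apply: ltW; apply: lt_le_trans (truncnS_gt x) _.
by rewrite ler_nat.
Qed.

Lemma natr_lt_pow2 {R : realType} (i : nat) : (i%:R : R) <= 2 ^+ i.
Proof. by rewrite -natrX ler_nat ltnW// ltn_expl. Qed.

Lemma pow2_expR {R : realType} (k : nat) : (2 ^+ k : R) = expR (k%:R * ln 2).
Proof. by rewrite expRM_natl lnK// posrE. Qed.

(** The term of degree [B.+1] in the exponential series already dominates. *)
Lemma expR_beats_power {R : realType} (x : R) (B : nat) : 0 < x ->
  expR (- x) * x ^+ B <= (B.+1)`!%:R / x.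
Proof.
move=> x0; have h := expR_ge1Dxn B (ltW x0).
have f0 : 0 < (B.+1)`!%:R :> R by rewrite ltr0n fact_gt0.
have {}h : x ^+ B.+1 / (B.+1)`!%:R <= expR x by apply: le_trans h; rewrite lerDr.
rewrite expRN ler_pdivlMr// -mulrA -exprSr mulrC ler_pdivrMr ?expR_gt0//.
by move: h; rewrite ler_pdivrMr// mulrC.
Qed.

(** Estimates along the scales [2 ^ (q * i + 1)], whose successive ratios are
    bounded, extend to all times because the shortest distance is monotone. *)
Lemma dyadic_block (q n i1 : nat) : (0 < q)%N -> (2 ^ (q * i1 + 1) <= n)%N ->
  exists2 i, (i1 <= i)%N & (2 ^ (q * i + 1) <= n < 2 ^ (q * i.+1 + 1))%N.
Proof.
move=> q0 hn; have n0 : (0 < n)%N by apply: leq_trans hn; rewrite expn_gt0.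
pose k := trunc_log 2 n.
have /andP[k1 k2] := trunc_log_bounds (isT : 1 < 2)%N n0.
have hk : (q * i1 + 1 <= k)%N.
  by rewrite -ltnS -(@ltn_exp2l 2)// (leq_ltn_trans hn).
exists ((k - 1) %/ q)%N.
  by rewrite leq_divRL// mulnC; lia.
have h := divn_eq (k - 1) q; have h2 := ltn_pmod (k - 1) q0.
apply/andP; split.
  apply: leq_trans k1; rewrite leq_exp2l//; rewrite -/k; move: h; rewrite mulnC; lia.
apply: leq_trans k2 _; rewrite leq_exp2l// -/k mulnS; move: h; rewrite mulnC; lia.
Qed.

(** Cauchy-Schwarz, as the nonnegativity of the sum of the
    [(M%:R * p k - 1) ^+ 2]. *)
Lemma sum_sqr_ge {R : realFieldType} (M : nat) (p : nat -> R) :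
  \sum_(k < M) p k = 1 -> 1 <= M%:R * \sum_(k < M) p k ^+ 2.
Proof.
move=> p1.
have M0 : M%:R != 0 :> R.
  by case: M p1 => [|M _]; [rewrite big_ord0 => /eqP; rewrite eq_sym oner_eq0|rewrite pnatr_eq0].
have : 0 <= \sum_(k < M) (M%:R * p k - 1) ^+ 2 by apply: sumr_ge0 => k _; exact: sqr_ge0.
have -> : \sum_(k < M) (M%:R * p k - 1) ^+ 2 =
    M%:R ^+ 2 * \sum_(k < M) p k ^+ 2 - 2 * M%:R * \sum_(k < M) p k + M%:R.
  rewrite !mulr_sumr -sumrB -[X in _ + X](_ : \sum_(k < M) 1 = _).
    by rewrite -big_split/=; apply: eq_bigr => k _; ring.
  by rewrite sumr_const card_ord.
rewrite p1 mulr1 => H; have Mp : 0 < M%:R :> R by rewrite lt0r M0 ler0n.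
have : 0 <= M%:R * (M%:R * \sum_(k < M) p k ^+ 2 - 1).
  by apply: le_trans H _; rewrite le_eqVlt; apply/orP; left; apply/eqP; ring.
by rewrite pmulr_rge0// subr_ge0.
Qed.

(** Arithmetic of the birthday problem, with two blocks of [n] samples and cells
    of probabilities [p k]: [e] is the mean number of collisions, the double sum
    bounds its second moment, and [P] is the probability that there is none.
    Put [s = \sum_k p k ^+ 2 = sg ^+ 2].  Since [s >= 1 / M], an error
    [et <= rho / M] in the probabilities changes the main term [n ^+ 4 * s ^+ 2]
    of the second moment by a proportion of order [rho]; what is left after
    subtracting [e ^+ 2] comes from pairs of collisions that share a sample,
    and is smaller than [e ^+ 2] by a factor of order [n * sg]. *)
Lemma no_collision_arith {R : realFieldType} (M : nat) (p : nat -> R)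
    (n et rho sg P e : R) :
  (forall k, 0 <= p k) -> \sum_(k < M) p k = 1 -> 0 <= et ->
  et * M%:R <= rho -> rho <= 2^-1 ->
  0 <= sg -> sg ^+ 2 = \sum_(k < M) p k ^+ 2 -> 1 <= n * sg -> 0 < n -> 0 <= P ->
  n ^+ 2 * \sum_(k < M) p k * (p k - et) <= e ->
  P * e ^+ 2 <=
    \sum_(k < M) \sum_(l < M)
      (n * (if (k : nat) == l then p k + et else 0) +
         n ^+ 2 * ((p k + et) * (p l + et))) ^+ 2 - e ^+ 2 ->
  P <= 48 * rho + 40 / (n * sg).
Proof.
move=> p0 p1 et0 etM rho2 sg0 sgE nsg n0 P0 He HP.
set q := fun k => p k + et.
set s := \sum_(k < M) p k ^+ 2 in sgE.
have q0 k : 0 <= q k by rewrite addr_ge0.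
have Ms : 1 <= M%:R * s by exact: sum_sqr_ge.
have M0 : 0 <= M%:R :> R by rewrite ler0n.
have ets : et <= rho * s.
  have := ler_wpM2l et0 Ms; rewrite mulr1 => /le_trans; apply.
  by rewrite mulrA ler_wpM2r// /s sumr_ge0// => k _; exact: sqr_ge0.
have rho0 : 0 <= rho by apply: le_trans etM; exact: mulr_ge0.
have s1 : s <= 1.
  have psg k : (k < M)%N -> p k <= 1.
    move=> kM; rewrite -p1 (bigD1 (Ordinal kM))//= lerDl.
    by apply: sumr_ge0.
  rewrite -p1 /s; apply: ler_sum => k _.
  by rewrite expr2 ler_piMl// psg.
have sg1 : sg <= 1 by rewrite -(@expr_le1 _ 2)// sgE.
have sgp : 0 < sg by rewrite -(pmulr_rgt0 _ n0) (lt_le_trans _ nsg).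
have etsg : et <= rho * sg.
  by apply: le_trans ets _; rewrite ler_wpM2l// -sgE expr2 ler_piMl.
have qsg k : (k < M)%N -> q k <= 3/2 * sg.
  move=> kM.
  have pk : p k <= sg.
    rewrite -(@ler_pXn2r _ 2)// ?nnegrE// sgE /s (bigD1 (Ordinal kM))//= lerDl.
    by apply: sumr_ge0 => *; exact: sqr_ge0.
  have : rho * sg <= 2^-1 * sg by rewrite ler_wpM2r.
  by rewrite /q; lra.
set Q := \sum_(k < M) q k ^+ 2.
have QE : Q = s + 2 * et + M%:R * et ^+ 2.
  have -> : 2 * et = \sum_(k < M) 2 * et * p k by rewrite -mulr_sumr p1 mulr1.
  rewrite /Q /s.
  rewrite -[X in _ + X](_ : \sum_(k < M) et ^+ 2 = _).
    by rewrite -!big_split/=; apply: eq_bigr => k _; rewrite /q; ring.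
  by rewrite sumr_const card_ord mulr_natl.
have Qs : Q <= s * (1 + 3 * rho).
  have h1 : M%:R * et ^+ 2 <= rho * (rho * s).
    rewrite expr2 mulrA [M%:R * _]mulrC; apply: ler_pM => //; exact: mulr_ge0.
  have h2 : rho * (rho * s) <= 2^-1 * (rho * s).
    by rewrite ler_wpM2r// (le_trans et0).
  rewrite QE; have -> : s * (1 + 3 * rho) = s + 3 * (rho * s) by ring.
  lra.
have s0 : 0 < s by rewrite -sgE exprn_gt0.
have VE : \sum_(k < M) \sum_(l < M)
      (n * (if (k : nat) == l then p k + et else 0) +
         n ^+ 2 * ((p k + et) * (p l + et))) ^+ 2 <=
    n ^+ 4 * Q ^+ 2 + 3 * n ^+ 3 * sg * Q + n ^+ 2 * Q.
  have -> : n ^+ 4 * Q ^+ 2 + 3 * n ^+ 3 * sg * Q + n ^+ 2 * Q =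
     \sum_(k < M) (n ^+ 4 * q k ^+ 2 * Q + (3 * n ^+ 3 * sg + n ^+ 2) * q k ^+ 2).
    rewrite big_split/= -mulr_suml -[X in _ = X * Q + _]mulr_sumr -[X in _ = _ + X]mulr_sumr -/Q. ring.
  apply: ler_sum => k _.
  have -> : n ^+ 4 * q k ^+ 2 * Q = \sum_(l < M) n ^+ 4 * q k ^+ 2 * q l ^+ 2.
    by rewrite -mulr_sumr.
  rewrite (bigD1 k)//= [X in _ <= X + _](bigD1 k)//= eqxx -!/(q _).
  rewrite addrAC; apply: lerD.
    have h := qsg k (ltn_ord k).
    have : n ^+ 3 * q k ^+ 2 * q k <= n ^+ 3 * q k ^+ 2 * (3/2 * sg).
      by rewrite ler_wpM2l// mulr_ge0// exprn_ge0// ltW.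
    move=> h3; rewrite -subr_ge0.
    suff -> : forall x y : R, n ^+ 4 * x ^+ 2 * x ^+ 2 + (3 * n ^+ 3 * y + n ^+ 2) * x ^+ 2 -
       (n * x + n ^+ 2 * (x * x)) ^+ 2 = 2 * (n ^+ 3 * x ^+ 2 * (3/2 * y) - n ^+ 3 * x ^+ 2 * x).
      by rewrite mulr_ge0// subr_ge0.
    by move=> x y; field.
  apply: ler_sum => l lk.
  have -> : ((k : nat) == l) = false by rewrite eq_sym; exact/negbTE.
  by rewrite mulr0 add0r -!/(q _); apply: le_of_eq; ring.
have eE : n ^+ 2 * (s * (1 - rho)) <= e.
  apply: le_trans He; rewrite ler_pM2l ?exprn_gt0//.
  have -> : \sum_(k < M) p k * (p k - et) = s - et.
    rewrite -[et in RHS]mulr1 -p1 mulr_sumr /s -sumrB.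
    by apply: eq_bigr => k _; ring.
  by have -> : s * (1 - rho) = s - rho * s by [ring]; lra.
have {He HP VE}H : P * e ^+ 2 <= n ^+ 4 * Q ^+ 2 + 3 * n ^+ 3 * sg * Q + n ^+ 2 * Q - e ^+ 2.
  by apply: le_trans HP _; rewrite lerD2r.
set u := n * sg in nsg *.
have u2 : n ^+ 2 * s = u ^+ 2 by rewrite -sgE /u; ring.
have e1 : u ^+ 2 * (1 - rho) <= e by rewrite -u2 -mulrA.
have Q1 : n ^+ 2 * Q <= u ^+ 2 * (1 + 3 * rho).
  by rewrite -u2 -mulrA ler_pM2l ?exprn_gt0.
have Q0 : 0 <= Q by apply: sumr_ge0 => k _; exact: sqr_ge0.
have {}H : P * e ^+ 2 <= (n ^+ 2 * Q) ^+ 2 + 3 * u * (n ^+ 2 * Q) + n ^+ 2 * Q - e ^+ 2.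
  apply: le_trans H _; rewrite lerD2r; apply: le_of_eq.
  by rewrite /u; ring.
set W := n ^+ 2 * Q in Q1 H.
have W0 : 0 <= W by rewrite mulr_ge0// sqr_ge0.
have u0 : 0 < u by lra.
set U := u ^+ 2 in e1 Q1.
have U0 : 0 < U by rewrite exprn_gt0.
have e4 : U / 2 <= e.
  apply: le_trans e1; rewrite ler_pM2l//; lra.
have ee : U ^+ 2 * (1 - rho) ^+ 2 <= e ^+ 2.
  rewrite -exprMn lerXn2r ?nnegrE//.
    by rewrite mulr_ge0 ?(ltW U0)//; lra.
  by apply: le_trans e4; rewrite divr_ge0// ltW.
have WW : W ^+ 2 <= U ^+ 2 * (1 + 3 * rho) ^+ 2.
  rewrite -exprMn lerXn2r ?nnegrE//; exact: le_trans W0 Q1.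
have W52 : W <= 5 / 2 * U.
  apply: le_trans Q1 _; rewrite mulrC ler_pM2r//; lra.
have uW : u * W <= 5 / 2 * (u * U).
  by rewrite [leRHS]mulrCA ler_pM2l.
have uU : U <= u * U by rewrite ler_peMl// ltW.
have {}H : P * e ^+ 2 <= 12 * rho * U ^+ 2 + 10 * (u * U).
  apply: le_trans H _.
  have : U ^+ 2 * (1 + 3 * rho) ^+ 2 - U ^+ 2 * (1 - rho) ^+ 2 <= 12 * rho * U ^+ 2.
    have -> : U ^+ 2 * (1 + 3 * rho) ^+ 2 - U ^+ 2 * (1 - rho) ^+ 2 =
       (8 * rho + 8 * (rho * rho)) * U ^+ 2 by ring.
    rewrite ler_pM2r ?exprn_gt0//.
    have : rho * rho <= 2^-1 * rho by rewrite ler_wpM2r.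
    lra.
  lra.
have ee4 : U ^+ 2 / 4 <= e ^+ 2.
  apply: le_trans ee; rewrite ler_pM2l ?exprn_gt0//.
  rewrite (_ : 4^-1 = (2^-1) ^+ 2); last by field.
  rewrite lerXn2r ?nnegrE//; lra.
have H2 : P * (U ^+ 2 / 4) <= 12 * rho * U ^+ 2 + 10 * (u * U).
  by apply: le_trans H; rewrite ler_wpM2l.
have : P * (U ^+ 2 / 4) <= (48 * rho + 40 / u) * (U ^+ 2 / 4).
  apply: le_trans H2 _; apply: le_of_eq.
  by rewrite /U; field; rewrite gt_eqF.
by rewrite ler_pM2r// divr_gt0// exprn_gt0.
Qed.

(** * Indicators of intervals as test functions *)

Lemma is_interval_meas {R : realType} (J : set R) : is_interval J ->
  measurable (J : set (measurableTypeR R)).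
Proof. exact: is_interval_measurable. Qed.

Section indicator_variation.
Context {R : realType}.
Implicit Types (a b : R) (J : set R).

(** An interval is the difference of two up-sets, whose indicators are
    nondecreasing with variation at most 1.  The bound does not depend on [J],
    which allows decay of correlations to be used at all scales at once. *)
Lemma BV_indic_interval a b J : a < b -> is_interval J ->
  BV a b \1_J /\ BV_norm a b (\1_J) <= (b - a) + 2.
Proof.
move=> ab Jint.
pose U : set R := [set x | exists2 y, J y & y <= x].
pose V : set R := [set x | exists2 y, J y & y <= x] `\` J.
have HJ : (\1_J : R -> R) = \1_U \+ (\- \1_V).
  apply/funext => x; rewrite /= !indicE.
  have [xJ|xJ] := pselect (J x).
    rewrite (mem_set xJ) (mem_set (_ : U x)); last by exists x.
    by rewrite memNset ?subr0// => -[].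
  rewrite (memNset xJ).
  have [xU|xU] := pselect (U x).
    by rewrite (mem_set xU) (mem_set (_ : V x))// subrr.
  by rewrite (memNset xU) (memNset (_ : ~ V x)) ?subrr// => -[].
have up (W : set R) : (forall x y, W x -> x <= y -> W y) ->
    {in `[a, b] &, {homo (\1_W : R -> R) : x y / x <= y}}.
  move=> H x y _ _ xy; rewrite !indicE.
  have [Wx|Wx] := pselect (W x); last by rewrite (memNset Wx) ler0n.
  by rewrite (mem_set Wx) (mem_set (H _ _ Wx xy)).
have upU : {in `[a, b] &, {homo (\1_U : R -> R) : x y / x <= y}}.
  by apply: up => x y [z Jz zx] xy; exists z => //; exact: le_trans xy.
have upV : {in `[a, b] &, {homo (\1_V : R -> R) : x y / x <= y}}.
  apply: up => x y [[z Jz zx] NJx] xy; split.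
    by exists z => //; exact: le_trans xy.
  by move=> Jy; apply: NJx; apply: (Jint z y) => //; rewrite zx.
have TVle (W : set R) : {in `[a, b] &, {homo (\1_W : R -> R) : x y / x <= y}} ->
    (total_variation a b (\1_W : R -> R) <= 1)%E.
  move=> H; rewrite nondecreasing_total_variation//; last exact: ltW.
  rewrite lee_fin !indicE.
  by case: (b \in W); case: (a \in W); rewrite /= ?subrr ?subr0 ?sub0r ?lerN10 ?ler01.
have bvJ : bounded_variation a b (\1_J : R -> R).
  rewrite HJ; apply: bounded_variationD => //.
    exact: nondecreasing_bounded_variation.
  by apply: bounded_variationN; exact: nondecreasing_bounded_variation.
have TVJ : fine (total_variation a b (\1_J : R -> R)) <= 2.
  rewrite -lee_fin fineK; last by rewrite -bounded_variationP// ltW.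
  rewrite HJ; apply: le_trans (total_variation_le _ _ (ltW ab)) _.
  rewrite total_variationN (_ : 2%:E = 1 + 1)%E; last by rewrite -EFinD.
  by apply: leeD; exact: TVle.
have mJ := is_interval_meas Jint.
have fin_ab : (@lebesgue_measure R `[a, b] < +oo)%E.
  by rewrite lebesgue_measure_itv/= lte_fin ab -EFinD ltry.
have intJ : (@lebesgue_measure R).-integrable `[a, b] (EFin \o (\1_J : R -> R)).
  apply: measurable_bounded_integrable => //.
  exists 1; split => // M M1 x _ /=; rewrite indicE (le_trans _ (ltW M1))//.
  by case: (x \in J); rewrite ?normr1 ?normr0.
split; first by split.
rewrite /BV_norm; apply: lerD => //.
apply: (@le_trans _ _ (\int[@lebesgue_measure R]_(x in `[a, b]) 1)).
  apply: le_Rintegral => //.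
  - exact: (integrable_norm intJ).
  - apply: measurable_bounded_integrable => //.
    by exists 1; split => // M M1 x _ /=; rewrite normr1 ltW.
  - by move=> x _; rewrite indicE; case: (x \in J); rewrite ?normr1 ?normr0.
rewrite Rintegral_cst// mul1r.
by have -> : fine (@lebesgue_measure R `[a, b]) = b - a by rewrite lebesgue_measure_itv/= lte_fin ab.
Qed.

End indicator_variation.

(** * The correlation integral and a grid of cells *)

Section grid.
Context {R : realType} (a b : R).
Local Notation X := (`[a, b]%classic : set R).

Definition cell (r : R) (k : nat) : set R := `[a + k%:R * r, a + k.+1%:R * r[.

Definition ncells (r : R) : nat := (Num.truncn ((b - a) / r)).+1.

Lemma cell_interval r k : is_interval (cell r k).
Proof. exact: interval_is_interval. Qed.

Lemma cell_inj r k l x : 0 < r -> cell r k x -> cell r l x -> k = l.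
Proof.
move=> r0; rewrite /cell /= !in_itv/= => /andP[k1 k2] /andP[l1 l2].
have H i j : a + i%:R * r <= x -> x < a + j.+1%:R * r -> (i <= j)%N.
  move=> h1 h2; have : i%:R * r < j.+1%:R * r by lra.
  by rewrite ltr_pM2r// ltr_nat ltnS.
by apply/eqP; rewrite eqn_leq !H.
Qed.

Lemma cell_cover r x : 0 < r -> X x -> exists2 k, (k < ncells r)%N & cell r k x.
Proof.
move=> r0; rewrite /= in_itv/= => /andP[ax xb].
have h0 : 0 <= (x - a) / r by rewrite divr_ge0 ?(ltW r0)// subr_ge0.
exists (Num.truncn ((x - a) / r)).
  rewrite /ncells ltnS truncn_le_nat; apply: le_lt_trans (truncnS_gt _).
  by rewrite ler_pM2r ?invr_gt0//; lra.
have /andP[h1 h2] := truncn_itv h0.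
rewrite /cell /= in_itv/=; move: h1 h2; rewrite ler_pdivlMr// ltr_pdivrMr//.
by move=> h1 h2; apply/andP; split; lra.
Qed.

Lemma cell_close r k x y : cell r k x -> cell r k y -> `|x - y| < r.
Proof.
rewrite /cell /= !in_itv/= => /andP[k1 k2] /andP[l1 l2].
by rewrite ltr_norml; move: k2 l2; rewrite -natr1 mulrDl; lra.
Qed.

Lemma close_cells r k l x y : 0 < r -> cell r k x -> cell r l y ->
  `|x - y| < r -> (k <= l.+1)%N && (l <= k.+1)%N.
Proof.
move=> r0; rewrite /cell /= !in_itv/= ltr_norml.
move=> /andP[k1 k2] /andP[l1 l2] /andP[h1 h2].
have H i j : a + i%:R * r < a + j.+1%:R * r + r -> (i <= j.+1)%N.
  move=> h; have : i%:R * r < j.+2%:R * r.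
    by rewrite -[j.+2%:R]natr1 mulrDl; lra.
  by rewrite ltr_pM2r// ltr_nat ltnS.
by rewrite !H//; lra.
Qed.

Lemma ncells_le r : 0 < r -> a <= b -> (ncells r)%:R <= (b - a) / r + 1.
Proof.
move=> r0 ab; rewrite /ncells -natr1 lerD2r.
have : 0 <= (b - a) / r by rewrite divr_ge0 ?(ltW r0)// subr_ge0.
by move=> /truncn_itv/andP[].
Qed.

End grid.

Lemma neighbours_le3 (M l : nat) :
  (\sum_(k < M) ((k <= l.+1) && (l <= k.+1)) <= 3)%N.
Proof.
have H (j : nat) : (\sum_(k < M) ((k : nat) == j) <= 1)%N.
  elim: M => [|M IH]; first by rewrite big_ord0.
  rewrite big_ord_recr/=; case: (eqVneq M j) => [Mj|_]; last by rewrite addn0.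
  rewrite big1// => i _; apply/eqP; rewrite eqb0; apply/negP => /eqP ij.
  by have := ltn_ord i; rewrite ij -Mj ltnn.
apply: (@leq_trans (\sum_(k < M) (((k : nat) == l.-1) + (((k : nat) == l) + ((k : nat) == l.+1)))%N)).
  by apply: leq_sum => -[k kM] _ /=; lia.
rewrite !big_split/=; apply: (@leq_trans (1 + (1 + 1))) => //.
by rewrite !leq_add.
Qed.

Section correlation_integral.
Context {R : realType} (a b : R).
Context (mu : probability (measurableTypeR R) R).
Local Notation X := (`[a, b]%classic : set R).
Local Notation prob := (prob mu).
Hypothesis muX : mu X = 1%E.

Lemma measurable_ball (x r : R) : measurable (ball x r : set (measurableTypeR R)).
Proof. by rewrite ball_itv; exact: measurable_itv. Qed.

(** The ball at [x] is the section at [x] of a measurable subset of the plane. *)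
Lemma measurable_mu_ball (r : R) :
  @measurable_fun _ _ (measurableTypeR R) _ X (fun x => mu (ball x r)).
Proof.
pose A : set (measurableTypeR R * measurableTypeR R) :=
  (fun p => p.1 - p.2 : R) @^-1` (ball 0 r).
have mA : measurable A.
  have mf : measurable_fun setT
     (fun p : measurableTypeR R * measurableTypeR R => (p.1 - p.2 : measurableTypeR R)).
    apply: measurable_funB; [exact: measurable_fst|exact: measurable_snd].
  by have := mf measurableT _ (measurable_ball 0 r); rewrite setTI.
have mx : @measurable_fun _ _ (measurableTypeR R) _ X (fun x => mu (xsection A x)).
  by apply: measurable_funTS; apply: (measurable_fun_xsection mu mA).
congr (@measurable_fun _ _ _ _ _ _) : mx; apply/funext => x; congr (mu _).
apply/seteqP; split=> y; rewrite /xsection /A /ball /=.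
  by rewrite inE /= sub0r normrN.
by move=> h; rewrite inE /= sub0r normrN.
Qed.

Lemma sum_prob_cells (r : R) : 0 < r -> \sum_(k < ncells a b r) prob (cell a r k) = 1.
Proof.
move=> r0.
have mc k : measurable (cell a r k : set (measurableTypeR R)).
  by apply: is_interval_meas; exact: cell_interval.
rewrite -prob_bigU_triv//; last by move=> k l x; exact: cell_inj.
apply: (@prob_eq1_mono _ _ X) => //; first exact: bigsetU_measurable.
  move=> x Xx; have [k kM ck] := cell_cover r0 Xx.
  by rewrite -(bigcup_mkord _ (cell a r)); exists k.
by rewrite /prob muX.
Qed.

Lemma integral_step (M : nat) (g : nat -> R) (J : nat -> set R) :
  (forall k, 0 <= g k) -> (forall k, measurable (J k : set (measurableTypeR R))) ->
  (\int[mu]_(x in X) (\sum_(k < M) g k * \1_(J k) x)%:E)%E =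
    (\sum_(k < M) g k * prob (J k))%:E.
Proof.
move=> g0 mJ; have mX : measurable (X : set (measurableTypeR R)) by exact: measurable_itv.
under eq_integral => x _ do rewrite -sumEFin.
rewrite (@ge0_integral_sum _ (measurableTypeR R) _ mu X mX 'I_M
   (fun k x => (g k * \1_(J k) x)%:E)).
- rewrite -sumEFin; apply: eq_bigr => k _.
  under eq_integral => x _ do rewrite EFinM.
  rewrite ge0_integralZl_EFin//.
  + rewrite integral_indic// EFinM; congr (_ * _)%E.
    have pX : prob X = 1 by rewrite /prob muX.
    rewrite -(probI1 (mJ k) mX pX) probE//; exact: measurableI.
  + by apply/measurable_EFinP; exact: measurable_indic.
- move=> k; apply/measurable_EFinP; exact: measurable_funM.
- by move=> k x _; rewrite lee_fin mulr_ge0.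
Qed.

(** Points of the same cell are [r]-close, and [r]-close points lie in
    neighbouring cells.  The contribution of neighbours is reduced to the
    diagonal one by [p k * p l <= (p k ^+ 2 + p l ^+ 2) / 2], each cell having
    at most three neighbours. *)
Lemma correlation_integral_bounds (r : R) : 0 < r ->
  ((\sum_(k < ncells a b r) prob (cell a r k) ^+ 2)%:E <=
     \int[mu]_(x in X) mu (ball x r) <=
   (3 * \sum_(k < ncells a b r) prob (cell a r k) ^+ 2)%:E)%E.
Proof.
move=> r0; set M := ncells a b r; set J := cell a r.
have mX : measurable (X : set (measurableTypeR R)) by exact: measurable_itv.
have pX : prob X = 1 by rewrite /prob muX.
have mJ k : measurable (J k : set (measurableTypeR R)).
  by apply: is_interval_meas; exact: cell_interval.
have sumJ (g : nat -> R) k x : (k < M)%N -> J k x ->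
    \sum_(l < M) g l * \1_(J l) x = g k.
  move=> kM Jk; rewrite (bigD1 (Ordinal kM))//= indicE mem_set// mulr1.
  rewrite big1 ?addr0// => l lk; rewrite indicE memNset ?mulr0// => Jl.
  by move/eqP: lk; apply; apply: val_inj; exact: (cell_inj r0 Jl Jk).
have mstep (g : nat -> R) : @measurable_fun _ _ (measurableTypeR R) _ X
    (fun x => (\sum_(k < M) g k * \1_(J k) x)%:E).
  apply/measurable_EFinP; apply: measurable_sum => k.
  by apply: measurable_funM => //; exact: measurable_indic.
have mb := measurable_mu_ball r.
apply/andP; split.
  have -> : \sum_(k < M) prob (J k) ^+ 2 = \sum_(k < M) prob (J k) * prob (J k).
    by apply: eq_bigr => k _; rewrite expr2.
  rewrite -(@integral_step M (fun k => prob (J k)) J)//; last by move=> k; exact: prob_ge0.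
  apply: ge0_le_integral => //.
  - move=> x _; rewrite lee_fin; apply: sumr_ge0 => k _.
    by rewrite mulr_ge0 ?prob_ge0.
  - exact: (mstep (fun k => prob (J k))).
  - move=> x Xx; have [k kM Jk] := cell_cover r0 Xx.
    rewrite (sumJ (fun k => prob (J k)) k)// probE//.
    apply: le_measure; rewrite ?inE//; first exact: measurable_ball.
    by move=> y Jy; rewrite /ball/=; exact: (cell_close Jk Jy).
pose nb k := \sum_(l < M) ((k <= l.+1)%N && (l <= k.+1)%N)%:R * prob (J l).
have nb0 k : 0 <= nb k by apply: sumr_ge0 => l _; rewrite mulr_ge0 ?prob_ge0.
apply: (@le_trans _ _ (\int[mu]_(x in X) (\sum_(k < M) nb k * \1_(J k) x)%:E)%E).
  apply: ge0_le_integral => //.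
  move=> x Xx; have [k kM Jk] := cell_cover r0 Xx.
  rewrite (sumJ nb k)// -probE; last exact: measurable_ball.
  rewrite lee_fin; apply: (@le_trans _ _ (prob (\big[setU/set0]_(l < M | (k <= l.+1)%N && (l <= k.+1)%N) J l))).
    have mU : measurable (\big[setU/set0]_(l < M | (k <= l.+1)%N && (l <= k.+1)%N) J l
       : set (measurableTypeR R)) by exact: bigsetU_measurable.
    rewrite -(probI1 (measurable_ball x r) mX pX).
    apply: prob_mono => //; first by apply: measurableI => //; exact: measurable_ball.
    move=> y [xy Xy]; have [l lM Jl] := cell_cover r0 Xy.
    rewrite (bigD1 (Ordinal lM))/=; first by left.
    exact: (close_cells r0 Jk Jl).
  apply: le_trans (prob_bigU_le _ _ _ (fun l : 'I_M => mJ l)) _.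
  rewrite /nb big_mkcond/=; apply: ler_sum => l _.
  by case: ifP; rewrite ?mul1r// mul0r.
rewrite integral_step// lee_fin.
pose w (k l : nat) : R := ((k <= l.+1)%N && (l <= k.+1)%N)%:R.
have wsym k l : w k l = w l k by rewrite /w andbC.
have w3 l : \sum_(k < M) w k l <= 3.
  by rewrite /w -natr_sum ler_nat neighbours_le3.
have H (p : nat -> R) : \sum_(k < M) \sum_(l < M) w k l * p l ^+ 2 <=
    3 * \sum_(k < M) p k ^+ 2.
  rewrite exchange_big mulr_sumr; apply: ler_sum => l _.
  by rewrite -mulr_suml ler_wpM2r ?sqr_ge0.
set p := fun k => prob (J k).
have H' : \sum_(k < M) \sum_(l < M) w k l * p k ^+ 2 <= 3 * \sum_(k < M) p k ^+ 2.
  rewrite exchange_big; apply: le_trans (H p); apply: le_of_eq.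
  by apply: eq_bigr => k _; apply: eq_bigr => l _; rewrite wsym.
have : \sum_(k < M) nb k * p k <=
   2^-1 * (\sum_(k < M) \sum_(l < M) w k l * p l ^+ 2 +
      \sum_(k < M) \sum_(l < M) w k l * p k ^+ 2).
  rewrite -big_split/= mulr_sumr; apply: ler_sum => k _.
  rewrite -big_split/= mulr_sumr /nb mulr_suml; apply: ler_sum => l _.
  rewrite -/(w k l) -/(p l).
  have h : p l * p k <= 2^-1 * (p l ^+ 2 + p k ^+ 2).
    by have := sqr_ge0 (p k - p l); nra.
  have := ler_wpM2l (ler0n R ((k <= l.+1)%N && (l <= k.+1)%N)) h.
  by rewrite -/(w k l); lra.
move=> /le_trans; apply; have := H p; have := H'; rewrite /p; lra.
Qed.

End correlation_integral.

(** * Correlation dimensions *)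

Section limsup.
Context {R : realType}.
Local Open Scope ereal_scope.

Lemma limf_esup_le {U : choiceType} {V : filteredType U} (f : V -> \bar R)
    (F : set (set V)) u : F [set x | f x <= u] -> limf_esup f F <= u.
Proof.
move=> Fu; apply: le_trans (ereal_inf_lbound _) _; first by exists [set x | f x <= u].
by apply: ge_ereal_sup => _ [x /= xu <-].
Qed.

Lemma limf_esup_ge {U : choiceType} {V : filteredType U} (f : V -> \bar R)
    (F : set (set V)) u : ProperFilter F -> F [set x | u <= f x] -> u <= limf_esup f F.
Proof.
move=> PF Fu; apply: le_ereal_inf_tmp => _ [W FW <-].
have /filter_ex[x [/= ux Wx]] : F ([set x | u <= f x] `&` W) by exact: filterI.
by apply: le_trans ux _; apply: ereal_sup_ubound; exists x.
Qed.

Lemma limf_esup_lt {U : choiceType} {V : filteredType U} (f : V -> \bar R)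
    (F : set (set V)) u : Filter F -> limf_esup f F < u -> F [set x | f x < u].
Proof.
move=> FF /ereal_inf_ltP[_ [W FW <-] Wu].
apply: filterS FW => x Wx /=; apply: le_lt_trans Wu.
by apply: ereal_sup_ubound; exists x.
Qed.

End limsup.

Section division.
Context {R : realType}.
Local Open Scope ereal_scope.

Lemma div_neg (y : \bar R) (r : R) : (r < 0)%R -> y / r%:E = y * (r^-1)%:E.
Proof. by move=> r0; rewrite inver lt_eqF. Qed.

Lemma le_div_neg (y : \bar R) (t r : R) : (r < 0)%R ->
  y <= (t * r)%:E -> t%:E <= y / r%:E.
Proof.
move=> r0; have ri : (r^-1 < 0)%R by rewrite invr_lt0.
rewrite div_neg//; case: y => [y| |].
- by rewrite -EFinM !lee_fin ler_ndivlMr.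
- by rewrite leye_eq.
- by move=> _; rewrite mulNyr ltr0_sg// EFinN mulN1e /= leey.
Qed.

Lemma ge_div_neg (y : \bar R) (t r : R) : (r < 0)%R ->
  (t * r)%:E <= y -> y / r%:E <= t%:E.
Proof.
move=> r0; have ri : (r^-1 < 0)%R by rewrite invr_lt0.
rewrite div_neg//; case: y => [y| |].
- by rewrite -EFinM !lee_fin ler_ndivrMr.
- by move=> _; rewrite mulyr ltr0_sg// EFinN mulN1e leNye.
- by rewrite leeNy_eq.
Qed.

Lemma lne_powR (n : nat) (t : R) : (0 < n)%N ->
  lne (n%:R `^ (- t))%:E = (t * (- ln n%:R))%:E.
Proof.
move=> n0; rewrite lne_EFin ?powR_gt0 ?ltr0n//.
by rewrite ln_powR mulrN mulNr.
Qed.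

Lemma lne_le (x y : \bar R) : 0 <= x -> x <= y -> lne x <= lne y.
Proof.
move=> x0 xy; rewrite lee_lne// in_itv/= ?x0 ?leey//.
by rewrite (le_trans x0 xy).
Qed.

End division.

Lemma limn_einf_ge {R : realType} (u : nat -> \bar R) (L : R) :
  (forall j : nat, exists n0, forall n, (n0 <= n)%N -> ((L - j.+1%:R^-1)%:E <= u n)%E) ->
  (L%:E <= limn_einf u)%E.
Proof.
move=> H; apply/lee_subgt0Pr => e e0.
have [j0 Hj] := archi_nat e^-1.
have je : (j0.+1%:R^-1 : R) <= e.
  rewrite -[leRHS]invrK lef_pV2 ?posrE ?invr_gt0//; exact: Hj.
have [n0 Hn] := H j0.
rewrite /limn_einf leeNr -EFinB -EFinN; apply: limf_esup_le.
exists n0 => // n /= nn; rewrite EFinN leeN2.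
by apply: le_trans (Hn n nn); rewrite lee_fin lerD2l lerN2.
Qed.

Section dimensions.
Context {R : realType} (a b : R) (mu : probability (measurableTypeR R) R).
Local Notation X := (`[a, b]%classic : set R).
Local Notation prob := (prob mu).
Hypothesis ab : a < b.
Hypothesis muX : mu X = 1%E.
Local Notation corr r := (\int[mu]_(x in X) mu (ball x r))%E.

Lemma near0 (r0 : R) (Q : R -> Prop) : 0 < r0 -> (forall r, 0 < r < r0 -> Q r) ->
  \forall r \near 0^'+, Q r.
Proof.
move=> r00 H; near=> r; apply: H; apply/andP; split.
  by near: r; exact: nbhs_right_gt.
by near: r; exact: nbhs_right_lt.
Unshelve. all: by end_near. Qed.

Lemma near0P (Q : R -> Prop) : (\forall r \near 0^'+, Q r) ->
  exists2 r0 : R, 0 < r0 & forall r, 0 < r < r0 -> Q r.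
Proof.
rewrite /at_right /within /= => /nbhs_ballP[d /= d0 H].
exists d => // r /andP[r0 rd]; apply: H => //.
by rewrite /ball/= sub0r normrN ger0_norm// ltW.
Qed.

(** Cauchy-Schwarz over the cells, of which there are at most
    [(b - a) / r + 1]. *)
Lemma corr_ge (r : R) : 0 < r -> ((r / (b - a + r))%:E <= corr r)%E.
Proof.
move=> r0; have /andP[+ _] := correlation_integral_bounds muX r0.
apply: le_trans; rewrite lee_fin.
have := @sum_sqr_ge R (ncells a b r) (fun k => prob (cell a r k)) (sum_prob_cells muX r0).
rewrite /=.
set s := \sum_(k < _) _ => h.
have Mle := ncells_le r0 (ltW ab).
have s0 : 0 <= s by apply: sumr_ge0 => k _; exact: sqr_ge0.
have d0 : 0 < b - a + r by rewrite addr_gt0// subr_gt0.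
rewrite ler_pdivrMr//.
have : 1 <= ((b - a) / r + 1) * s by apply: le_trans h _; rewrite ler_wpM2r.
move=> h2; have : r * 1 <= r * (((b - a) / r + 1) * s) by rewrite ler_pM2l.
have -> : r * (((b - a) / r + 1) * s) = s * (b - a + r) by field; rewrite gt_eqF.
by rewrite mulr1.
Qed.

Lemma small_power (K e : R) : 0 < K -> 0 < e ->
  exists2 r0 : R, 0 < r0 <= 1 & forall r, 0 < r < r0 -> K * expR (e * ln r) <= 1.
Proof.
move=> K0 e0; exists (Num.min 1 (expR (- ln K / e))).
  by rewrite lt_min ltr01 expR_gt0 ge_min lexx.
move=> r /andP[r0]; rewrite lt_min => /andP[_ h].
rewrite -[X in X * _]lnK ?posrE// -expRD -[leRHS]expR0 ler_expR.
have : ln r < - ln K / e by rewrite -ltr_expR lnK ?posrE.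
by rewrite ltr_pdivlMr// mulrC; lra.
Qed.

Lemma correlation_ratio_le (e : R) : 0 < e ->
  \forall r \near 0^'+, (correlation_ratio X mu r <= (1 + e)%:E)%E.
Proof.
move=> e0; have ba0 : 0 < b - a + 1 by rewrite addr_gt0// subr_gt0.
have [r0 /andP[r00 r01] H] := small_power ba0 e0.
apply: (near0 r00) => r /[dup] rr /andP[rp rlt].
have r1 : r < 1 by exact: lt_le_trans r01.
apply: ge_div_neg; first by rewrite ln_lt0// rp.
have -> : ((1 + e) * ln r)%:E = lne (expR ((1 + e) * ln r))%:E.
  by rewrite lne_EFin ?expR_gt0// expRK.
apply: lne_le; first by rewrite lee_fin expR_ge0.
apply: le_trans (corr_ge rp); rewrite lee_fin mulrDl mul1r expRD lnK ?posrE//.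
rewrite ler_pM2l// -[leRHS]div1r ler_pdivlMr; last by rewrite addr_gt0// subr_gt0.
apply: le_trans (H r rr); rewrite mulrC ler_wpM2r ?expR_ge0//; lra.
Qed.

Lemma upper_correlation_dim_le1 : (upper_correlation_dim X mu <= 1)%E.
Proof.
apply/lee_addgt0Pr => e e0; apply: limf_esup_le.
exact: correlation_ratio_le.
Qed.

(** As [ln r < 0], a ratio below [theta] means an integral above [r `^ theta]. *)
Lemma upper_dim_power (theta : R) : (upper_correlation_dim X mu < theta%:E)%E ->
  exists2 r0 : R, 0 < r0 &
    forall r, 0 < r < r0 -> ((r `^ theta)%:E <= \int[mu]_(x in X) mu (ball x r))%E.
Proof.
move=> h.
have : \forall r \near 0^'+, (correlation_ratio X mu r < theta%:E)%E.
  exact: (limf_esup_lt _ h).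
move=> /near0P[r0 r00 H]; exists (Num.min r0 1); first by rewrite lt_min r00 ltr01.
move=> r /andP[rp]; rewrite lt_min => /andP[rr0 r1].
have {}H := H r; rewrite rp rr0 in H; have {}H := H isT.
rewrite leNgt; apply/negP => lt; move: H; apply/negP; rewrite -leNgt.
apply: le_div_neg; first by rewrite ln_lt0// rp.
rewrite -ln_powR -lne_EFin ?powR_gt0//; apply: lne_le; last exact: ltW.
by apply: integral_ge0.
Qed.

Variable K1 : R.
Hypothesis K10 : 0 < K1.
Hypothesis dens : forall x l, 0 <= l -> prob `[x - l, x + l] <= K1 * l.

Lemma corr_le (r : R) : 0 < r -> (corr r <= (K1 * r)%:E)%E.
Proof.
move=> r0; have mX : measurable (X : set (measurableTypeR R)) by exact: measurable_itv.
apply: (@le_trans _ _ (\int[mu]_(x in X) (cst (K1 * r)%:E) x)%E).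
  apply: ge0_le_integral => //.
  - exact: measurable_mu_ball.
  - move=> x _; rewrite -probE; last exact: measurable_ball.
    rewrite lee_fin; apply: le_trans (dens x (ltW r0)).
    apply: prob_mono; [exact: measurable_ball|exact: measurable_itv|].
    by rewrite ball_itv; apply: subset_itv; rewrite bnd_simp.
rewrite integral_cst// [X in (_ * X)%E](_ : _ = 1%E) ?mule1//; exact: muX.
Qed.

Lemma correlation_ratio_ge (e : R) : 0 < e ->
  \forall r \near 0^'+, ((1 - e)%:E <= correlation_ratio X mu r)%E.
Proof.
move=> e0; have [r0 /andP[r00 r01] H] := small_power K10 e0.
apply: (near0 r00) => r /[dup] rr /andP[rp rlt].
have r1 : r < 1 by exact: lt_le_trans r01.
apply: le_div_neg; first by rewrite ln_lt0// rp.
have -> : ((1 - e) * ln r)%:E = lne (expR ((1 - e) * ln r))%:E.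
  by rewrite lne_EFin ?expR_gt0// expRK.
apply: lne_le; first by apply: integral_ge0.
apply: le_trans (corr_le rp) _; rewrite lee_fin mulrBl mul1r expRD lnK ?posrE//.
by rewrite mulrC ler_pM2l// expRN -[leRHS]div1r ler_pdivlMr ?expR_gt0//; exact: H.
Qed.

(** A bounded density makes the correlation integral at most linear in [r], and
    [corr_ge] makes it at least linear. *)
Lemma correlation_dims_eq1 : lower_correlation_dim X mu = 1%E /\
  upper_correlation_dim X mu = 1%E.
Proof.
have up : (1 <= upper_correlation_dim X mu)%E.
  apply/lee_subgt0Pr => e e0; apply: limf_esup_ge.
  exact: correlation_ratio_ge.
split; apply/eqP; rewrite eq_le; last by rewrite upper_correlation_dim_le1.
apply/andP; split; rewrite /lower_correlation_dim /limf_einf.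
  apply/lee_addgt0Pr => e e0; rewrite leeNl -EFinD -EFinN; apply: limf_esup_ge.
  have := correlation_ratio_le e0; apply: filterS => r /= h.
  by rewrite EFinN leeN2.
apply/lee_subgt0Pr => e e0; rewrite leeNr -EFinB -EFinN; apply: limf_esup_le.
have := correlation_ratio_ge e0; apply: filterS => r /= h.
by rewrite EFinN leeN2.
Qed.

End dimensions.

(** * Visits and returns of orbits *)

Section orbits.
Context {R : realType} (a b : R) (T : R -> R).
Context (mu : probability (measurableTypeR R) R).
Local Notation X := (`[a, b]%classic : set R).
Local Notation prob := (prob mu).

(** The points of [X] that are in [B] at time [t].  Intersecting with [X] keeps
    this set measurable, because [T] is only known to be measurable on [X]. *)
Definition vis t (B : set R) : set R := X `&` iter t T @^-1` B.

Definition near_return (r : R) (i j : nat) : set R :=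
  X `&` [set x | `|iter i T x - iter j T x| < r].

Definition far (n : nat) (r : R) : set R :=
  X `&` [set x | forall i j, (i < j < n)%N -> r <= `|iter i T x - iter j T x|].

Lemma visI t B C : vis t (B `&` C) = vis t B `&` vis t C.
Proof. by apply/seteqP; split=> x; [case=> ? [? ?]|case=> -[? ?] [_ ?]]; split. Qed.

Lemma far_mono n n' r r' : (n' <= n)%N -> r' <= r -> far n r `<=` far n' r'.
Proof.
move=> nn rr x [Xx H]; split => // i j /andP[ij jn].
by apply: le_trans rr _; apply: H; rewrite ij (leq_trans jn).
Qed.

Hypothesis TX : set_fun X X T.

Lemma iter_X t x : X x -> X (iter t T x).
Proof. by move=> Xx; elim: t => //= t IH; exact: TX. Qed.

Lemma vis_vis t s B : vis t (vis s B) = vis (t + s) B.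
Proof.
apply/seteqP; split=> x [Xx].
  by move=> [_]; rewrite /= -iterD addnC => ?; split.
by rewrite /= addnC iterD => ?; split => //; split => //; exact: iter_X.
Qed.

Lemma near_return_vis r i j : (i <= j)%N ->
  near_return r i j = vis i (near_return r 0 (j - i)).
Proof.
move=> ij; apply/seteqP; split=> x.
  move=> [Xx h]; split => //; split; first exact: iter_X.
  by rewrite /= -iterD subnK.
by move=> [Xx [_]]; rewrite /= -iterD subnK// => h; split.
Qed.

Hypothesis mT : @measurable_fun _ _ (measurableTypeR R) (measurableTypeR R) X T.

Lemma measurable_X : measurable (X : set (measurableTypeR R)).
Proof. exact: measurable_itv. Qed.

Lemma measurable_vis t (B : set (measurableTypeR R)) :
  measurable B -> measurable (vis t B : set (measurableTypeR R)).
Proof.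
move=> mB; elim: t => [|t IH]; first exact: (measurableI _ _ measurable_X).
have := mT measurable_X IH.
suff -> : vis t.+1 B = X `&` T @^-1` vis t B by [].
by rewrite -[X in X = _](vis_vis 1 t).
Qed.

Lemma measurable_iter t :
  @measurable_fun _ _ (measurableTypeR R) (measurableTypeR R) X (iter t T).
Proof. by move=> _ B mB; exact: measurable_vis. Qed.

Lemma measurable_near_return r i j :
  measurable (near_return r i j : set (measurableTypeR R)).
Proof.
have mX : measurable (X : set (measurableTypeR R)) by exact: measurable_itv.
have mf : @measurable_fun _ _ (measurableTypeR R) (measurableTypeR R) X
    (fun x => iter i T x - iter j T x).
  by apply: measurable_funB; exact: measurable_iter.
have := mf mX _ (measurable_ball 0 r).
congr (measurable _); apply/seteqP; split=> x [Xx]; rewrite /ball/= sub0r normrN => h;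
  by split.
Qed.

Lemma far_bigcup n r :
  far n r = X `\` \big[setU/set0]_(j < n) \big[setU/set0]_(i < j) near_return r i j.
Proof.
apply/seteqP; split=> x [Xx H]; split => //.
  rewrite -(bigcup_mkord n (fun j => \big[setU/set0]_(i < j) near_return r i j)).
  move=> [j /= jn]; rewrite -(bigcup_mkord j (fun i => near_return r i j)).
  by move=> [i /= ij [_ /=]]; rewrite ltNge H// ij.
move=> i j /andP[ij jn]; rewrite leNgt; apply/negP => h; apply: H.
rewrite -(bigcup_mkord n (fun j => \big[setU/set0]_(i < j) near_return r i j)).
exists j => //=; rewrite -(bigcup_mkord j (fun i => near_return r i j)).
by exists i.
Qed.

Lemma measurable_far n r : measurable (far n r : set (measurableTypeR R)).
Proof.
rewrite far_bigcup; apply: measurableD; first exact: measurable_itv.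
by apply: bigsetU_measurable => j _; apply: bigsetU_measurable => i _;
  exact: measurable_near_return.
Qed.

Hypothesis muX : mu X = 1%E.

Lemma probX : prob X = 1.
Proof. by rewrite /prob muX. Qed.

Lemma probXI (B : set (measurableTypeR R)) : measurable B ->
  prob (X `&` B) = prob B.
Proof.
by move=> mB; rewrite setIC probI1// ?probX//; exact: measurable_X.
Qed.

(** The error is proportional to [prob B]; this lets the estimate be iterated
    along several times without losing precision on small sets. *)
Lemma decay_intervals : a < b -> exp_decay_BV_L1 a b T mu ->
  exists C c : R, [/\ 0 < C, 0 < c & forall (J : set R) (B : set (measurableTypeR R)) t,
    is_interval J -> measurable B ->
    `|prob (J `&` vis t B) - prob J * prob B| <= C * expR (- (c * t%:R)) * prob B].
Proof.
move=> ab [C1 [c1 [C10 c10 H]]].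
exists (C1 * (b - a + 2)), c1; split => //.
  by rewrite mulr_gt0// addr_gt0// subr_gt0.
move=> J B t Jint mB; have mJ := is_interval_meas Jint.
have [bvJ nJ] := BV_indic_interval ab Jint.
have mX := measurable_X.
have intI (A : set (measurableTypeR R)) : measurable A ->
    mu.-integrable X (EFin \o (\1_A : R -> R)).
  move=> mA; apply: (@measurable_bounded_integrable _ (measurableTypeR R)) => //.
  - by apply: le_lt_trans (probability_le1 mu _) (ltry _).
  - exists 1; split => // M M1 x _ /=; rewrite indicE (le_trans _ (ltW M1))//.
    by case: (x \in A); rewrite ?normr1 ?normr0.
have Iind (A : set (measurableTypeR R)) : measurable A ->
    \int[mu]_(x in X) (\1_A x : R) = prob A.
  by move=> mA; rewrite /Rintegral integral_indic// -(probXI mA) setIC.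
have := H (\1_J) (\1_B) t bvJ (intI _ mB).
rewrite !Iind// -[X in _ * _ * _ * X](_ : prob B = _); last first.
  rewrite -(Iind _ mB); apply: eq_Rintegral => x _; rewrite indicE.
  by case: (x \in B); rewrite ?normr1 ?normr0.
have -> : \int[mu]_(x in X) (\1_J x * \1_B (iter t T x)) = prob (J `&` vis t B).
  rewrite -Iind; last by apply: measurableI => //; exact: measurable_vis.
  apply: eq_Rintegral => x; rewrite inE => Xx; rewrite !indicE in_setI.
  have -> : (x \in vis t B) = (iter t T x \in B).
    by apply/idP/idP; rewrite !inE; [case|split].
  by case: (x \in J); rewrite ?mul1r ?mul0r.
move=> /le_trans; apply.
rewrite ler_wpM2r ?prob_ge0// mulrAC ler_wpM2r ?expR_ge0//.
by rewrite ler_wpM2l// ltW.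
Qed.

Hypothesis muT : forall A : set (measurableTypeR R), measurable A ->
    mu (X `&` T @^-1` A) = mu A.

Lemma prob_vis t (B : set (measurableTypeR R)) : measurable B ->
  prob (vis t B) = prob B.
Proof.
move=> mB; elim: t => [|t IH]; first exact: probXI.
rewrite -IH -[in LHS](vis_vis 1 t) /prob muT//; exact: measurable_vis.
Qed.

Variable Kr : R.
Hypothesis Kr0 : 0 < Kr.
Hypothesis Hret : forall k r, (0 < k)%N -> 0 < r -> prob (near_return r 0 k) <= Kr * r.

Lemma prob_not_far n r : 0 < r -> prob (X `\` far n r) <= n%:R ^+ 2 * (Kr * r).
Proof.
move=> r0; rewrite far_bigcup setDD.
have mR i j : measurable (near_return r i j : set (measurableTypeR R)).
  exact: measurable_near_return.
have mU j : measurable (\big[setU/set0]_(i < j) near_return r i j : set (measurableTypeR R)).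
  exact: bigsetU_measurable.
rewrite probXI; last exact: bigsetU_measurable.
apply: le_trans (prob_bigU_le _ _ _ (fun j : 'I_n => mU j)) _.
have -> : n%:R ^+ 2 * (Kr * r) = \sum_(j < n) (n%:R * (Kr * r)).
  by rewrite sumr_const card_ord -[RHS]mulr_natl expr2 -mulrA.
apply: ler_sum => j _.
apply: le_trans (prob_bigU_le _ _ _ (fun i : 'I_j => mR i j)) _.
apply: (@le_trans _ _ (\sum_(i < j) (Kr * r))).
  apply: ler_sum => i _; rewrite near_return_vis; last exact: ltnW.
  rewrite prob_vis//; apply: Hret => //.
  by rewrite subn_gt0.
rewrite sumr_const card_ord -[leLHS]mulr_natl ler_wpM2r ?mulr_ge0 ?(ltW Kr0) ?(ltW r0)//.
by rewrite ler_nat ltnW.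
Qed.

(** Borel-Cantelli along the times [2 ^ i.+1] at the scales
    [(2 ^ i) `^ (- t)]; the bound of [prob_not_far] is then geometric of ratio
    [2 `^ (2 - t)]. *)
Lemma eventually_far (t : R) : 2 < t ->
  {ae mu, forall x, exists n0, forall n, (n0 <= n)%N -> X x ->
     far n (n%:R `^ (- t)) x}.
Proof.
move=> t2.
pose l : R := ln 2; have l0 : 0 < l by rewrite ln_gt0// ltr1n.
pose r (i : nat) := expR (- (t * (i%:R * l))).
have r0 i : 0 < r i by exact: expR_gt0.
pose F (i : nat) := X `\` far (2 ^ i.+1) (r i).
have mF i : measurable (F i : set (measurableTypeR R)).
  by apply: measurableD; [exact: measurable_itv|exact: measurable_far].
pose z := expR ((2 - t) * l).
have z01 : 0 < z < 1.
  by rewrite expR_gt0/= -[ltRHS]expR0 ltr_expR pmulr_llt0// subr_lt0.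
have bound i : (0 <= i)%N -> prob (F i) <= (4 * Kr) * z ^+ i.
  move=> _; apply: le_trans (prob_not_far _ (r0 i)) _.
  apply: le_of_eq; rewrite natrX [2 ^+ i.+1]exprS exprMn.
  have -> : z ^+ i = (2 ^+ i) ^+ 2 * r i.
    rewrite pow2_expR -/l -expRM_natl -expRM_natl /r -expRD; congr expR.
    by rewrite /=; ring.
  by ring.
have := Borel_Cantelli_geometric z01 mF bound.
apply: ae_imply => x [i1 H]; exists (2 ^ i1)%N => n hn Xx.
have n0 : (0 < n)%N by apply: leq_trans hn; rewrite expn_gt0.
have /andP[k1 k2] := trunc_log_bounds (isT : 1 < 2)%N n0.
set i := trunc_log 2 n in k1 k2.
have ii : (i1 <= i)%N by rewrite -ltnS -(@ltn_exp2l 2)// (leq_ltn_trans hn).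
have : far (2 ^ i.+1) (r i) x.
  by apply: contrapT => nf; apply: (H i ii); split.
apply: far_mono; first exact: ltnW.
rewrite /powR pnatr_eq0 gtn_eqF// /r ler_expR mulNr lerN2 ler_pM2l; last lra.
rewrite -ler_expR -pow2_expR lnK ?posrE ?ltr0n//.
by rewrite -natrX ler_nat.
Qed.

End orbits.

(** * The shortest distance and its rate *)

Section rates.
Context {R : realType} (a b : R) (T : R -> R).
Local Notation X := (`[a, b]%classic : set R).
Local Open Scope ereal_scope.

Lemma shortest_distance_lt n x r :
  (exists i j, (i < j < n)%N /\ (`|iter i T x - iter j T x| < r)%R) ->
  shortest_distance T n x < r%:E.
Proof.
move=> [i [j [/andP[ij jn] h]]]; rewrite /shortest_distance.
apply: le_lt_trans (_ : `|iter i T x - iter j T x|%:E < _); last by rewrite lte_fin.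
rewrite big_mkord; apply: (bigmin_inf (Ordinal jn)) => //=.
by rewrite big_mkord; apply: (bigmin_inf (Ordinal ij)).
Qed.

Lemma shortest_distance_ge n x r :
  (forall i j, (i < j < n)%N -> (r <= `|iter i T x - iter j T x|)%R) ->
  r%:E <= shortest_distance T n x.
Proof.
move=> H; rewrite /shortest_distance big_mkord.
apply: le_bigmin => [|j _]; first exact: leey.
rewrite big_mkord; apply: le_bigmin => [|i _]; first exact: leey.
by rewrite lee_fin; apply: H; rewrite !ltn_ord.
Qed.

Lemma rate_ge n x t : (1 < n)%N -> X x -> ~ far a b T n (n%:R `^ (- t)) x ->
  t%:E <= shortest_distance_rate T x n.
Proof.
move=> n1 Xx nf.
have ln0 : (0 < ln (n%:R : R))%R by rewrite ln_gt0// ltr1n.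
have p0 : (0 < n%:R `^ (- t))%R by rewrite powR_gt0// ltr0n ltnW.
have h : shortest_distance T n x < (n%:R `^ (- t))%:E.
  apply: shortest_distance_lt; apply: contrapT => none; apply: nf; split => //= i j ij.
  by rewrite leNgt; apply/negP => h; apply: none; exists i, j.
rewrite /shortest_distance_rate.
apply: le_div_neg; first by rewrite oppr_lt0.
rewrite -lne_powR; last exact: ltnW.
apply: lne_le; last exact: ltW.
by apply: shortest_distance_ge.
Qed.

Lemma rate_le n x t : (1 < n)%N -> far a b T n (n%:R `^ (- t)) x ->
  shortest_distance_rate T x n <= t%:E.
Proof.
move=> n1 [Xx H].
have ln0 : (0 < ln (n%:R : R))%R by rewrite ln_gt0// ltr1n.
apply: ge_div_neg; first by rewrite oppr_lt0.
rewrite -lne_powR; last exact: ltnW.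
apply: lne_le; first by rewrite lee_fin powR_ge0.
exact: shortest_distance_ge.
Qed.

End rates.

(** * Collisions under exponential decay of correlations *)

Section decay_of_correlations.
Context {R : realType} (a b : R) (T : R -> R).
Context (mu : probability (measurableTypeR R) R).
Local Notation X := (`[a, b]%classic : set R).
Local Notation prob := (prob mu).
Local Notation vis := (vis a b T).
Local Notation far := (far a b T).
Local Notation rate := (shortest_distance_rate T).
Hypothesis TX : set_fun X X T.
Hypothesis mT : @measurable_fun _ _ (measurableTypeR R) (measurableTypeR R) X T.
Hypothesis muX : mu X = 1%E.
Hypothesis muT : forall A : set (measurableTypeR R), measurable A ->
    mu (X `&` T @^-1` A) = mu A.
Variables C c : R.
Hypotheses (C0 : 0 < C) (c0 : 0 < c).
Hypothesis mix : forall (J : set R) (B : set (measurableTypeR R)) t,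
    is_interval J -> measurable B ->
    `|prob (J `&` vis t B) - prob J * prob B| <= C * expR (- (c * t%:R)) * prob B.
Hypothesis ab : a < b.
Local Notation mvis := (measurable_vis TX mT).
Local Notation pvis := (prob_vis TX mT muX muT).

Definition mixrate (L : nat) : R := C * expR (- (c * L%:R)).

Lemma mixrate_ge0 L : 0 <= mixrate L.
Proof. by rewrite mulr_ge0 ?expR_ge0// ltW. Qed.

Lemma mixrate_anti L t : (L <= t)%N -> mixrate t <= mixrate L.
Proof.
move=> Lt; rewrite ler_wpM2l ?(ltW C0)// ler_expR lerN2 ler_wpM2l ?(ltW c0)//.
by rewrite ler_nat.
Qed.

Lemma mixrate_small e : 0 < e -> exists n0, forall n, (n0 <= n)%N -> mixrate n <= e.
Proof.
move=> e0; have [n0 H] := archi_nat (C / (c * e)).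
exists n0 => n /H h; rewrite /mixrate expRN ler_pdivrMr ?expR_gt0//.
have ce : 0 < c * e by rewrite mulr_gt0.
have {}h : C <= n%:R * (c * e) by rewrite -ler_pdivrMr.
apply: le_trans h _; have -> : n%:R * (c * e) = e * (c * n%:R) by ring.
by rewrite ler_pM2l//; apply: le_trans (expR_ge1Dx _); rewrite lerDr.
Qed.

Lemma mix_ub (J : set R) (B : set (measurableTypeR R)) L t : (L <= t)%N ->
  is_interval J -> measurable B ->
  prob (J `&` vis t B) <= (prob J + mixrate L) * prob B.
Proof.
move=> Lt iJ mB; have := mix t iJ mB; rewrite ler_norml => /andP[_].
rewrite lerBlDl => /le_trans; apply; rewrite mulrDl lerD2l ler_wpM2r ?prob_ge0//.
exact: mixrate_anti.
Qed.

Lemma mix_lb (J : set R) (B : set (measurableTypeR R)) L t : (L <= t)%N ->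
  is_interval J -> measurable B ->
  (prob J - mixrate L) * prob B <= prob (J `&` vis t B).
Proof.
move=> Lt iJ mB; have := mix t iJ mB; rewrite ler_norml => /andP[+ _].
rewrite lerBrDl; apply: le_trans; rewrite mulrBl lerD2l lerN2.
rewrite ler_wpM2r ?prob_ge0//; exact: mixrate_anti.
Qed.

Section blocks.
Variables (J : nat -> set R) (L N M : nat).
Hypothesis iJ : forall k, is_interval (J k).
Hypothesis dJ : forall k l x, J k x -> J l x -> k = l.

Let mJ k : measurable (J k : set (measurableTypeR R)).
Proof. exact: is_interval_meas. Qed.

Let p k := prob (J k).
Let q k := p k + mixrate L.

Let q0 k : 0 <= q k.
Proof. by rewrite addr_ge0 ?prob_ge0 ?mixrate_ge0. Qed.

(* bounds the probability of being in cell [k] at time [i * L] and in cell [l]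
   at time [j * L] *)
Let alpha (k l i j : nat) : R :=
  if i == j then (if k == l then q k else 0) else q k * q l.

Let one_visit (k i t : nat) (Z : set (measurableTypeR R)) :
  (L <= t)%N -> measurable Z ->
  prob (vis (i * L) (J k) `&` vis (i * L + t) Z) <= q k * prob Z.
Proof.
move=> Lt mZ; rewrite -vis_vis// -visI pvis; last first.
  by apply: measurableI => //; exact: mvis.
exact: mix_ub.
Qed.

Let two_visits (k l i j : nat) (Z : set (measurableTypeR R)) :
  (i < j)%N -> (j < N)%N -> measurable Z ->
  prob (vis (i * L) (J k) `&` vis (j * L) (J l) `&` vis (N * L) Z) <=
    q k * q l * prob Z.
Proof.
move=> ij jN mZ.
have -> : vis (i * L) (J k) `&` vis (j * L) (J l) `&` vis (N * L) Z =
    vis (i * L) (J k) `&` vis (i * L + (j - i) * L) (J l `&` vis ((N - j) * L) Z).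
  rewrite -mulnDl subnKC 1?ltnW// visI vis_vis// -mulnDl subnKC 1?ltnW//.
  by rewrite setIA.
have mW : measurable (J l `&` vis ((N - j) * L) Z : set (measurableTypeR R)).
  by apply: measurableI => //; exact: mvis.
apply: le_trans (one_visit _ _ _ mW) _; first by rewrite leq_pmull ?subn_gt0.
rewrite -mulrA ler_wpM2l//; apply: mix_ub => //.
by rewrite leq_pmull ?subn_gt0.
Qed.

Let pair_visits (k l i j : nat) (Z : set (measurableTypeR R)) :
  (i < N)%N -> (j < N)%N -> measurable Z ->
  prob (vis (i * L) (J k) `&` vis (j * L) (J l) `&` vis (N * L) Z) <=
    alpha k l i j * prob Z.
Proof.
move=> iN jN mZ; rewrite /alpha; case: ifPn => [/eqP <-|ij].
  rewrite -visI; case: ifPn => [/eqP <-|kl].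
    rewrite setIid (_ : N * L = i * L + (N - i) * L)%N; last first.
      by rewrite -mulnDl subnKC 1?ltnW.
    by apply: one_visit => //; rewrite leq_pmull ?subn_gt0.
  rewrite (_ : J k `&` J l = set0); last first.
    by apply/seteqP; split=> x // [Jk Jl]; rewrite (dJ Jk Jl) eqxx in kl.
  by rewrite mul0r (_ : _ `&` _ = set0) ?prob0//; apply/seteqP; split=> x // -[[]].
move: ij; rewrite neq_ltn => /orP[ij|ij]; first exact: two_visits.
rewrite [X in prob (X `&` _)]setIC [q k * _]mulrC; exact: two_visits.
Qed.

Let col (u : 'I_M * ('I_N * 'I_N)) : set R :=
  vis (u.2.1 * L) (J u.1) `&` vis (N * L) (vis (u.2.2 * L) (J u.1)).

Let mcol u : measurable (col u : set (measurableTypeR R)).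
Proof. by apply: measurableI; do ?[apply: mvis]; exact: mJ. Qed.

Let col_lb (u : 'I_M * ('I_N * 'I_N)) : p u.1 * (p u.1 - mixrate L) <= prob (col u).
Proof.
case: u => k [i j]; rewrite /col /=.
rewrite (_ : N * L = i * L + (N - i) * L)%N; last first.
  by rewrite -mulnDl subnKC 1?ltnW.
rewrite -vis_vis// -visI pvis; last first.
  by apply: measurableI => //; do ?[apply: mvis]; exact: mJ.
rewrite vis_vis// mulrC; apply: mix_lb => //.
by apply: leq_trans (leq_addr _ _); rewrite leq_pmull ?subn_gt0.
Qed.

Let col_ub (u v : 'I_M * ('I_N * 'I_N)) : prob (col u `&` col v) <=
  alpha u.1 v.1 u.2.1 v.2.1 * alpha u.1 v.1 u.2.2 v.2.2.
Proof.
case: u v => [k [i j]] [l [i' j']]; rewrite /col /=.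
rewrite setIACA -visI.
have mm : measurable (vis (j * L) (J k) `&` vis (j' * L) (J l) :
    set (measurableTypeR R)).
  by apply: measurableI; apply: mvis; exact: mJ.
apply: le_trans (pair_visits _ _ _ _ mm) _ => //.
rewrite ler_wpM2l//.
  by rewrite /alpha; case: ifP => _; [case: ifP => _|rewrite mulr_ge0].
have := @pair_visits k l j j' setT (ltn_ord j) (ltn_ord j') measurableT.
rewrite probT mulr1; apply: le_trans.
apply: prob_mono => //; first by apply: measurableI => //; apply: mvis.
by move=> x AB; split => //; case: AB => -[Xx _] _; split.
Qed.

Let s : R := \sum_(k < M) p k ^+ 2.

Let alpha_sum (k l : nat) : \sum_(i < N) \sum_(j < N) alpha k l i j <=
  N%:R * (if k == l then q k else 0) + N%:R ^+ 2 * (q k * q l).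
Proof.
have -> : N%:R * (if k == l then q k else 0) =
    \sum_(i < N) (if k == l then q k else 0).
  by rewrite sumr_const card_ord mulr_natl.
have -> : N%:R ^+ 2 * (q k * q l) = \sum_(i < N) \sum_(j < N) (q k * q l).
  by rewrite sumr_const card_ord sumr_const card_ord -mulrnA -[RHS]mulr_natl natrM -expr2.
rewrite -big_split /=; apply: ler_sum => i _.
rewrite (bigD1 i)//= [X in _ <= _ + X](bigD1 i)//= addrA; apply: lerD.
  by rewrite /alpha eqxx lerDl mulr_ge0.
by apply: ler_sum => j ji; rewrite /alpha -val_eqE /= eq_sym in ji *; rewrite (negbTE ji).
Qed.

(** The samples are taken at the times [i * L] and [N * L + j * L] for
    [i, j < N], and a collision is a cell visited by one sample of each block.
    All these times are at least [L] apart, so the probability of prescribed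
    visits factors, up to replacing [p k] by [q k = p k + mixrate C c L]; the
    events [col u] and [col v] share a sample in the first block, in the second,
    in both or in none, and [alpha] handles each block separately.  Collisions
    within a block are ignored precisely so that the second moment becomes a sum
    of squares, one square for every pair of cells. *)
Lemma no_collision_moments (NC : set (measurableTypeR R)) : measurable NC ->
  (forall x, NC x -> forall i j, (i < N)%N -> (j < N)%N -> forall k, (k < M)%N ->
     J k (iter (i * L) T x) -> J k (iter (N * L + j * L) T x) -> False) ->
  exists2 e : R, N%:R ^+ 2 * \sum_(k < M) p k * (p k - mixrate L) <= e &
  prob NC * e ^+ 2 <=
    \sum_(k < M) \sum_(l < M)
      (N%:R * (if (k : nat) == l then q k else 0) + N%:R ^+ 2 * (q k * q l)) ^+ 2
    - e ^+ 2.
Proof.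
move=> mNC H; exists (\sum_u prob (col u)).
  apply: (@le_trans _ _ (\sum_(u : 'I_M * ('I_N * 'I_N)) p u.1 * (p u.1 - mixrate L))); last first.
    by apply: ler_sum => u _; exact: col_lb.
  rewrite -(pair_bigA _ (fun (k : 'I_M) (_ : 'I_N * 'I_N) => p k * (p k - mixrate L)))/=.
  rewrite mulr_sumr; apply: ler_sum => k _.
  by rewrite sumr_const card_prod card_ord -[leRHS]mulr_natl natrM expr2.
have := @second_moment R mu _ col NC _ mcol mNC _ erefl.
move=> /(_ _)/le_trans; apply.
  move=> [k [i j]] x NCx [[_ /= Hi]] [_] [_]; rewrite /= -iterD => Hj.
  by apply: (H _ NCx i j _ _ k) => //; rewrite addnC.
rewrite lerD2r.
apply: (@le_trans _ _ (\sum_(u : 'I_M * ('I_N * 'I_N)) \sum_(v : 'I_M * ('I_N * 'I_N))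
   alpha u.1 v.1 u.2.1 v.2.1 * alpha u.1 v.1 u.2.2 v.2.2)).
  by apply: ler_sum => u _; apply: ler_sum => v _; exact: col_ub.
rewrite -(pair_bigA _ (fun (k : 'I_M) (u : 'I_N * 'I_N) =>
   \sum_(v : 'I_M * ('I_N * 'I_N)) alpha k v.1 u.1 v.2.1 * alpha k v.1 u.2 v.2.2))/=.
apply: ler_sum => k _.
under eq_bigr => u _ do rewrite -(pair_bigA _ (fun (l : 'I_M) (v : 'I_N * 'I_N) =>
   alpha k l u.1 v.1 * alpha k l u.2 v.2))/=.
rewrite exchange_big/=; apply: ler_sum => l _.
have a0 i j : 0 <= alpha k l i j.
  by rewrite /alpha; case: ifP => _; [case: ifP => _|rewrite mulr_ge0].
apply: (@le_trans _ _ ((\sum_(i < N) \sum_(j < N) alpha k l i j) ^+ 2)); last first.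
  rewrite lerXn2r ?nnegrE ?alpha_sum//.
  - by apply: sumr_ge0 => i _; apply: sumr_ge0.
  - by rewrite addr_ge0// mulr_ge0// ?exprn_ge0// ?mulr_ge0//; case: ifP.
rewrite le_eqVlt; apply/orP; left; apply/eqP.
rewrite expr2 big_distrlr/= -(pair_bigA _ (fun (i j : 'I_N) =>
   \sum_(v : 'I_N * 'I_N) alpha k l i v.1 * alpha k l j v.2))/=.
apply: eq_bigr => i _; apply: eq_bigr => j _.
by rewrite big_distrlr/= -(pair_bigA _ (fun (i' j' : 'I_N) =>
  alpha k l i i' * alpha k l j j')).
Qed.

End blocks.

(** A point that is far up to scale [r] has no two samples in a cell of length
    [r]. *)
Lemma prob_far_le (n L N : nat) (r rho w : R) : 0 < r -> (0 < N)%N -> (0 < L)%N ->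
  (N * L + N * L <= n)%N -> mixrate L * (ncells a b r)%:R <= rho -> rho <= 2^-1 ->
  (w%:E <= \int[mu]_(x in X) mu (ball x r))%E -> 0 <= w ->
  1 <= N%:R * Num.sqrt (w / 3) ->
  prob (far n r) <= 48 * rho + 40 / (N%:R * Num.sqrt (w / 3)).
Proof.
move=> r0 N0 L0 NLn etM rho2 wI w0 Nw.
set p := fun k => prob (cell a r k).
set s := \sum_(k < ncells a b r) p k ^+ 2.
have ws : w / 3 <= s.
  have /andP[_ h] := correlation_integral_bounds muX r0.
  by have := le_trans wI h; rewrite lee_fin -/s; lra.
have w3 : 0 <= w / 3 by rewrite divr_ge0.
have s0 : 0 <= s by exact: le_trans ws.
have sq : Num.sqrt (w / 3) <= Num.sqrt s by rewrite ler_sqrt.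
have NR : 0 < N%:R :> R by rewrite ltr0n.
have dJ k l x : cell a r k x -> cell a r l x -> k = l by exact: cell_inj.
have key x : far n r x -> forall i j, (i < N)%N -> (j < N)%N -> forall k,
    (k < ncells a b r)%N -> cell a r k (iter (i * L) T x) ->
    cell a r k (iter (N * L + j * L) T x) -> False.
  move=> [Xx Hx] i j iN jN k kM Ji Jj.
  have := cell_close Ji Jj; rewrite ltNge Hx//.
  rewrite -mulnDl ltn_pmul2r// ltn_addr//=.
  by apply: leq_trans NLn; rewrite -mulnDl ltn_pmul2r// ltn_add2l.
have [e e1 e2] := no_collision_moments
  (fun k => @cell_interval R a r k) dJ (measurable_far TX mT n r) key.
have := @no_collision_arith R (ncells a b r) p N%:R (mixrate L) rho (Num.sqrt s)
  (prob (far n r)) e.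
rewrite sqr_sqrtr// => H.
apply: (@le_trans _ _ (48 * rho + 40 / (N%:R * Num.sqrt s))).
  apply: H => //.
  - by move=> k; exact: prob_ge0.
  - exact: sum_prob_cells.
  - exact: mixrate_ge0.
  - by apply: le_trans Nw _; rewrite ler_pM2l.
  - exact: prob_ge0.
rewrite lerD2l ler_pM2l// lef_pV2 ?posrE.
- by rewrite ler_pM2l.
- by apply: lt_le_trans ltr01 _; apply: le_trans Nw _; rewrite ler_pM2l.
- exact: lt_le_trans ltr01 Nw.
Qed.

(** At time [2 ^ (q * i + 1)] the samples are taken with gap [L = 2 ^ i], which
    makes the mixing error doubly exponentially small and leaves
    [N = 2 ^ ((q - 1) * i)] samples in each block.  With [r] of order
    [(2 ^ (q * i)) `^ (- t)], the quantity [N ^+ 2 * r `^ theta] has order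
    [2 `^ (i * (q * (2 - t * theta) - 2))], and the choice
    [q * (2 - t * theta) >= 4] gives a probability of order [2 ^- i]. *)
Lemma eventually_not_far (theta t r0 : R) : 0 < t -> 0 <= theta -> t * theta < 2 ->
  0 < r0 ->
  (forall r, 0 < r < r0 -> ((r `^ theta)%:E <= \int[mu]_(x in X) mu (ball x r))%E) ->
  {ae mu, forall x, exists n0, forall n, (n0 <= n)%N -> ~ far n (n%:R `^ (- t)) x}.
Proof.
move=> t0 th0 tth r00 HI.
pose l : R := ln 2; have l0 : 0 < l by rewrite ln_gt0// ltr1n.
have d0 : 0 < 2 - t * theta by rewrite subr_gt0.
have [q0 Hq0] := archi_nat (4 / (2 - t * theta)).
(* makes the exponent of [N ^+ 2 * r `^ theta] at least 2 per step *)
pose q := q0.+1.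
have q4 : 4 <= q%:R * (2 - t * theta).
  by have := Hq0 q (leqnSn _); rewrite ler_pdivrMr.
have qg : (0 < q)%N by [].
have [B HB] := archi_nat (t * q%:R); have {}HB := HB _ (leqnn B).
pose r i := expR (- (t * l * (q * i.+1 + 1)%:R)).
have rpos i : 0 < r i by exact: expR_gt0.
have r1 i : r i <= 1.
  rewrite /r -[X in _ <= X]expR0 ler_expR oppr_le0 mulr_ge0 ?ler0n// mulr_ge0// ltW//.
(* the gap [L] as a real number: all bounds below are powers of it *)
pose y i : R := 2 ^+ i.
have y0 i : 0 < y i by rewrite exprn_gt0.
have yE i : y i = expR (i%:R * l) by rewrite /y pow2_expR.
pose A := expR (t * l * (q%:R + 1)).
have A0 : 0 < A by exact: expR_gt0.
have ba0 : 0 < b - a + 1 by rewrite addr_gt0// subr_gt0.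
pose K1 := C * (b - a + 1) * A * ((B.+1)`!%:R / c ^+ B.+1).
have K10 : 0 < K1.
  rewrite /K1; apply: mulr_gt0; last by rewrite divr_gt0 ?exprn_gt0// ltr0n fact_gt0.
  by rewrite !mulr_gt0.
have claimA i : mixrate (2 ^ i) * (ncells a b (r i))%:R <= K1 / y i.
  have Mle : (ncells a b (r i))%:R <= (b - a + 1) * (A * y i ^+ B).
    apply: (@le_trans _ _ ((b - a + 1) / r i)).
      apply: le_trans (ncells_le (rpos i) (ltW ab)) _.
      rewrite [leRHS]mulrDl lerD2l mul1r -[leLHS]invr1 lef_pV2 ?posrE//.
    rewrite ler_wpM2l ?(ltW ba0)//.
    rewrite /r -expRN opprK /A yE -expRM_natl -expRD ler_expR.
    rewrite natrD natrM -[i.+1%:R]natr1.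
    have : t * q%:R * (i%:R * l) <= B%:R * (i%:R * l).
      by rewrite ler_wpM2r// mulr_ge0 ?ler0n// ltW.
    by move=> h; lra.
  apply: (@le_trans _ _ (mixrate (2 ^ i) * ((b - a + 1) * (A * y i ^+ B)))).
    by rewrite ler_wpM2l// mixrate_ge0.
  have := @expR_beats_power R (c * y i) B (mulr_gt0 c0 (y0 i)).
  have -> : mixrate (2 ^ i) = C * expR (- (c * y i)) by rewrite /mixrate natrX.
  rewrite exprMn => h.
  have cB : 0 < c ^+ B by rewrite exprn_gt0.
  have -> : C * expR (- (c * y i)) * ((b - a + 1) * (A * y i ^+ B)) =
     C * (b - a + 1) * A / c ^+ B * (expR (- (c * y i)) * (c ^+ B * y i ^+ B)).
    by field; rewrite gt_eqF.
  have -> : K1 / y i = C * (b - a + 1) * A / c ^+ B * ((B.+1)`!%:R / (c * y i)).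
    by rewrite /K1 exprS; field; rewrite !gt_eqF.
  by rewrite ler_wpM2l// divr_ge0 ?(ltW cB)// !mulr_ge0// ltW.
pose kap := Num.sqrt (expR (- (t * theta * l * (q%:R + 1))) / 3).
have kap0 : 0 < kap by rewrite sqrtr_gt0 divr_gt0 ?expR_gt0.
pose w i := r i `^ theta.
pose N i := (2 ^ (q0 * i))%N.
have claimB i : kap * y i <= (N i)%:R * Num.sqrt (w i / 3).
  have -> : w i / 3 = kap ^+ 2 * (expR (- (t * theta * q%:R * l * i%:R) / 2)) ^+ 2.
    rewrite sqr_sqrtr; last by rewrite divr_ge0 ?expR_ge0.
    rewrite -expRM_natl /w /r -expRM [RHS]mulrAC -expRD; congr (_ / _); congr expR.
    by rewrite natrD natrM -[i.+1%:R]natr1; field.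
  rewrite -exprMn sqrtr_sqr ger0_norm; last by rewrite mulr_ge0 ?expR_ge0// ltW.
  rewrite mulrCA ler_pM2l// yE /N natrX pow2_expR -/l -expRD ler_expR natrM.
  have : i%:R * l * 4 <= i%:R * l * (q%:R * (2 - t * theta)).
    by rewrite ler_wpM2l// mulr_ge0 ?ler0n// ltW.
  by rewrite /q -natr1 => h; lra.
pose F i := far (2 ^ (q * i + 1)) (r i).
have [i0 Hi0] := archi_nat (Num.max (2 * K1) (Num.max (kap^-1) (1 - ln r0 / (t * l)))).
have bound i : (i0 <= i)%N -> prob (F i) <= (48 * K1 + 40 / kap) * (2^-1) ^+ i.
  move=> /Hi0; rewrite !ge_max => /and3P[h1 h2 h3].
  have iy : i%:R <= y i by exact: natr_lt_pow2.
  have rr0 : r i < r0.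
    rewrite -[r0]lnK ?posrE// ltr_expR.
    have tl : 0 < t * l by rewrite mulr_gt0.
    have : 1 - ln r0 / (t * l) < (q * i.+1 + 1)%:R.
      by apply: le_lt_trans h3 _; rewrite ltr_nat; clear; rewrite /q; lia.
    move=> h4.
    have : t * l * (- (ln r0 / (t * l))) < t * l * (q * i.+1 + 1)%:R.
      by rewrite ltr_pM2l//; lra.
    have -> : t * l * (- (ln r0 / (t * l))) = - ln r0.
      by field; rewrite !gt_eqF.
    lra.
  have rho2 : K1 / y i <= 2^-1.
    by rewrite ler_pdivrMr//; lra.
  have ky : 1 <= kap * y i.
    rewrite mulrC -ler_pdivrMr// div1r; exact: le_trans iy.
  have N0 : (0 < N i)%N by rewrite /N expn_gt0.
  have L0 : (0 < 2 ^ i)%N by rewrite expn_gt0.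
  have NL : (N i * 2 ^ i + N i * 2 ^ i <= 2 ^ (q * i + 1))%N.
    by rewrite /N -expnD addnn -mul2n -expnS leq_exp2l// /q; clear; lia.
  have wI : ((w i)%:E <= \int[mu]_(x in X) mu (ball x (r i)))%E.
    by apply: HI; rewrite rpos rr0.
  apply: le_trans (prob_far_le (rpos i) N0 L0 NL
    (claimA i) rho2 wI (powR_ge0 _ _) (le_trans ky (claimB i))) _.
  rewrite exprVn -/(y i) [leRHS]mulrDl; apply: lerD; first by rewrite mulrA.
  rewrite -mulrA ler_pM2l// -invfM lef_pV2 ?posrE//; last by rewrite mulr_gt0.
  by apply: lt_le_trans (claimB i); rewrite mulr_gt0.
have mF i : measurable (F i : set (measurableTypeR R)) by exact: measurable_far.
have z01 : 0 < (2^-1 : R) < 1 by rewrite invr_gt0 ltr0n invf_lt1 ?ltr1n ?ltr0n.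
have := Borel_Cantelli_geometric z01 mF bound.
apply: ae_imply => x [i1 H]; exists (2 ^ (q * i1 + 1))%N => n hn fn.
have [i ii /andP[n1 n2]] := dyadic_block qg hn.
apply: (H i ii); apply: far_mono fn => //.
have n0 : (0 < n)%N by apply: leq_trans hn; rewrite expn_gt0.
rewrite /powR pnatr_eq0 gtn_eqF// /r ler_expR -mulrA mulNr lerN2 ler_pM2l//.
rewrite mulrC -(ler_expR) -pow2_expR lnK ?posrE ?ltr0n//.
by rewrite -natrX ler_nat ltnW.
Qed.

Lemma eventually_rate_ge (d t : R) : upper_correlation_dim X mu = d%:E -> 0 < d ->
  0 < t -> t < 2 / d ->
  {ae mu, forall x, X x -> exists n0, forall n, (n0 <= n)%N -> (t%:E <= rate x n)%E}.
Proof.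
move=> dE d0 t0 td.
have d2 : d < 2 / t by rewrite ltr_pdivlMr// mulrC -ltr_pdivlMr.
(* any exponent strictly between [d] and [2 / t] *)
pose theta := (d + 2 / t) / 2.
have th1 : d < theta by rewrite /theta; lra.
have th2 : theta < 2 / t by rewrite /theta; lra.
have tth : t * theta < 2 by rewrite mulrC -ltr_pdivlMr.
have [r0 r00 H] : exists2 r0 : R, 0 < r0 &
    forall r, 0 < r < r0 -> ((r `^ theta)%:E <= \int[mu]_(x in X) mu (ball x r))%E.
  by apply: upper_dim_power; rewrite dE lte_fin.
have th0 : 0 <= theta by rewrite ltW// (lt_trans d0).
have := eventually_not_far t0 th0 tth r00 H.
apply: ae_imply => x [n0 Hx] Xx; exists (maxn n0 2) => n; rewrite geq_max => /andP[n1 n2].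
by apply: (rate_ge n2 Xx); exact: Hx.
Qed.

Lemma ae_rate_lower_bounds (d : R) : upper_correlation_dim X mu = d%:E -> 0 < d -> d <= 1 ->
  {ae mu, forall x, X x -> forall j : nat, exists n0, forall n, (n0 <= n)%N ->
    ((2 / d - j.+1%:R^-1)%:E <= rate x n)%E}.
Proof.
move=> dE d0 d1.
have H j : {ae mu, forall x, X x -> exists n0, forall n, (n0 <= n)%N ->
    ((2 / d - j.+1%:R^-1)%:E <= rate x n)%E}.
  have j0 : 0 < (j.+1%:R^-1 : R) by rewrite invr_gt0 ltr0n.
  have j1 : (j.+1%:R^-1 : R) <= 1 by rewrite invf_le1 ?ltr0n// ler1n.
  have h2 : 2 <= 2 / d by rewrite ler_pdivlMr// ler_piMr.
  apply: (eventually_rate_ge dE d0); move: j0 j1 h2; set u := _^-1; set v := 2 / d; lra.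
have := ae_foralln H; apply: ae_imply => x Hx Xx j; exact: Hx.
Qed.

(** The sets [E] with this property form a Dynkin class that contains the
    intervals. *)
Lemma mixing_measurable (E B : set (measurableTypeR R)) (e : R) :
  measurable E -> measurable B -> 0 < e ->
  exists n0, forall n, (n0 <= n)%N -> `|prob (E `&` vis n B) - prob E * prob B| <= e.
Proof.
move=> mE mB; move: e.
have B1 : prob B <= 1 := prob_le1 mu mB.
have B0 : 0 <= prob B := prob_ge0 mu B.
pose Q (E : set (measurableTypeR R)) := forall e : R, 0 < e ->
  exists n0, forall n, (n0 <= n)%N -> `|prob (E `&` vis n B) - prob E * prob B| <= e.
have mV n : measurable (vis n B : set (measurableTypeR R)) by exact: mvis.
(* the class is closed under disjoint unions of two sets *)
have Q2 (U V : set (measurableTypeR R)) : measurable U -> measurable V ->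
    U `&` V = set0 -> Q U -> Q V -> Q (U `|` V).
  move=> mU mV' UV QU QV e e0.
  have e2 : 0 < e / 2 by rewrite divr_gt0.
  have [n1 H1] := QU _ e2; have [n2 H2] := QV _ e2.
  exists (maxn n1 n2) => n; rewrite geq_max => /andP[/H1 h1 /H2 h2].
  rewrite setIUl !probU//; try exact: measurableI.
    have -> : prob (U `&` vis n B) + prob (V `&` vis n B) - (prob U + prob V) * prob B
       = (prob (U `&` vis n B) - prob U * prob B) + (prob (V `&` vis n B) - prob V * prob B).
      by ring.
    by apply: le_trans (ler_normD _ _) _; lra.
  by rewrite setIACA UV set0I.
suff : Q E by [].
have G : forall S, <<s (@ocitv R) >> S -> Q S.
  apply: (@dynkin_induction _ (measurableTypeR R) (@ocitv R) Q) => //.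
  - exact: ocitvI.
  - move=> e e0; exists 0%N => n _.
    by rewrite setTI pvis// probT mul1r subrr normr0 ltW.
  - move=> S [x _ <-] e e0; have [n0 H] := mixrate_small e0.
    exists n0 => n /H h; apply: le_trans (mix _ _ mB) _; first exact: interval_is_interval.
    by apply: le_trans h; rewrite /mixrate ler_piMr// mulr_ge0 ?expR_ge0// ltW.
  - move=> S mS QS e e0; have [n0 H] := QS e e0; exists n0 => n /H h.
    have := probDI mu (mV n) mS; rewrite pvis// [vis n B `&` S]setIC.
    have -> : vis n B `\` S = ~` S `&` vis n B by rewrite setDE setIC.
    move=> E1; rewrite probC//.
    have -> : prob (~` S `&` vis n B) - (1 - prob S) * prob B =
       - (prob (S `&` vis n B) - prob S * prob B) by lra.
    by rewrite normrN.
  - move=> F mF tF QF e e0.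
    have mU : measurable (\bigcup_k F k : set (measurableTypeR R)) by exact: bigcupT_measurable.
    pose G m := \big[setU/set0]_(k < m) F k.
    have mG m : measurable (G m : set (measurableTypeR R)) by exact: bigsetU_measurable.
    have QG m : Q (G m).
      elim: m => [|m IH].
        move=> e' e'0; exists 0%N => n _.
        by rewrite /G big_ord0 set0I prob0 mul0r subrr normr0 ltW.
      rewrite /G big_ord_recr/=; apply: (Q2 _ _ (mG m) (mF m)) => //.
      apply/seteqP; split=> x //; rewrite /G -(bigcup_mkord m F) => -[[k /= km Fk] Fm].
      move/trivIsetP : tF => /(_ k m Logic.I Logic.I) H.
      have : (F k `&` F m) x by split.
      by rewrite H//; apply/eqP => E'; move: km; rewrite E' ltnn.
    have GU : \bigcup_m G m = \bigcup_k F k.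
      apply/seteqP; split=> [x [i _]|x [i _ Fix]].
        by rewrite /G -bigcup_mkord => -[j _ Fjx]; exists j.
      by exists i.+1 => //; rewrite /G big_ord_recr/=; right.
    have e3 : 0 < e / 3 by rewrite divr_gt0.
    have [m Hm] := @prob_nondecreasing_limit R mu G (e / 3) mG (fun i j ij => @subset_bigsetU _ F i j ij) e3.
    rewrite GU in Hm.
    have [n0 H] := QG m _ e3; exists n0 => n /H h.
    have GsubU : G m `<=` \bigcup_k F k by rewrite -GU; exact: bigcup_sup.
    have d1 : prob (\bigcup_k F k) = prob (G m) + prob ((\bigcup_k F k) `\` G m).
      by rewrite [LHS](probDI mu mU (mG m)) (setIidr GsubU).
    have mUV : measurable ((\bigcup_k F k) `&` vis n B : set (measurableTypeR R)).
      exact: measurableI.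
    have d2 : prob ((\bigcup_k F k) `&` vis n B) = prob (G m `&` vis n B) +
        prob ((\bigcup_k F k) `&` vis n B `\` G m).
      rewrite [LHS](probDI mu mUV (mG m)) setIAC.
      by rewrite (setIidr GsubU).
    have d3 : prob ((\bigcup_k F k) `&` vis n B `\` G m) <= prob ((\bigcup_k F k) `\` G m).
      by apply: prob_mono; [exact: measurableD|exact: measurableD|move=> x [[]]].
    have d4 := prob_ge0 mu ((\bigcup_k F k) `&` vis n B `\` G m).
    have d5 := prob_ge0 mu ((\bigcup_k F k) `\` G m).
    move: h; rewrite !ler_norml => /andP[h1 h2].
    have d6 : prob ((\bigcup_k F k) `\` G m) * prob B <= prob ((\bigcup_k F k) `\` G m).
      by rewrite ler_piMr.
    have d7 : 0 <= prob ((\bigcup_k F k) `\` G m) * prob B by rewrite mulr_ge0.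
    have d8 : prob ((\bigcup_k F k) `\` G m) <= e / 3 by lra.
    by apply/andP; split; rewrite d2 d1 mulrDl; lra.
exact: G.
Qed.

End decay_of_correlations.

(** * A mean value theorem for one-sided derivatives *)

Section mean_value.
Context {R : realType} (C : set R) (f : R -> R).

(** The limit of a filter that does not converge is [0] by convention, so a
    nonzero value of [derive_on] entails that the derivative exists. *)
Lemma derivable_on_neq0 x : derive_on C f x != 0 -> derivable_on C f x.
Proof.
by move=> d0; apply: contrapT => nc; move: d0; rewrite /derive_on (dvgP nc) eqxx.
Qed.

Lemma derivable_on_quotient x : derivable_on C f x -> forall e, 0 < e ->
  exists2 d, 0 < d & forall y, C y -> y != x -> `|x - y| < d ->
    `|derive_on C f x - (f y - f x) / (y - x)| < e.
Proof.
move=> H e e0.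
have /cvgrPdist_lt /(_ e e0) : diff_quotient f x y @[y --> within C x^'] --> derive_on C f x by exact: H.
rewrite /within /dnbhs /within /= => /nbhs_ballP [d /= d0 Hd].
by exists d => // y Cy yx xy; exact: (Hd y).
Qed.

Lemma derivable_on_continuous x : derivable_on C f x -> forall e, 0 < e ->
  exists2 d, 0 < d & forall y, C y -> `|x - y| < d -> `|f x - f y| < e.
Proof.
move=> H e e0; have [d d0 Hd] := derivable_on_quotient H ltr01.
pose M := `|derive_on C f x| + 1.
have M0 : 0 < M by rewrite ltr_wpDl.
exists (Num.min d (e / M)); first by rewrite lt_min d0 divr_gt0.
move=> y Cy; rewrite lt_min => /andP[xyd xye].
have [->|yx] := eqVneq y x; first by rewrite subrr normr0.
have {Hd} := Hd y Cy yx xyd; set q := _ / _ => Hq.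
have qM : `|q| <= M.
  rewrite /M -(subrK (derive_on C f x) q) addrC.
  by apply: le_trans (ler_normD _ _) _; rewrite lerD2l distrC ltW.
have -> : f x - f y = q * (x - y).
  by rewrite /q; field; rewrite subr_eq0.
rewrite normrM; apply: le_lt_trans (_ : M * `|x - y| < _).
  by rewrite ler_wpM2r.
by rewrite mulrC -ltr_pdivlMr.
Qed.

(** Inside [C] the derivative along [C] is the two-sided one; at [x] and [y] it
    still gives the one-sided continuity that the mean value theorem asks for. *)
Lemma mvt_on x y : is_interval C -> (forall z, C z -> derivable_on C f z) ->
  x < y -> C x -> C y ->
  exists2 z, C z & f y - f x = derive_on C f z * (y - x).
Proof.
move=> iC dC xy Cx Cy.
have Cz z : x <= z <= y -> C z by move=> /(iC x y Cx Cy).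
have [||z] := @MVT R f (derive_on C f) x y xy.
- move=> z; rewrite in_itv/= => /andP[xz zy].
  have H : h^-1 *: ((f \o shift z) (h *: 1) - f z) @[h --> 0^'] --> derive_on C f z.
    apply/cvgrPdist_lt => e e0.
    have Cz' : C z by apply: Cz; rewrite !ltW.
    have [d d0 Hd] := derivable_on_quotient (dC z Cz') e0.
    rewrite /dnbhs /within/=; apply/nbhs_ballP.
    exists (Num.min d (Num.min (z - x) (y - z))) => /=.
      by rewrite !lt_min d0 !subr_gt0 xz.
    move=> h; rewrite /ball/= sub0r normrN !lt_min => /and3P[h1 h2 h3] hn0.
    rewrite !ltr_norml in h2 h3; move: h2 h3 => /andP[h2 h2'] /andP[h3 h3'].
    rewrite /shift /= /GRing.scale /= mulr1.
    have := Hd (h + z); rewrite addrK => Hd'; rewrite [_^-1 * _]mulrC. apply: Hd'.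
    + by apply: Cz; apply/andP; split; lra.
    + by rewrite -subr_eq0 addrK.
    + by rewrite opprD addrCA subrr addr0 normrN.
  have dz : derivable f z 1 by apply/cvg_ex; exists (derive_on C f z).
  by apply: DeriveDef => //; exact: (cvg_lim (@Rhausdorff R) H).
- apply/continuous_within_itvP => //; split.
  + move=> z; rewrite in_itv/= => /andP[xz zy]; apply/cvgrPdist_lt => e e0.
    have Cz' : C z by apply: Cz; rewrite !ltW.
    have [d d0 Hd] := derivable_on_continuous (dC z Cz') e0.
    apply/nbhs_ballP; exists (Num.min d (Num.min (z - x) (y - z))) => /=.
      by rewrite !lt_min d0 !subr_gt0 xz.
    move=> u; rewrite /ball/= !lt_min => /and3P[h1 h2 h3]; apply: Hd => //.
    move: h2 h3; rewrite !ltr_norml => /andP[h2 h2'] /andP[h3 h3'].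
    by apply: Cz; apply/andP; split; lra.
  + apply/cvgrPdist_lt => e e0.
    have [d d0 Hd] := derivable_on_continuous (dC x Cx) e0.
    rewrite /at_right /within/=; apply/nbhs_ballP; exists (Num.min d (y - x)) => /=.
      by rewrite !lt_min d0 !subr_gt0.
    move=> u; rewrite /ball/= !lt_min => /andP[h1 h2] xu; apply: Hd => //.
    move: h2; rewrite !ltr_norml => /andP[h2 h2'].
    by apply: Cz; apply/andP; split; lra.
  + apply/cvgrPdist_lt => e e0.
    have [d d0 Hd] := derivable_on_continuous (dC y Cy) e0.
    rewrite /at_left /within/=; apply/nbhs_ballP; exists (Num.min d (y - x)) => /=.
      by rewrite !lt_min d0 !subr_gt0.
    move=> u; rewrite /ball/= !lt_min => /andP[h1 h2] xu; apply: Hd => //.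
    move: h2; rewrite !ltr_norml => /andP[h2 h2'].
    by apply: Cz; apply/andP; split; lra.
rewrite in_itv/= => /andP[xz zy] E; exists z => //.
by apply: Cz; rewrite !ltW.
Qed.

End mean_value.

(** * Lengths, and countable families of disjoint sets *)

(** The empty set pads the enumeration, so that it is indexed by all of [nat]
    even when the family is finite. *)
Lemma countable_disjoint_enum {U : Type} (A : set (set U)) :
  countable A -> trivIset A id ->
  exists F : nat -> set U, [/\ forall i, F i = set0 \/ A (F i),
    trivIset setT F & \bigcup_i F i = \bigcup_(C in A) C].
Proof.
move=> /countable_injP[f finj] tA.
pose F i := \bigcup_(C in A `&` [set C | f C = i]) C.
have FE i C : A C -> f C = i -> F i = C.
  move=> AC fC; apply/seteqP; split=> x; last by move=> Cx; exists C.
  move=> [C' [AC' /= fC'] C'x].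
  by rewrite -(finj C' C) ?inE// fC.
have Fin i x : F i x -> exists2 C, A C & F i = C.
  by move=> [C [AC fC] Cx]; exists C => //; exact: FE.
exists F; split.
- move=> i; have [->|/set0P[x /Fin[C AC ->]]] := eqVneq (F i) set0; first by left.
  by right.
- apply/trivIsetP => i j _ _ ij; apply/eqP; apply: contraNT ij => /set0P[x [Fi Fj]].
  move: Fi Fj => [C [AC fC] Cx] [C' [AC' fC'] C'x].
  by apply/eqP; rewrite -fC -fC' (tA C C' AC AC')//; exists x.
- apply/seteqP; split=> x.
    by move=> [i _ [C [AC _] Cx]]; exists C.
  by move=> [C AC Cx]; exists (f C) => //; exists C.
Qed.

Section lengths.
Context {R : realType}.
Local Notation leb := (@lebesgue_measure R).

Definition len (A : set R) : R := fine (leb A).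

Lemma leb_diam_le (A : set R) d : measurable (A : set (measurableTypeR R)) ->
  0 <= d -> (forall x y, A x -> A y -> `|x - y| <= d) -> (leb A <= (2 * d)%:E)%E.
Proof.
move=> mA d0 H; have [->|/set0P[x0 Ax0]] := eqVneq A set0.
  by rewrite measure0 lee_fin mulr_ge0.
apply: (@le_trans _ _ (leb `[x0 - d, x0 + d])).
  apply: le_measure; rewrite ?inE//.
  move=> x Ax; have := H x x0 Ax Ax0; rewrite ler_norml => /andP[h1 h2].
  by rewrite /= in_itv/=; apply/andP; split; lra.
rewrite lebesgue_measure_itv/= lte_fin; case: ifP => _; last first.
  by rewrite lee_fin mulr_ge0.
by rewrite -EFinD lee_fin; lra.
Qed.

Lemma leb_interval_ge (A : set R) x y : is_interval A -> A x -> A y ->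
  (`|x - y|%:E <= leb A)%E.
Proof.
move=> iA; wlog xy : x y / x <= y.
  move=> H Ax Ay; have [xy|yx] := leP x y; first exact: H.
  by rewrite distrC; apply: H => //; exact: ltW.
move=> Ax Ay; apply: (@le_trans _ _ (leb `[x, y])).
  rewrite lebesgue_measure_itv/= lte_fin ler0_norm ?subr_le0// opprB.
  case: ltP => [_|yx]; first by rewrite -EFinD.
  by rewrite lee_fin subr_le0.
apply: le_measure; rewrite ?inE; [exact: measurable_itv|exact: is_interval_meas|].
by move=> z; rewrite /= in_itv/= => /(iA _ _ Ax Ay).
Qed.

(** If [y] and [y'] are in [I] and are [rho]-close to points outside of [I] on
    the same side, then these outside points lie beyond both [y] and [y'], so
    [y] and [y'] are [rho]-close to each other. *)
Lemma interval_edge (I : set R) rho : is_interval I -> 0 <= rho ->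
  exists u1 u2, forall y z, I y -> ~ I z -> `|y - z| <= rho ->
    `|y - u1| <= rho \/ `|y - u2| <= rho.
Proof.
move=> iI rho0.
have side (s : bool) : exists u, forall y z, I y -> ~ I z -> `|y - z| <= rho ->
    (if s then z < y else y < z) -> `|y - u| <= rho.
  have [[u [v [Iu Nv uv suv]]]|none] := pselect (exists u v, [/\ I u, ~ I v,
      `|u - v| <= rho & if s then v < u else u < v]); last first.
    by exists 0 => y z Iy Nz yz syz; exfalso; apply: none; exists y, z.
  exists u => y z Iy Nz yz syz.
  move: uv yz; rewrite !ler_norml => /andP[h1 h2] /andP[h3 h4].
  case: s suv syz => suv syz; apply/andP.
    have zu : z < u.
      by rewrite ltNge; apply/negP => uz; apply: Nz; apply: (iI u y) => //; rewrite uz ltW.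
    have vy : v < y.
      by rewrite ltNge; apply/negP => uz; apply: Nv; apply: (iI y u) => //; rewrite uz ltW.
    by split; lra.
  have zu : u < z.
    by rewrite ltNge; apply/negP => uz; apply: Nz; apply: (iI y u) => //; rewrite uz ltW.
  have vy : y < v.
    by rewrite ltNge; apply/negP => uz; apply: Nv; apply: (iI u y) => //; rewrite uz ltW.
  by split; lra.
have [u1 H1] := side true; have [u2 H2] := side false.
exists u1, u2 => y z Iy Nz yz; have [yz'|zy|E] := ltgtP y z.
- by right; exact: (H2 y z).
- by left; exact: (H1 y z).
- by rewrite E in Iy.
Qed.

End lengths.

(** * Cylinders of a Gibbs-Markov map *)

Section cylinders.
Context {R : realType} (a b : R) (T : R -> R) (P : set (set R)).
Local Notation X := (`[a, b]%classic : set R).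
Local Notation leb := (@lebesgue_measure R).
Hypothesis hT : gibbs_markov X T P.

Let hE := gm_expanding hT.

Definition part : set R := \bigcup_(I in P) I.

(** A word is an infinite sequence, of which a cylinder of level [n] reads the
    first [n] letters; prefixes and shifts then need no conversion. *)
Definition cyl (n : nat) (w : nat -> set R) : set R :=
  [set x | X x /\ forall i, (i < n)%N -> w i (iter i T x)].

Definition word (w : nat -> set R) := forall i, P (w i).

Definition cylinders n : set (set R) :=
  [set C | exists2 w, word w & C = cyl n w].

Lemma part_disjoint I J x : P I -> P J -> I x -> J x -> I = J.
Proof. by move=> PI PJ Ix Jx; apply: (pe_disjoint hE PI PJ); exists x. Qed.

Lemma part_sub : part `<=` X.
Proof. by move=> x [I PI Ix]; have [_ + _] := pe_interval hE PI; exact. Qed.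

Lemma part_image x : part x -> part (T x).
Proof.
move=> [I PI Ix]; have [Q QP TI] := gm_markov hT PI.
have : (T @` I) (T x) by exists x.
by rewrite TI => -[J QJ Jx]; exists J => //; exact: QP.
Qed.

Lemma part_iter n x : part x -> part (iter n T x).
Proof. by move=> Yx; elim: n => //= n IH; exact: part_image. Qed.

(** The Markov property makes the union of the partition forward invariant. *)
Lemma repeller_part : repeller X T P = part.
Proof.
apply/seteqP; split=> x.
  by move=> [_ /(_ 0%N)] [I PI Ix]; exists I.
by move=> Yx; split; [exact: part_sub|move=> k; exact: part_iter].
Qed.

Lemma itinerary x : part x -> exists2 w, word w & forall n, cyl n w x.
Proof.
move=> Yx.
have H n : exists I, P I /\ I (iter n T x).
  by have [I PI Ix] := part_iter n Yx; exists I.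
have [w Hw] := choice H.
exists w; first by move=> i; have [] := Hw i.
by move=> n; split; [exact: part_sub|move=> i _; have [] := Hw i].
Qed.

Lemma cyl_cylinder n w : word w -> cyl n w !=set0 -> cylinder X T P n (cyl n w).
Proof. by move=> Hw ne; exists w; split => // i _; exact: Hw. Qed.

Lemma cylS n w : cyl n.+1 w = cyl n w `&` [set x | w n (iter n T x)].
Proof.
apply/seteqP; split=> x.
  move=> [Xx H]; split; last exact: H.
  by split => // i ?; apply: H; rewrite ltnS ltnW.
move=> [[Xx H] wx]; split => // i; rewrite ltnS leq_eqVlt => /predU1P[->//|].
exact: H.
Qed.

Lemma cyl_mono n m w : (n <= m)%N -> cyl m w `<=` cyl n w.
Proof.
by move=> nm x [Xx H]; split => // i h; apply: H; exact: leq_trans nm.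
Qed.

Lemma cyl_eq n w w' x : word w -> word w' -> cyl n w x -> cyl n w' x ->
  cyl n w = cyl n w'.
Proof.
move=> Hw Hw' [_ H] [_ H'].
have E i : (i < n)%N -> w i = w' i.
  by move=> h; exact: (part_disjoint (Hw i) (Hw' i) (H i h) (H' i h)).
by apply/seteqP; split=> y [Xy Hy]; split => // i h; [rewrite -E//|rewrite E//]; exact: Hy.
Qed.

Lemma cyl_part n w : word w -> (0 < n)%N -> cyl n w `<=` part.
Proof. by move=> Hw n0 x [_ /(_ 0%N n0)] wx; exists (w 0%N). Qed.

Lemma cyl_subX n w : cyl n w `<=` X.
Proof. by move=> x []. Qed.

Lemma cyl_shift n m w x : cyl (m + n) w x ->
  cyl n (fun i => w (m + i)%N) (iter m T x).
Proof.
move=> [Xx H]; split.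
  elim: (m) => //= k IH; exact: (pe_map hE).
by move=> i h; rewrite -iterD [(i + m)%N]addnC; apply: H; rewrite ltn_add2l.
Qed.

Lemma cyl1 w : word w -> cyl 1 w = w 0%N.
Proof.
move=> Hw; apply/seteqP; split=> x; first by move=> [_]; exact.
by move=> wx; split; [apply: part_sub; exists (w 0%N)|case].
Qed.

(** By the Markov property the image of the symbol [w n] contains the symbol
    [w n.+1] as soon as it meets it, which it does because the cylinder is not
    empty; induction on [n]. *)
Lemma cyl_image n w : word w -> cyl n.+1 w !=set0 ->
  forall y, w n y -> exists2 x, cyl n.+1 w x & iter n T x = y.
Proof.
move=> Hw; elim: n => [_ y wy|n IH [x0 x0C] y wy].
  exists y => //; split; first by apply: part_sub; exists (w 0%N).
  by case.
have x0C' : cyl n.+1 w x0 by apply: cyl_mono x0C.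
have [Q QP TQ] := gm_markov hT (Hw n).
have : (T @` w n) (iter n.+1 T x0) by exists (iter n T x0) => //; apply: x0C'.2.
rewrite TQ => -[J QJ Jx].
have EJ : J = w n.+1.
  by apply: (part_disjoint (QP _ QJ) (Hw _) Jx); apply: x0C.2.
have : (T @` w n) y by rewrite TQ; exists J => //; rewrite EJ.
move=> [z wz Tz]; have [x xC xz] := IH (ex_intro _ x0 x0C') z wz.
exists x; last by rewrite /= xz.
by rewrite cylS; split => //=; rewrite xz Tz.
Qed.

Lemma image_cyl n w : word w -> cyl n.+1 w !=set0 ->
  iter n.+1 T @` cyl n.+1 w = T @` w n.
Proof.
move=> Hw ne; apply/seteqP; split=> y.
  by move=> [x [Xx H] <-]; exists (iter n T x) => //; exact: H.
move=> [z wz <-]; have [x Cx xz] := cyl_image Hw ne wz.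
by exists x => //=; rewrite xz.
Qed.

(** By bounded distortion the derivatives of [T^n] on a cylinder do not vanish,
    have the same sign [s], and have ratios between [1 / C] and [C], where [C]
    is the distortion constant; the mean value theorem integrates this with
    [K = C ^+ 2]. *)
Lemma distortion_const : exists2 K : R, 1 <= K &
  forall n w, word w -> (0 < n)%N -> cyl n w !=set0 -> is_interval (cyl n w) ->
  exists s D : R, [/\ 0 < D, s ^+ 2 = 1 & forall x y, cyl n w x -> cyl n w y -> x <= y ->
    D * (y - x) <= s * (iter n T y - iter n T x) <= K * D * (y - x)].
Proof.
have [C C0 HC] := pe_distortion hE.
have C1 : 1 <= C.
  have [I PI] := pe_nonempty hE; have [iI IX [x [y [Ix Iy xy]]]] := pe_interval hE PI.
  have Yx : part x by exists I.
  have [w Hw Hx] := itinerary Yx.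
  have := HC 1%N (cyl 1 w) x x isT (cyl_cylinder Hw (ex_intro _ x (Hx 1%N))) (Hx _) (Hx _).
  move=> /andP[h1 h2]; have : C^-1 <= C by exact: le_trans h2.
  by rewrite -[X in X <= _]div1r ler_pdivrMr//; nra.
exists (C ^+ 2); first by rewrite exprn_ege1.
move=> n w Hw n0 ne iC; have cC := cyl_cylinder Hw ne.
set Cn := cyl n w in ne iC cC *.
pose d x := derive_on Cn (iter n T) x.
have Hd x y : Cn x -> Cn y -> C^-1 <= d x / d y <= C by exact: HC.
have dn0 x : Cn x -> d x != 0.
  move=> Cx; apply/eqP => dx; have /andP[+ _] := Hd x x Cx Cx.
  by rewrite dx mul0r leNgt invr_gt0 C0.
have [x0 Cx0] := ne.
exists (Num.sg (d x0)), (`|d x0| / C); split.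
- by rewrite divr_gt0// normr_gt0 dn0.
- by rewrite sqr_sg dn0.
move=> x y Cx Cy; rewrite le_eqVlt => /predU1P[->|xy].
  by rewrite !subrr !mulr0 lexx.
have [z Cz ->] := mvt_on iC (fun z Cz => derivable_on_neq0 (dn0 z Cz)) xy Cx Cy.
rewrite mulrA !ler_pM2r ?subr_gt0//.
have -> : Num.sg (d x0) * derive_on Cn (iter n T) z = `|d x0| * (d z / d x0).
  by rewrite normrEsg -/(d z); field; rewrite dn0.
have -> : C ^+ 2 * (`|d x0| / C) = `|d x0| * C by field; rewrite gt_eqF.
by rewrite !ler_pM2l ?normr_gt0 ?dn0//; exact: Hd.
Qed.

(** [T^n] is monotone on an interval of level [n] by [distortion_const], so it
    pulls back the interval [w n] to a convex set. *)
Lemma cyl_interval n w : word w -> is_interval (cyl n.+1 w).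
Proof.
have [K K1 HK] := distortion_const.
move=> Hw; elim: n => [|n IH].
  have -> : cyl 1 w = w 0%N.
    apply/seteqP; split=> x; first by move=> [_]; exact.
    by move=> wx; split; [apply: part_sub; exists (w 0%N)|case].
  by have [] := pe_interval hE (Hw 0%N).
rewrite cylS => x y [Cx wx] [Cy wy] z /andP[xz zy].
have Cz : cyl n.+1 w z by apply: (IH x y) => //; rewrite xz zy.
split => //=.
have [iw _ _] := pe_interval hE (Hw n.+1).
have [s [D [D0 s2 H]]] := HK n.+1 w Hw isT (ex_intro _ x Cx) IH.
have /andP[h1 _] := H x z Cx Cz xz; have /andP[h2 _] := H z y Cz Cy zy.
have {}h1 : 0 <= s * (iter n.+1 T z - iter n.+1 T x).
  by apply: le_trans h1; rewrite mulr_ge0 ?(ltW D0)// subr_ge0.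
have {}h2 : 0 <= s * (iter n.+1 T y - iter n.+1 T z).
  by apply: le_trans h2; rewrite mulr_ge0 ?(ltW D0)// subr_ge0.
have : s == 1 \/ s == -1.
  by apply/orP; rewrite -eqf_sqr expr1n s2.
case=> /eqP sE; move: h1 h2; rewrite sE => h1 h2.
  by apply: (iw _ _ wx wy); apply/andP; split; rewrite -subr_ge0; move: h1 h2; rewrite !mul1r.
by apply: (iw _ _ wy wx); apply/andP; split; rewrite -subr_ge0;
  move: h1 h2; rewrite !mulN1r !opprB.
Qed.

Lemma meas_P I : P I -> measurable (I : set (measurableTypeR R)).
Proof.
move=> PI; apply: is_interval_meas.
by have [] := pe_interval (gm_expanding hT) PI.
Qed.

Lemma meas_cyl n w : word w -> measurable (cyl n.+1 w : set (measurableTypeR R)).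
Proof. by move=> Hw; apply: is_interval_meas; exact: cyl_interval. Qed.

Lemma meas_subpart Q : Q `<=` P ->
  measurable (\bigcup_(J in Q) J : set (measurableTypeR R)).
Proof.
move=> QP.
have cQ : countable Q.
  by apply: sub_countable (pe_countable (gm_expanding hT)); exact: subset_card_le.
have tQ : trivIset Q id by move=> I J QI QJ; apply: (pe_disjoint (gm_expanding hT)); exact: QP.
have [F [F1 _ <-]] := countable_disjoint_enum cQ tQ.
apply: bigcupT_measurable => i; have [->|QF] := F1 i; first exact: measurable0.
exact: (meas_P (QP _ QF)).
Qed.

Lemma meas_part : measurable (part : set (measurableTypeR R)).
Proof.
have [F [F1 _ E]] := countable_disjoint_enum (pe_countable (gm_expanding hT))
  (pe_disjoint (gm_expanding hT)).
have -> : part = \bigcup_i F i by rewrite E.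
apply: bigcupT_measurable => i; have [->|PF] := F1 i; first exact: measurable0.
exact: meas_P.
Qed.

Lemma countable_cylinders n : countable (cylinders n).
Proof.
elim: n => [|n IH].
  apply: (@sub_countable _ _ _ [set X]); last exact: countable1.
  apply: subset_card_le => C [w Hw ->].
  by apply/seteqP; split=> x; [case|move=> Xx; split].
have c2 := countableX IH (pe_countable (gm_expanding hT)).
pose g (p : set R * set R) : set R := p.1 `&` [set x | p.2 (iter n T x)].
apply: (@sub_countable _ _ _ (g @` (cylinders n `*` P))); last first.
  exact: (card_le_trans (card_image_le _ _) c2).
apply: subset_card_le => C [w Hw ->]; exists (cyl n w, w n) => /=.
  by split => /=; [exists w|exact: Hw].
by rewrite /g /= cylS.
Qed.

Lemma cylinders_disjoint n : trivIset (cylinders n) id.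
Proof.
move=> C C' [w Hw ->] [w' Hw' ->] [x [Cx C'x]].
exact: (cyl_eq Hw Hw' Cx C'x).
Qed.

Lemma cylinders_cover n : \bigcup_(C in cylinders n.+1) C = part.
Proof.
apply/seteqP; split=> x.
  by move=> [C [w Hw ->]]; exact: (cyl_part Hw).
move=> Yx; have [w Hw H] := itinerary Yx.
by exists (cyl n.+1 w) => //; exists w.
Qed.

(** For a finite partition the image contains an element of the partition by the
    Markov property; for an infinite one it is itself long by assumption. *)
Lemma big_image : exists2 delta : R, 0 < delta &
  forall n w, word w -> cyl n.+1 w !=set0 ->
  exists2 S : set R, measurable (S : set (measurableTypeR R)) &
   S `<=` iter n.+1 T @` cyl n.+1 w /\ (delta%:E <= leb S)%E.
Proof.
have [fP|iP] := pselect (finite_set P).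
  have [d d0 H] := gm_big_image_finite hT fP.
  exists d => // n w Hw ne; rewrite image_cyl//.
  have [Q QP TQ] := gm_markov hT (Hw n).
  have [x [Xx wx]] := ne.
  have : (T @` w n) (T (iter n T x)) by exists (iter n T x) => //; exact: wx.
  rewrite TQ => -[J QJ _]; exists J; first exact: (meas_P (QP _ QJ)).
  by split; [move=> y Jy; exists J|apply: H; exact: QP].
have [d d0 H] := gm_big_image_infinite hT iP.
exists d => // n w Hw ne; exists (iter n.+1 T @` cyl n.+1 w).
  by rewrite image_cyl//; have [Q QP ->] := gm_markov hT (Hw n); exact: meas_subpart.
by split => //; apply: H => //; exact: cyl_cylinder.
Qed.

Hypothesis ab : a < b.

Lemma leb_X : leb X = (b - a)%:E.
Proof. by rewrite lebesgue_measure_itv/= lte_fin ab -EFinD. Qed.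

Lemma leb_fin (A : set R) : measurable (A : set (measurableTypeR R)) ->
  A `<=` X -> (len A)%:E = leb A.
Proof.
move=> mA AX; rewrite /len fineK// ge0_fin_numE//.
apply: (@le_lt_trans _ _ (leb X)); last by rewrite leb_X ltry.
by apply: le_measure; rewrite ?inE//; exact: measurable_itv.
Qed.

Lemma len_le (A : set R) : measurable (A : set (measurableTypeR R)) ->
  A `<=` X -> len A <= b - a.
Proof.
move=> mA AX; rewrite -lee_fin leb_fin// -leb_X.
by apply: le_measure; rewrite ?inE//; exact: measurable_itv.
Qed.

Lemma len_cyl_ge0 n w : word w -> 0 <= len (cyl n.+1 w).
Proof.
by move=> Hw; rewrite -lee_fin leb_fin//; [exact: meas_cyl|exact: cyl_subX].
Qed.

Lemma len_cyl_mono n m w : word w -> (n <= m)%N -> len (cyl m.+1 w) <= len (cyl n.+1 w).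
Proof.
move=> Hw nm; have mC k := meas_cyl k Hw.
rewrite -lee_fin !leb_fin//; try exact: cyl_subX.
by apply: le_measure; rewrite ?inE//; exact: cyl_mono.
Qed.

Lemma len_cyl_diam n w x y : word w -> cyl n.+1 w x -> cyl n.+1 w y ->
  `|x - y| <= len (cyl n.+1 w).
Proof.
move=> Hw Cx Cy; rewrite -lee_fin leb_fin//; [|exact: meas_cyl|exact: cyl_subX].
by apply: leb_interval_ge => //; exact: cyl_interval.
Qed.

Lemma len_cyl_le n w d : word w -> 0 <= d ->
  (forall x y, cyl n.+1 w x -> cyl n.+1 w y -> `|x - y| <= d) ->
  len (cyl n.+1 w) <= 2 * d.
Proof.
move=> Hw d0 H; rewrite -lee_fin leb_fin//; [|exact: meas_cyl|exact: cyl_subX].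
by apply: leb_diam_le => //; exact: meas_cyl.
Qed.

(** The segment between [x] and [y] is disjoint from the smaller cylinder, so
    the two lengths add up to at most the length of the larger one. *)
Lemma side_diam n m w z0 x y : word w -> (n <= m)%N -> cyl m.+1 w z0 ->
  cyl n.+1 w x -> cyl n.+1 w y -> ~ cyl m.+1 w x -> ~ cyl m.+1 w y ->
  (x < z0 /\ y < z0) \/ (z0 < x /\ z0 < y) ->
  `|x - y| <= len (cyl n.+1 w) - len (cyl m.+1 w).
Proof.
move=> Hw nm Cz; wlog xy : x y / x <= y.
  move=> W Cx Cy nx ny side; have [xy|yx] := leP x y; first exact: W.
  rewrite distrC; apply: W => //; first exact: ltW.
  by case: side => -[? ?]; [left|right].
move=> Cx Cy nx ny side.
have iN : is_interval (cyl n.+1 w) := cyl_interval Hw.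
have iM : is_interval (cyl m.+1 w) := cyl_interval Hw.
have mN := meas_cyl n Hw; have mM := meas_cyl m Hw.
pose S : set R := `[x, y]%classic.
have mS : measurable (S : set (measurableTypeR R)) by exact: measurable_itv.
have SM : S `&` cyl m.+1 w = set0.
  apply/seteqP; split=> t // [+ Mt]; rewrite /S /= in_itv/= => /andP[xt ty].
  case: side => -[h1 h2].
    by apply: ny; apply: (iM t z0) => //; rewrite ty ltW.
  by apply: nx; apply: (iM z0 t) => //; rewrite xt ltW.
have SN : S `<=` cyl n.+1 w.
  by move=> t; rewrite /S /= in_itv/= => h; exact: (iN x y).
have MN : cyl m.+1 w `<=` cyl n.+1 w by exact: cyl_mono.
have lS : leb S = (`|x - y|)%:E.
  rewrite lebesgue_measure_itv/= lte_fin ler0_norm ?subr_le0// opprB.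
  case: ltP => [_|yx]; first by rewrite -EFinD.
  by congr _%:E; apply/eqP; rewrite eq_sym subr_eq0 eq_le yx.
have E : leb (S `|` cyl m.+1 w) = (`|x - y| + len (cyl m.+1 w))%:E.
  by rewrite EFinD -lS (leb_fin mM (@cyl_subX _ _)); exact: measureU.
have : (leb (S `|` cyl m.+1 w) <= leb (cyl n.+1 w))%E.
  apply: le_measure; rewrite ?inE//; first exact: measurableU.
  by move=> t [/SN|/MN].
by rewrite E -(leb_fin mN (@cyl_subX _ _)) lee_fin lerBrDr.
Qed.

(** The cylinders of a given level form a countable partition of [part]. *)
Lemma sum_cylinders (nu : {measure set (measurableTypeR R) -> \bar R}) n (B : set R) k :
  measurable (B : set (measurableTypeR R)) -> 0 <= k ->
  (forall w, word w -> cyl n.+1 w !=set0 ->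
    (nu (B `&` cyl n.+1 w) <= (k * len (cyl n.+1 w))%:E)%E) ->
  (nu (B `&` part) <= (k * (b - a))%:E)%E.
Proof.
move=> mB k0 H.
have [F [F1 F2 F3]] := countable_disjoint_enum (countable_cylinders n.+1)
  (@cylinders_disjoint n.+1).
rewrite cylinders_cover in F3.
have mF i : measurable (F i : set (measurableTypeR R)).
  by have [->|[w Hw ->]] := F1 i; [exact: measurable0|exact: meas_cyl].
have FX i : F i `<=` X.
  by have [->|[w Hw ->]] := F1 i; [exact: sub0set|exact: cyl_subX].
rewrite -F3 setI_bigcupr measure_bigcup; last 2 first.
- by move=> i _; exact: measurableI.
- apply/trivIsetP => i j _ _ ij; rewrite setIACA setIid.
  by move/trivIsetP : F2 => /(_ i j Logic.I Logic.I ij) ->; rewrite setI0.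
apply: (@le_trans _ _ (\sum_(0 <= i <oo | i \in setT) k%:E * leb (F i))%E).
  apply: lee_nneseries => // i _.
  have [Fi|/set0P[x Fx]] := eqVneq (F i) set0.
    by rewrite Fi setI0 !measure0 mule0.
  have [Fi|[w Hw E]] := F1 i; first by rewrite Fi in Fx.
  rewrite -(leb_fin (mF i) (FX i)) -EFinM E; apply: H => //.
  by exists x; rewrite -E.
rewrite nneseriesZl; last by move=> i _; exact: measure_ge0.
rewrite -measure_bigcup//.
rewrite F3 EFinM lee_wpmul2l// ?lee_fin// -leb_X.
apply: le_measure; rewrite ?inE; [exact: meas_part|exact: measurable_itv|].
exact: part_sub.
Qed.

(** The image of a cylinder of level [n] under [T^n] has length between [delta]
    and [b - a], so the expansion [D] of [T^n] on it is, up to constants, the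
    inverse of its length. *)
Lemma cyl_geometry : exists K delta : R, [/\ 1 <= K, 0 < delta &
  forall n w, word w -> cyl n.+1 w !=set0 -> exists D : R, [/\ 0 < D,
    forall x y, cyl n.+1 w x -> cyl n.+1 w y ->
      D * `|x - y| <= `|iter n.+1 T x - iter n.+1 T y| <= K * D * `|x - y|,
    delta <= K * D * len (cyl n.+1 w) &
    D * len (cyl n.+1 w) <= 2 * (b - a)]].
Proof.
have [K K1 HK] := distortion_const.
have [d d0 Hd] := big_image.
exists K, (d / 2); split => //; first by rewrite divr_gt0.
move=> n w Hw ne.
have [s [D [D0 s2 H]]] := HK n.+1 w Hw isT ne (cyl_interval Hw).
exists D; have KD0 : 0 <= K * D by rewrite mulr_ge0// ltW// (lt_le_trans _ K1).
have s1 : `|s| = 1.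
  by apply/eqP; rewrite -(@eqrXn2 _ 2)// -normrX s2 normr1 expr1n.
have G x y : cyl n.+1 w x -> cyl n.+1 w y ->
    D * `|x - y| <= `|iter n.+1 T x - iter n.+1 T y| <= K * D * `|x - y|.
  wlog xy : x y / x <= y.
    move=> W Cx Cy; have [xy|yx] := leP x y; first exact: W.
    by rewrite distrC [X in _ <= X <= _]distrC; apply: W => //; exact: ltW.
  move=> Cx Cy; have /andP[h1 h2] := H x y Cx Cy xy.
  have h0 : 0 <= s * (iter n.+1 T y - iter n.+1 T x).
    by apply: le_trans h1; rewrite mulr_ge0 ?(ltW D0)// subr_ge0.
  rewrite distrC [X in _ <= X <= _]distrC ger0_norm ?subr_ge0//.
  have -> : `|iter n.+1 T y - iter n.+1 T x| = s * (iter n.+1 T y - iter n.+1 T x).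
    by rewrite -(ger0_norm h0) normrM s1 mul1r.
  by rewrite h1 h2.
split => //.
  have [S mS [ST dS]] := Hd n w Hw ne.
  have : (leb S <= (2 * (K * D * len (cyl n.+1 w)))%:E)%E.
    apply: leb_diam_le => //; first by rewrite mulr_ge0// len_cyl_ge0.
    move=> u v /ST[x Cx <-] /ST[y Cy <-].
    have /andP[_] := G x y Cx Cy; move=> /le_trans; apply.
    by rewrite ler_wpM2l//; exact: len_cyl_diam.
  by move=> /(le_trans dS); rewrite lee_fin; lra.
have : len (cyl n.+1 w) <= 2 * ((b - a) / D).
  apply: len_cyl_le => //; first by rewrite divr_ge0 ?(ltW D0)// subr_ge0 ltW.
  move=> x y Cx Cy; rewrite ler_pdivlMr// mulrC.
  have /andP[h _] := G x y Cx Cy; apply: le_trans h _.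
  have XT z : cyl n.+1 w z -> X (iter n.+1 T z).
    by case=> Xz _; apply: iter_X => //; exact: (pe_map (gm_expanding hT)).
  have := XT x Cx; have := XT y Cy; rewrite /= !in_itv/= => /andP[h1 h2] /andP[h3 h4].
  by rewrite ler_norml; apply/andP; split; lra.
by rewrite mulrA ler_pdivlMr// mulrC.
Qed.

End cylinders.

(** * Radon-Nikodym densities *)

Section density_cutoff.
Context {R : realType} (a b : R).
Context (mu : probability (measurableTypeR R) R).
Local Notation X := (`[a, b]%classic : set R).
Local Notation prob := (prob mu).
Local Notation leb := (@lebesgue_measure R).

(** [E] is a sublevel set of the Radon-Nikodym density of [mu]; these sets
    exhaust [X]. *)
Lemma density_cutoff : a < b -> mu X = 1%E -> mu `<< leb -> exists2 M : R, 0 < M &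
  exists2 E : set (measurableTypeR R), measurable E & 2^-1 <= prob E /\
    forall A : set (measurableTypeR R), measurable A -> A `<=` E ->
      (mu A <= M%:E * leb A)%E.
Proof.
move=> ab muX ac.
pose f := Radon_Nikodym (charge_of_finite_measure mu) leb.
have ac' : charge_of_finite_measure mu `<< leb by [].
have fi : leb.-integrable setT f by exact: Radon_Nikodym_integrable.
have mf : measurable_fun setT f by exact: (measurable_int leb).
have ff x : f x \is a fin_num by exact: Radon_Nikodym_fin_num.
have mX : measurable (X : set (measurableTypeR R)) by exact: measurable_itv.
pose E (n : nat) : set (measurableTypeR R) := X `&` [set x | (f x <= n%:R%:E)%E].
have mE n : measurable (E n).
  by apply: emeasurable_fun_infty_c => //; exact: measurable_funTS.
have EU : \bigcup_n E n = X.
  apply/seteqP; split=> x; first by move=> [n _ []].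
  move=> Xx; have [n0 H] := archi_nat (fine (f x)).
  by exists n0 => //; split => //=; rewrite -(fineK (ff x)) lee_fin; exact: H.
have ndE i j : (i <= j)%N -> E i `<=` E j.
  by move=> ij x [Xx Ex]; split => //=; apply: le_trans Ex _; rewrite lee_fin ler_nat.
have h20 : 0 < 2^-1 :> R by rewrite invr_gt0.
have [n] := prob_nondecreasing_limit mu mE ndE h20.
rewrite EU {1}/prob muX /= => Hn.
exists n.+1%:R; first by rewrite ltr0n.
exists (E n); first exact: mE.
split; first by lra.
move=> A mA AE.
have AX : (leb A < +oo)%E.
  apply: (@le_lt_trans _ _ (leb X)); last by rewrite (leb_X ab) ltry.
  by apply: le_measure; rewrite ?inE// => x /AE[].
have -> : mu A = (\int[leb]_(x in A) f x)%E by rewrite -Radon_Nikodym_integral.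
apply: (@le_trans _ _ (\int[leb]_(x in A) (cst n.+1%:R%:E) x)%E); last by rewrite integral_cst.
have i1 : leb.-integrable A f by exact: integrableS fi.
have i2 : leb.-integrable A (cst n.+1%:R%:E : R -> \bar R).
  apply/integrableP; split => //; under eq_integral do rewrite abse_EFin.
  by rewrite integral_cst//= lte_mul_pinfty.
have i3 x : A x -> (f x <= (cst n.+1%:R%:E : R -> \bar R) x)%E.
  by move=> Ax; have [_ h] := AE _ Ax; apply: le_trans h _; rewrite lee_fin ler_nat.
by apply: le_integral => // x; rewrite inE; exact: i3.
Qed.

End density_cutoff.

(** * Absolutely continuous Gibbs measures *)

Section absolutely_continuous.
Context {R : realType} (a b : R) (T : R -> R) (P : set (set R)).
Context (mu : probability (measurableTypeR R) R).
Local Notation X := (`[a, b]%classic : set R).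
Local Notation leb := (@lebesgue_measure R).
Local Notation cyl := (cyl a b T).
Local Notation word := (word P).
Local Notation part := (part P).
Local Notation prob := (prob mu).
Local Notation vis := (vis a b T).
Local Notation ret r k := (near_return a b T r 0 k).
Hypothesis ab : a < b.
Hypothesis hT : gibbs_markov X T P.
Hypothesis mT : @measurable_fun _ _ (measurableTypeR R) (measurableTypeR R) X T.
Hypothesis muX : mu X = 1%E.
Hypothesis muT : forall A : set (measurableTypeR R), measurable A ->
    mu (X `&` T @^-1` A) = mu A.
Hypothesis gb : gibbs_bound X T P mu.
Variables C c : R.
Hypotheses (C0 : 0 < C) (c0 : 0 < c).
Hypothesis mix : forall (J : set R) (B : set (measurableTypeR R)) t,
    is_interval J -> measurable B ->
    `|prob (J `&` vis t B) - prob J * prob B| <= C * expR (- (c * t%:R)) * prob B.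

Let TX : set_fun X X T := pe_map (gm_expanding hT).
Local Notation mvis := (measurable_vis TX mT).
Local Notation pvis := (prob_vis TX mT muX muT).

(** The Gibbs bound for [n = 1] at any point of [I], all of which are in the
    repeller. *)
Lemma prob_symbol_gt0 I : P I -> 0 < prob I.
Proof.
move=> PI; have [iI IX [x [y [Ix Iy xy]]]] := pe_interval (gm_expanding hT) PI.
have Yx : part x by exists I.
have [w Hw Hx] := itinerary hT Yx.
have wI : w 0%N = I.
  by apply: (part_disjoint hT (Hw _) PI _ Ix); exact: (Hx 1%N).2.
have [phi _ [k k0 [p H]]] := gb.
have Rx : repeller X T P x by rewrite (repeller_part hT).
have := H 1%N (cyl 1 w) x isT (cyl_cylinder Hw (ex_intro _ x (Hx 1%N))) (Hx 1%N) Rx.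
rewrite (cyl1 hT Hw) wI => /andP[h _]; rewrite lt_neqAle prob_ge0 andbT.
apply/eqP => I0; move: h; rewrite -/(prob I) -I0 mul0r leNgt invr_gt0.
by rewrite k0.
Qed.

(** [I] is contained in [T^-n part] for all [n], so mixing yields
    [prob I = prob I * prob part], and [prob I] is positive. *)
Lemma prob_part : prob part = 1.
Proof.
have [I PI] := pe_nonempty (gm_expanding hT).
have pI := prob_symbol_gt0 PI.
have mY := meas_part hT.
have Y1 := prob_le1 mu mY.
have IE n : prob (I `&` vis n part) = prob I.
  rewrite setIidl// => x Ix; have Yx : part x by exists I.
  by split; [exact: (part_sub hT)|exact: (part_iter hT)].
apply/eqP; rewrite eq_le Y1 leNgt; apply/negP => Y1'.
pose e := prob I * (1 - prob part) / 2.
have e0 : 0 < e by rewrite divr_gt0// mulr_gt0// subr_gt0.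
have [n0 H] := mixing_measurable TX mT muX muT C0 c0 mix (meas_P hT PI) mY e0.
have := H n0 (leqnn _); rewrite IE ler_norml => /andP[_].
rewrite /e; nra.
Qed.

Lemma prob_partI (B : set (measurableTypeR R)) : measurable B -> prob (B `&` part) = prob B.
Proof.
move=> mB; apply: probI1 => //; first exact: (meas_part hT).
exact: prob_part.
Qed.

Lemma prob_sum_cylinders n (B : set (measurableTypeR R)) k : measurable B -> 0 <= k ->
  (forall w, word w -> cyl n.+1 w !=set0 ->
    prob (B `&` cyl n.+1 w) <= k * len (cyl n.+1 w)) ->
  prob B <= k * (b - a).
Proof.
move=> mB k0 H; rewrite -(prob_partI mB) -lee_fin probE; last first.
  by apply: measurableI => //; exact: (meas_part hT).
apply: (sum_cylinders (n := n) hT ab) => // w Hw ne.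
have := H w Hw ne; rewrite -lee_fin probE//.
by apply: measurableI => //; exact: (meas_cyl hT).
Qed.

(** By [cyl_geometry], Lebesgue measure of [T^-n J] inside a cylinder of level
    [n] is at most a multiple of [|J|] times the length of the cylinder.
    Summing, and restricting to a set [E] where the density of [mu] is at most
    [M], one gets [mu (E `&` T^-n J) <= const * M * |J|] for all [n]; the
    left-hand side tends to [mu E * mu J] by mixing. *)
Lemma density_bound : mu `<< leb -> exists2 K1 : R, 0 < K1 &
  forall x l, 0 <= l -> prob `[x - l, x + l] <= K1 * l.
Proof.
move=> ac.
have [K [d [K1 d0 HG]]] := cyl_geometry hT ab.
have [M M0 [E mE [E2 HE]]] := density_cutoff ab muX ac.
have K0 : 0 < K by exact: lt_le_trans K1.
pose k0 := 4 * K / d.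
have k00 : 0 < k0 by rewrite divr_gt0// mulr_gt0.
exists (2 * (M * (k0 * (b - a)))); first by rewrite !mulr_gt0 ?invr_gt0 ?subr_gt0.
move=> x l l0; set J : set R := `[x - l, x + l]%classic.
have mJ : measurable (J : set (measurableTypeR R)) by exact: measurable_itv.
have dJ u v : J u -> J v -> `|u - v| <= 2 * l.
  rewrite /J /= !in_itv/= => /andP[u1 u2] /andP[v1 v2].
  by rewrite ler_norml; apply/andP; split; lra.
have l20 : 0 <= 2 * l by rewrite mulr_ge0.
have B1 n : (leb (vis n.+1 J `&` part) <= (k0 * l * (b - a))%:E)%E.
  apply: (sum_cylinders (n := n) hT ab).
  - exact: mvis.
  - by rewrite mulr_ge0// ltW.
  move=> w Hw ne; have [D [D0 HD dD _]] := HG n w Hw ne.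
  have mV : measurable (vis n.+1 J `&` cyl n.+1 w : set (measurableTypeR R)).
    by apply: measurableI; [exact: mvis|exact: (meas_cyl hT)].
  apply: (@le_trans _ _ (2 * (2 * l / D))%:E).
    apply: leb_diam_le => //; first by rewrite divr_ge0// ltW.
    move=> u v [[_ Ju] Cu] [[_ Jv] Cv].
    rewrite ler_pdivlMr// mulrC; have /andP[h _] := HD u v Cu Cv.
    by apply: le_trans h _; exact: dJ.
  rewrite lee_fin.
  have -> : k0 * l * len (cyl n.+1 w) = 2 * (2 * l / D) * (K * D * len (cyl n.+1 w) / d).
    by rewrite /k0; field; rewrite !gt_eqF.
  rewrite ler_peMr//; first by rewrite mulr_ge0// divr_ge0// ltW.
  by rewrite ler_pdivlMr// mul1r.
have B2 n : prob (E `&` vis n.+1 J) <= M * (k0 * l * (b - a)).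
  have mEV : measurable (E `&` vis n.+1 J : set (measurableTypeR R)).
    by apply: measurableI => //; exact: mvis.
  rewrite -(probI1 mEV (meas_part hT) prob_part).
  have mA : measurable (E `&` vis n.+1 J `&` part : set (measurableTypeR R)).
    by apply: measurableI => //; exact: (meas_part hT).
  rewrite -lee_fin probE//; apply: le_trans (HE _ mA _) _; first by move=> y [[]].
  rewrite EFinM lee_wpmul2l// ?lee_fin ?(ltW M0)//.
  apply: le_trans (B1 n); apply: le_measure; rewrite ?inE//.
    by apply: measurableI; [exact: mvis|exact: (meas_part hT)].
  by move=> y [[_ ?] ?].
rewrite leNgt; apply/negP => contra.
pose e := (prob J - 2 * (M * (k0 * (b - a))) * l) / 4.
have e0 : 0 < e by rewrite divr_gt0// subr_gt0.
have [n0 H] := mixing_measurable TX mT muX muT C0 c0 mix mE mJ e0.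
have := H n0.+1 (leqnSn _); rewrite ler_norml => /andP[h _].
have h2 := B2 n0.
have h3 : 2^-1 * prob J <= prob E * prob J by rewrite ler_wpM2r// prob_ge0.
have h4 : M * (k0 * l * (b - a)) = M * (k0 * (b - a)) * l by ring.
rewrite h4 in h2; move: h e0; rewrite /e; lra.
Qed.

(** The lengths of the symbols are summable, so only finitely many symbols are
    long, and each has positive probability. *)
Lemma long_symbols_prob l : 0 < l ->
  exists2 e : R, 0 < e & forall I, P I -> l <= len I -> e <= prob I.
Proof.
move=> l0.
have [F [F1 F2 F3]] := countable_disjoint_enum (pe_countable (gm_expanding hT))
  (pe_disjoint (gm_expanding hT)).
have mF i : measurable (F i : set (measurableTypeR R)).
  by have [->|PF] := F1 i; [exact: measurable0|exact: (meas_P hT)].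
have FX i : F i `<=` X.
  have [->|PF] := F1 i; first exact: sub0set.
  by have [_ + _] := pe_interval (gm_expanding hT) PF.
have fin : (\sum_(0 <= i <oo) leb (F i) < +oo)%E.
  have E : (\sum_(0 <= i <oo) leb (F i) = leb (\bigcup_i F i))%E.
    rewrite measure_bigcup//.
    by apply: eq_eseriesl => i; rewrite in_setT.
  rewrite E; apply: (@le_lt_trans _ _ (leb X)); last by rewrite (leb_X ab) ltry.
  apply: le_measure; rewrite ?inE//; first exact: bigcupT_measurable.
  by move=> x [i _]; exact: FX.
have tail : (\sum_(i <= j <oo) leb (F j))%E @[i --> \oo] --> (0 : \bar R)%E.
  exact: nneseries_tail_cvg.
have [n Hn] : exists n, forall i, (n <= i)%N -> P (F i) -> len (F i) < l.
  move/fine_cvgP : tail => [[n1 _ fin1] /cvgrPdist_lt /(_ l l0)[n2 _ H2]].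
  exists (maxn n1 n2) => i; rewrite geq_max => /andP[/fin1 f1 /H2].
  rewrite /= sub0r normrN => h _; apply: le_lt_trans h.
  rewrite -lee_fin (leb_fin ab (mF i) (FX i)) ger0_norm; last first.
    by apply: fine_ge0; apply: nneseries_ge0.
  rewrite fineK//.
  apply: le_trans (nneseries_lim_ge i.+1 _) => //.
  by rewrite big_nat1.
have [e e0 He] : exists2 e : R, 0 < e & forall i, (i < n)%N -> P (F i) -> e <= prob (F i).
  clear Hn; elim: n => [|n [e e0 IH]]; first by exists 1.
  have [PF|PF] := pselect (P (F n)).
    exists (Num.min e (prob (F n))); first by rewrite lt_min e0 prob_symbol_gt0.
    move=> i; rewrite ltnS leq_eqVlt ge_min => /predU1P[->|ij] Pi; first by rewrite lexx orbT.
    by rewrite IH.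
  exists e => // i; rewrite ltnS leq_eqVlt => /predU1P[->//|]; exact: IH.
exists e => // I PI lI.
have [_ _ [x [_ [Ix _ _]]]] := pe_interval (gm_expanding hT) PI.
have : (\bigcup_i F i) x by rewrite F3; exists I.
move=> [i _ Fx]; have [Fi|PF] := F1 i; first by rewrite Fi in Fx.
have FI : F i = I by apply: (part_disjoint hT PF PI Fx Ix).
rewrite -FI; apply: He => //; rewrite ltnNge; apply/negP => /Hn/(_ PF).
by rewrite FI ltNge lI.
Qed.

Variable K1 : R.
Hypothesis K10 : 0 < K1.
Hypothesis dens : forall x l, 0 <= l -> prob `[x - l, x + l] <= K1 * l.

(** If the partition were [{I}], the even iterates of [T] would be increasing
    maps of [I] into itself.  For an initial segment [J] of [I], one of [J] and
    [T^-n J] would then contain the other, so that [J `&` T^-n J] would have the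
    probability of [J], and mixing would force [prob J] to be 0 or 1.  But
    [prob J] increases from 0 to 1 without jumps, by the density bound. *)
Lemma two_symbols : exists I J, [/\ P I, P J & I <> J].
Proof.
apply: contrapT => none.
have [I PI] := pe_nonempty (gm_expanding hT).
have PE J : P J -> J = I.
  by move=> PJ; apply: contrapT => JI; apply: none; exists J, I.
have partI : part = I.
  by apply/seteqP; split=> x; [move=> [J /PE ->]|move=> Ix; exists I].
have stay x n : I x -> I (iter n T x).
  by rewrite -partI => Ix; exact: (part_iter hT).
pose w := fun _ : nat => I.
have Hw : word w by [].
have Ew n : cyl n.+1 w = I.
  apply/seteqP; split=> x; first by move=> [_ /(_ 0%N isT)].
  move=> Ix; split; last by move=> i _; exact: stay.
  by apply: (part_sub hT); rewrite partI.
have [K _ HK] := distortion_const hT.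
(* an even iterate preserves the orientation, whatever that of T is *)
have even_mono n x y : I x -> I y -> x <= y ->
    iter (n.+1 + n.+1) T x <= iter (n.+1 + n.+1) T y.
  move=> Ix Iy xy; have ne : cyl n.+1 w !=set0 by rewrite Ew; exists x.
  have [s [D [D0 s2 H]]] := HK n.+1 w Hw isT ne (cyl_interval hT Hw).
  rewrite Ew in H.
  have H0 u v : I u -> I v -> u <= v -> 0 <= s * (iter n.+1 T v - iter n.+1 T u).
    move=> Iu Iv uv; have /andP[h _] := H u v Iu Iv uv.
    by apply: le_trans h; rewrite mulr_ge0 ?(ltW D0)// subr_ge0.
  rewrite !iterD.
  have : s == 1 \/ s == -1 by apply/orP; rewrite -eqf_sqr expr1n s2.
  case=> /eqP sE; rewrite sE in H0.
    have := H0 x y Ix Iy xy; rewrite mul1r subr_ge0 => h.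
    by have := H0 _ _ (stay _ _ Ix) (stay _ _ Iy) h; rewrite mul1r subr_ge0.
  have := H0 x y Ix Iy xy; rewrite mulN1r opprB subr_ge0 => h.
  by have := H0 _ _ (stay _ _ Iy) (stay _ _ Ix) h; rewrite mulN1r opprB subr_ge0.
have mI : measurable (I : set (measurableTypeR R)) := meas_P hT PI.
have I1 : prob I = 1.
  by rewrite -partI; exact: prob_part.
pose J (t : R) : set R := `]-oo, t]%classic.
have mJ t : measurable (J t : set (measurableTypeR R)) by exact: measurable_itv.
pose F t := prob (J t).
have Jret t n : prob (J t `&` vis (n.+1 + n.+1) (J t)) = F t.
  have mV : measurable (vis (n.+1 + n.+1) (J t) : set (measurableTypeR R)) by exact: mvis.
  have mW : measurable (J t `&` vis (n.+1 + n.+1) (J t) : set (measurableTypeR R)).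
    exact: measurableI.
  have IX x : I x -> X x by move=> Ix; apply: (part_sub hT); rewrite partI.
  have [allJ|/existsNP[x0 /not_implyP[Ix0 /not_implyP[x0t /negP]]]] :=
      pselect (forall x, I x -> x <= t -> iter (n.+1 + n.+1) T x <= t).
    rewrite -(probI1 mW mI I1) /F -(probI1 (mJ t) mI I1); congr (_ _ _).
    apply/seteqP; split=> x; first by move=> [[]].
    move=> [Jx Ix]; split => //; split => //; split; first exact: IX.
    by rewrite /J /= in_itv/=; apply: allJ => //; move: Jx; rewrite /J /= in_itv.
  rewrite -ltNge => Sx0; rewrite /F -(pvis (n.+1 + n.+1) (mJ t)).
  rewrite -(probI1 mW mI I1) -(probI1 mV mI I1); congr (_ _ _).
  apply/seteqP; split=> x; first by move=> [[_]].
  move=> [Vx Ix]; split => //; split => //.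
  have : iter (n.+1 + n.+1) T x <= t by case: Vx => _; rewrite /J /= in_itv.
  rewrite /J /= in_itv/= => Sx; rewrite leNgt; apply/negP => tx.
  have := even_mono n x0 x Ix0 Ix (le_trans x0t (ltW tx)); rewrite leNgt.
  by rewrite (le_lt_trans Sx Sx0).
have F01 t : F t = F t * F t.
  apply/eqP; rewrite -subr_eq0 -normr_le0; apply/ler_addgt0Pl => e e0; rewrite addr0.
  have [n0 H] := @mixrate_small R C c c0 e e0.
  rewrite -{1}(Jret t n0); apply: le_trans (mix _ _ (mJ t)) _.
    exact: interval_is_interval.
  apply: le_trans (H (n0.+1 + n0.+1)%N _); last by clear; lia.
  by rewrite ler_piMr ?prob_le1// mulr_ge0 ?expR_ge0// ltW.
(* a step short enough for [F] to increase by at most [1 / 2] *)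
pose h := K1^-1; have h0 : 0 < h by rewrite invr_gt0.
have Fh t : F (t + h) <= F t + 2^-1.
  have sub : J (t + h) `<=` J t `|` `[(t + h / 2) - h / 2, (t + h / 2) + h / 2].
    move=> x; rewrite /J /= !in_itv/= => xth.
    have [xt|tx] := leP x t; [by left|right; apply/andP; split; lra].
  have mS : measurable (`[(t + h / 2) - h / 2, (t + h / 2) + h / 2]%classic : set (measurableTypeR R)).
    exact: measurable_itv.
  apply: le_trans (prob_mono mu (mJ _) (measurableU _ _ (mJ t) mS) sub) _.
  apply: le_trans (probU_le mu (mJ t) mS) _; rewrite lerD2l.
  apply: le_trans (dens _ _) _; first by rewrite divr_ge0// ltW.
  by rewrite /h mulrA mulfV ?mul1r// gt_eqF.
have Fa : F (a - 1) = 0.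
  rewrite /F -(probXI muX (mJ (a - 1))) (_ : _ `&` _ = set0) ?prob0//.
  apply/seteqP; split=> x //=; rewrite /J /= !in_itv/= => -[/andP[ax _] xa].
  by move: (le_trans ax xa); rewrite lerBrDl; lra.
have Fk k : F (a - 1 + k%:R * h) = 0.
  elim: k => [|k IH]; first by rewrite mul0r addr0.
  have -> : a - 1 + k.+1%:R * h = a - 1 + k%:R * h + h by rewrite -natr1; ring.
  have := Fh (a - 1 + k%:R * h); rewrite IH add0r.
  set u := F _; have E : u = u * u by exact: F01.
  have u0 : 0 <= u by exact: prob_ge0.
  by move=> u2; nra.
have [k Hk] := archi_nat ((b - (a - 1)) / h).
have : F (a - 1 + k%:R * h) = 1.
  apply: (@prob_eq1_mono _ _ X) => //; last by rewrite /prob muX.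
  move=> x; rewrite /J /= !in_itv/= => /andP[_ xb].
  by have := Hk k (leqnn k); rewrite ler_pdivrMr//; lra.
by rewrite Fk => /eqP; rewrite eq_sym oner_eq0.
Qed.

(** No symbol can be more likely than the complement of one of two given
    symbols. *)
Lemma symbol_prob_lt1 : exists2 th : R, 0 <= th < 1 & forall I, P I -> prob I <= th.
Proof.
have [I1 [I2 [P1 P2 I12]]] := two_symbols.
have p1 := prob_symbol_gt0 P1; have p2 := prob_symbol_gt0 P2.
have dis I J : P I -> P J -> I <> J -> prob I + prob J <= 1.
  move=> PI PJ IJ; have mI := meas_P hT PI; have mJ := meas_P hT PJ.
  rewrite -(probU mu mI mJ); first exact: prob_le1 (measurableU _ _ mI mJ).
  by apply/seteqP; split=> x // [Ix Jx]; apply: IJ; exact: (part_disjoint hT PI PJ Ix Jx).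
exists (1 - Num.min (prob I1) (prob I2)).
  apply/andP; split; last by rewrite ltrBlDr ltrDl lt_min p1.
  rewrite subr_ge0 ge_min; apply/orP; left; exact: prob_le1 (meas_P hT P1).
move=> I PI; rewrite lerBrDr -lerBrDl ge_min.
have [->|II1] := pselect (I = I1).
  by apply/orP; right; have := dis _ _ P1 P2 I12; lra.
by apply/orP; left; have := dis _ _ PI P1 II1; lra.
Qed.

(** Reading one letter every [L.+1] times, every letter read multiplies the
    probability by at most [th] plus a mixing error, hence by at most [z < 1]. *)
Lemma cyl_prob_small e : 0 < e -> exists M, forall w, word w -> prob (cyl M.+1 w) <= e.
Proof.
move=> e0; have [th /andP[th0 th1] Hth] := symbol_prob_lt1.
have d0 : 0 < (1 - th) / 2 by rewrite divr_gt0// subr_gt0.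
have [L HL] := @mixrate_small R C c c0 _ d0.
pose z := (1 + th) / 2.
have z0 : 0 <= z by rewrite divr_ge0// addr_ge0.
have z1 : z < 1 by rewrite /z; lra.
have step j w : word w -> prob (cyl (j * L.+1).+1 w) <= z ^+ j.
  elim: j w => [|j IH] w Hw; first by rewrite expr0 prob_le1//; exact: (meas_cyl hT).
  pose w' i := w (L.+1 + i)%N.
  have Hw' : word w' by move=> i; exact: Hw.
  have mC := meas_cyl hT (j * L.+1) Hw'.
  have i0 : is_interval (w 0%N) by have [] := pe_interval (gm_expanding hT) (Hw 0%N).
  apply: (@le_trans _ _ (prob (w 0%N `&` vis L.+1 (cyl (j * L.+1).+1 w')))).
    apply: prob_mono.
    - exact: (meas_cyl hT).
    - by apply: measurableI; [exact: (meas_P hT (Hw 0%N))|exact: mvis].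
    - move=> x Cx; split; first exact: Cx.2.
      split; first by case: Cx.
      by apply: (cyl_shift hT); rewrite mulSn -addnS in Cx.
  apply: le_trans (mix_ub C0 c0 mix (leqnn L.+1) i0 mC) _.
  rewrite exprS; apply: ler_pM; rewrite ?prob_ge0 ?IH//.
    by rewrite addr_ge0 ?prob_ge0// mixrate_ge0.
  by have := Hth _ (Hw 0%N); have := HL _ (leqnSn L); rewrite /z; lra.
have [j Hj] : exists j, z ^+ j <= e.
  have : (fun n => z ^+ n) @ \oo --> (0 : R) by apply: cvg_expr; rewrite ger0_norm.
  move=> /cvgrPdist_le /(_ e e0)[j _ H]; exists j.
  by have := H j (leqnn j); rewrite /= sub0r normrN ger0_norm// exprn_ge0.
by exists (j * L.+1)%N => w Hw; exact: le_trans (step j w Hw) Hj.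
Qed.

(** Otherwise [f] would decrease by more than [e] over each block of [M] steps
    and become negative. *)
Lemma small_decrement (M : nat) (e B : R) : 0 < e ->
  exists q, forall f : nat -> R, (forall n, 0 <= f n) -> f 0%N <= B ->
    exists2 n, (n < q)%N & f (n * M)%N - f (n.+1 * M)%N <= e.
Proof.
move=> e0; have [q Hq] := archi_nat ((B + 1) / e).
exists q => f f0 fB; apply: contrapT => none.
have H k : (k <= q)%N -> f (k * M)%N <= B - k%:R * e.
  elim: k => [|k IH] kq; first by rewrite mul0n mul0r subr0.
  have h1 := IH (ltnW kq).
  have : e < f (k * M)%N - f (k.+1 * M)%N.
    by rewrite ltNge; apply/negP => h; apply: none; exists k.
  by rewrite -[k.+1%:R]natr1; lra.
have := H q (leqnn q); have := f0 (q * M)%N; have := Hq q (leqnn q).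
by rewrite ler_pdivrMr//; lra.
Qed.

(** Suppose that a very deep cylinder is longer than [d].  Two of its prefixes,
    [M] levels apart, then have almost the same length ([small_decrement]).  Let
    [n.+1] be such that [T^n.+1] maps the longer prefix onto the symbol
    [w n.+1].  This symbol is long, because [T^n.+1] does not contract much, and
    so its probability is at least some [e0 > 0].  On the other hand the image of
    the shorter prefix is contained in a cylinder of level [M.+1], which is
    unlikely, and the rest of the symbol is the image of two short intervals
    under a Lipschitz map, which is unlikely by the density bound. *)
Lemma cyl_shrink d : 0 < d ->
  exists k0, forall n w, word w -> (k0 <= n)%N -> len (cyl n.+1 w) <= d.
Proof.
move=> d0.
have [K [delta [K1' delta0 HG]]] := cyl_geometry hT ab.
have K0 : 0 < K by exact: lt_le_trans K1'.
have ba0 : 0 < b - a by rewrite subr_gt0.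
pose l := d * delta / (2 * K * (b - a)).
have l0 : 0 < l by rewrite divr_gt0 ?mulr_gt0.
have [e0 e00 He0] := long_symbols_prob l0.
have e40 : 0 < e0 / 4 by rewrite divr_gt0.
have [M HM] := cyl_prob_small e40.
pose La := K * (2 * (b - a) / d).
have La0 : 0 < La by rewrite mulr_gt0 ?divr_gt0 ?mulr_gt0.
pose eta := e0 / (8 * K1 * La).
have eta0 : 0 < eta by rewrite divr_gt0// mulr_gt0// mulr_gt0.
have [q Hq] := small_decrement M (b - a) eta0.
exists (q * M).+1 => m w Hw hm; rewrite leNgt; apply/negP => big.
have big' k : (k <= q * M)%N -> d < len (cyl k.+2 w).
  by move=> kq; apply: lt_le_trans big _; apply: (len_cyl_mono hT ab) => //; exact: leq_trans hm.
have ne k : d < len (cyl k.+2 w) -> cyl k.+2 w !=set0.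
  move=> h; apply/set0P/eqP => E; move: h; rewrite E /len measure0 /= ltNge.
  by rewrite ltW.
have [i iq] := Hq (fun k => len (cyl k.+2 w)) (fun k => len_cyl_ge0 hT ab k.+1 Hw)
  (len_le ab (meas_cyl hT 1 Hw) (@cyl_subX _ _ _ _ _ _)).
set n := (i * M)%N; have -> : (i.+1 * M = n + M)%N by rewrite mulSn addnC.
set e := _ - _ => eeta.
have nM : (n + M <= q * M)%N by rewrite addnC -mulSn leq_mul2r iq orbT.
have bn := big' n (leq_trans (leq_addr _ _) nM); have bM := big' (n + M)%N nM.
have [z0 Cz] := ne _ bM; have ne2 := ne _ bn.
have ne1 : cyl n.+1 w !=set0.
  by case: ne2 => x Cx; exists x; apply: cyl_mono Cx.
have [D [D0 HD dD Dle]] := HG n w Hw ne1.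
have lenC : d < len (cyl n.+1 w) by apply: lt_le_trans bn _; exact: (len_cyl_mono hT ab).
have DLa : K * D <= La.
  rewrite ler_pM2l// ler_pdivlMr//; apply: le_trans Dle.
  by rewrite ler_pM2l// ltW.
have Dlow : delta / (K * (b - a)) <= D.
  rewrite ler_pdivrMr ?mulr_gt0//; apply: le_trans dD _.
  rewrite [D * _]mulrCA mulrA ler_pM2l ?mulr_gt0//.
  exact: (len_le ab (meas_cyl hT n Hw) (@cyl_subX _ _ _ _ _ _)).
have [iW WX _] := pe_interval (gm_expanding hT) (Hw n.+1).
have mW := meas_P hT (Hw n.+1).
have C2w x : cyl n.+2 w x -> w n.+1 (iter n.+1 T x) by case=> _; exact.
have C21 x : cyl n.+2 w x -> cyl n.+1 w x by exact: cyl_mono.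
have longw : l <= len (w n.+1).
  have lw0 : 0 <= len (w n.+1) by rewrite -lee_fin (leb_fin ab mW WX).
  have : len (cyl n.+2 w) <= 2 * (len (w n.+1) / D).
    apply: (len_cyl_le hT ab) => //; first by rewrite divr_ge0// ltW.
    move=> x y Cx Cy; rewrite ler_pdivlMr// mulrC.
    have /andP[h _] := HD x y (C21 _ Cx) (C21 _ Cy); apply: le_trans h _.
    rewrite -lee_fin (leb_fin ab mW WX); apply: leb_interval_ge => //; exact: C2w.
  move=> h; have {h} : d < 2 * (len (w n.+1) / D) by exact: lt_le_trans h.
  rewrite mulrA ltr_pdivlMr// => h.
  have : d * (delta / (K * (b - a))) <= d * D by rewrite ler_pM2l.
  have -> : l = d * (delta / (K * (b - a))) / 2.
    by rewrite /l; field; rewrite !gt_eqF.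
  by rewrite ler_pdivrMr//; lra.
have pw := He0 _ (Hw n.+1) longw.
pose side (s : bool) x := if s then x < z0 else z0 < x.
have Hside s : exists u, forall x, cyl n.+2 w x -> ~ cyl (n + M).+2 w x -> side s x ->
    `|iter n.+1 T x - u| <= La * eta.
  have [[x1 [C1 N1 S1]]|none] := pselect (exists x1, [/\ cyl n.+2 w x1,
      ~ cyl (n + M).+2 w x1 & side s x1]); last first.
    by exists 0 => x Cx Nx Sx; exfalso; apply: none; exists x.
  exists (iter n.+1 T x1) => x Cx Nx Sx.
  have /andP[_ h] := HD x x1 (C21 _ Cx) (C21 _ C1); apply: le_trans h _.
  apply: ler_pM => //; first by rewrite mulr_ge0// ltW.
  apply: le_trans _ eeta; apply: (side_diam hT ab (n := n.+1) (m := (n + M).+1) Hw _ Cz) => //.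
    by rewrite ltnS leq_addr.
  by move: Sx S1; rewrite /side; case: s; [left|right].
have [u1 Hu1] := Hside true; have [u2 Hu2] := Hside false.
pose w' k := w (n.+1 + k)%N.
have Hw' : word w' by move=> k; exact: Hw.
have cover : w n.+1 `<=` cyl M.+1 w' `|` (`[u1 - La * eta, u1 + La * eta] `|`
    `[u2 - La * eta, u2 + La * eta]).
  have ball_itv u v : `|v - u| <= La * eta -> (`[u - La * eta, u + La * eta]%classic : set R) v.
    by rewrite ler_norml => /andP[h1 h2]; rewrite /= in_itv/=; apply/andP; split; lra.
  move=> y wy; have [x Cx <-] := cyl_image hT Hw ne2 wy.
  have [C'x|NC'x] := pselect (cyl (n + M).+2 w x).
    by left; apply: (cyl_shift hT); rewrite addnS addSn.
  right; have [xz|zx|xz] := ltgtP x z0.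
  - by left; apply: ball_itv; exact: Hu1.
  - by right; apply: ball_itv; exact: Hu2.
  - by rewrite xz in NC'x.
have mI u : measurable (`[u - La * eta, u + La * eta]%classic : set (measurableTypeR R)).
  exact: measurable_itv.
have mCy := meas_cyl hT M Hw'.
have mU : measurable (`[u1 - La * eta, u1 + La * eta] `|` `[u2 - La * eta, u2 + La * eta]
  : set (measurableTypeR R)) by exact: measurableU.
have h1 := prob_mono mu mW (measurableU _ _ mCy mU) cover.
have h2 := probU_le mu mCy mU.
have h3 := probU_le mu (mI u1) (mI u2).
have Le0 : 0 <= La * eta by rewrite mulr_ge0// ltW.
have h4 := dens u1 Le0; have h5 := dens u2 Le0; have h6 := HM w' Hw'.
(* [w n.+1] has probability at most [e0 / 4 + 2 * (e0 / 8) < e0] *)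
have h7 : K1 * (La * eta) = e0 / 8 by rewrite /eta; field; rewrite !gt_eqF.
rewrite h7 in h4 h5; lra.
Qed.

Lemma interval_cover_le (S : set R) (u l : R) : measurable (S : set (measurableTypeR R)) ->
  0 <= l -> (forall x, S x -> `|x - u| <= l) -> prob S <= K1 * l.
Proof.
move=> mS l0 H; apply: le_trans (dens u l0); apply: prob_mono => //.
move=> x /H; rewrite ler_norml => /andP[h1 h2].
by rewrite /= in_itv/=; apply/andP; split; lra.
Qed.

(** For the cylinders of level [k] not longer than [ds], [T^k] expands by a
    factor at least 2 and [|T^k x - x| < r] confines [x] to a set of diameter
    proportional to [r] and to the length of the cylinder.  By [cyl_shrink] all
    cylinders are that short at the levels above [k0], in particular at level
    [k * q].  On a longer cylinder [I] of level [k], [T^k] is [La]-Lipschitz, so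
    the successive points [T^(k i) x] are within [La ^+ i * r] of each other
    while the orbit stays in [I].  If it stays up to [i = q], then [x] returns
    close to itself at time [k * q]; if not, some [T^(k i) x] with [i < q] is
    near an endpoint of [I], an event controlled by the density bound. *)
Lemma return_prob : exists2 Kr : R, 0 < Kr &
  forall k r, (0 < k)%N -> 0 < r -> prob (ret r k) <= Kr * r.
Proof.
have [K [delta [K1' delta0 HG]]] := cyl_geometry hT ab.
have K0 : 0 < K by exact: lt_le_trans K1'.
have ba0 : 0 < b - a by rewrite subr_gt0.
(* cylinders at most this long are expanded by a factor at least 2 *)
pose ds := delta / (2 * K).
have ds0 : 0 < ds by rewrite divr_gt0 ?mulr_gt0.
have [k0 Hk0] := cyl_shrink ds0.
pose q := k0.+1.
pose La := Num.max 1 (K * (2 * (b - a) / ds)).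
have La1 : 1 <= La by rewrite le_max lexx.
have La0 : 0 < La by exact: lt_le_trans La1.
pose Ka := K1 * (4 * K / delta).
have Ka0 : 0 < Ka by rewrite mulr_gt0// divr_gt0 ?mulr_gt0.
have mret r k : measurable (ret r k : set (measurableTypeR R)).
  exact: (measurable_near_return TX mT).
have smallC n w r : word w -> cyl n.+1 w !=set0 -> len (cyl n.+1 w) <= ds -> 0 < r ->
    prob (ret r n.+1 `&` cyl n.+1 w) <= Ka * r * len (cyl n.+1 w).
  move=> Hw ne ls r0; have [D [D0 HD dD _]] := HG n w Hw ne.
  have mB : measurable (ret r n.+1 `&` cyl n.+1 w : set (measurableTypeR R)).
    by apply: measurableI => //; exact: (meas_cyl hT).
  have D2 : 2 <= D.
    have : delta <= K * D * ds by apply: le_trans dD _; rewrite ler_pM2l// mulr_gt0.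
    have -> : K * D * ds = delta * (D / 2) by rewrite /ds; field; rewrite gt_eqF.
    by rewrite -[X in X <= _]mulr1 ler_pM2l// ler_pdivlMr// mul1r.
  have [E|/set0P[x [[_ /= Rx] Cx]]] := eqVneq (ret r n.+1 `&` cyl n.+1 w) set0.
    rewrite E prob0; apply: mulr_ge0; last exact: (len_cyl_ge0 hT ab).
    exact: mulr_ge0 (ltW Ka0) (ltW r0).
  have l0 : 0 <= 4 * r / D by rewrite divr_ge0 ?mulr_ge0 ?(ltW r0) ?(ltW D0).
  apply: (@le_trans _ _ (K1 * (4 * r / D))).
    apply: (interval_cover_le (u := x)) => // y [[_ /= Ry] Cy].
    have /andP[h _] := HD y x Cy Cx.
    rewrite ler_pdivlMr//.
    have h2 : `|iter n.+1 T y - iter n.+1 T x| <= `|y - x| + 2 * r.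
      have -> : iter n.+1 T y - iter n.+1 T x = (y - x) + (x - iter n.+1 T x) -
        (y - iter n.+1 T y) by ring.
      apply: le_trans (ler_normB _ _) _; have := ler_normD (y - x) (x - iter n.+1 T x).
      by move: Rx Ry => /=; lra.
    have h3 : 2 * `|y - x| <= D * `|y - x| by rewrite ler_wpM2r.
    by rewrite mulrC; lra.
  have -> : Ka * r * len (cyl n.+1 w) = K1 * (4 * r / D) * (K * D * len (cyl n.+1 w) / delta).
    by rewrite /Ka; field; rewrite !gt_eqF.
  rewrite ler_peMr//; first exact: mulr_ge0 (ltW K10) l0.
  by rewrite ler_pdivlMr// mul1r.
have deep n r : (k0 <= n)%N -> 0 < r -> prob (ret r n.+1) <= Ka * r * (b - a).
  move=> kn r0; apply: (@prob_sum_cylinders n) => //; first by rewrite mulr_ge0 ?ltW.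
  by move=> w Hw ne; apply: smallC => //; exact: Hk0.
pose Kb := 2 * K1 * La ^+ q * q%:R / ds.
have Lq0 : 0 < La ^+ q by rewrite exprn_gt0.
have Kb0 : 0 < Kb by rewrite divr_gt0// mulr_gt0 ?mulr_gt0// ltr0n.
pose Kq := q.+1%:R * La ^+ q.
have Kq0 : 0 < Kq by rewrite mulr_gt0// ltr0n.
exists ((Ka + Kb) * (b - a) + Ka * Kq * (b - a)).
  by apply: addr_gt0; apply: mulr_gt0 => //; [exact: addr_gt0|exact: mulr_gt0].
move=> [//|n] r _ r0.
pose k := n.+1; pose rq := Kq * r.
have rq0 : 0 < rq by rewrite mulr_gt0.
have kq : (k * q = (k * q).-1.+1)%N by rewrite prednK// muln_gt0.
have dq : prob (ret rq (k * q)) <= Ka * rq * (b - a).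
  by rewrite kq; apply: deep => //; rewrite -ltnS -kq leq_pmull.
(* the close returns that are not iterated into close returns at time [k * q] *)
pose B : set R := ret r k `\` ret rq (k * q).
have mB : measurable (B : set (measurableTypeR R)) by exact: measurableD.
have HB : prob B <= (Ka + Kb) * r * (b - a).
  apply: (@prob_sum_cylinders n) => //.
    by rewrite mulr_ge0 ?addr_ge0 ?(ltW Ka0) ?(ltW Kb0) ?(ltW r0).
  move=> w Hw ne; have mC := meas_cyl hT n Hw.
  have lC0 : 0 <= len (cyl n.+1 w) by exact: (len_cyl_ge0 hT ab).
  have [small|large] := leP (len (cyl n.+1 w)) ds.
    apply: (@le_trans _ _ (prob (ret r k `&` cyl n.+1 w))).
      apply: prob_mono; [exact: measurableI|exact: measurableI|].
      by move=> x [[]].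
    apply: le_trans (smallC _ _ _ Hw ne small r0) _.
    by rewrite ler_wpM2r// ler_wpM2r ?(ltW r0)// lerDl ltW.
  have [D [D0 HD _ Dle]] := HG n w Hw ne.
  have KDLa : K * D <= La.
    rewrite le_max; apply/orP; right; rewrite ler_pM2l// ler_pdivlMr//.
    by apply: le_trans Dle; rewrite ler_pM2l// ltW.
  have lip x y : cyl n.+1 w x -> cyl n.+1 w y -> `|iter k T x - iter k T y| <= La * `|x - y|.
    move=> Cx Cy; have /andP[_ h] := HD x y Cx Cy; apply: le_trans h _.
    by rewrite ler_wpM2r.
  pose rho := La ^+ q * r.
  have rho0 : 0 <= rho := mulr_ge0 (ltW Lq0) (ltW r0).
  have [u1 [u2 Hu]] := interval_edge (cyl_interval hT (n := n) Hw) rho0.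
  pose W : set R := `[u1 - rho, u1 + rho] `|` `[u2 - rho, u2 + rho].
  have mI u : measurable (`[u - rho, u + rho]%classic : set (measurableTypeR R)).
    exact: measurable_itv.
  have mW : measurable (W : set (measurableTypeR R)) by exact: measurableU.
  have pW : prob W <= 2 * K1 * rho.
    apply: le_trans (probU_le mu (mI u1) (mI u2)) _.
    by have := dens u1 rho0; have := dens u2 rho0; lra.
  have HW y z : cyl n.+1 w y -> ~ cyl n.+1 w z -> `|y - z| <= rho -> W y.
    move=> Cy Nz yz; have ball_itv u v : `|v - u| <= rho ->
        (`[u - rho, u + rho]%classic : set R) v.
      by rewrite ler_norml => /andP[h1 h2]; rewrite /= in_itv/=; apply/andP; split; lra.
    by have [h|h] := Hu y z Cy Nz yz; [left|right]; exact: ball_itv.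
  have cover : B `&` cyl n.+1 w `<=` \big[setU/set0]_(i < q) vis (k * i) W.
    move=> x [[[Xx /= Rx] NR] Cx]; apply: contrapT => NW.
    have NWi i : (i < q)%N -> ~ W (iter (k * i) T x).
      move=> iq Wi; apply: NW; rewrite -(bigcup_mkord q (fun i => vis (k * i) W)).
      by exists i => //; split.
    have Lie i : (i <= q)%N -> La ^+ i * r <= rho.
      by move=> iq; rewrite ler_wpM2r ?(ltW r0)// ler_weXn2l.
    have stepD i : iter (k * i.+1) T x = iter k T (iter (k * i) T x).
      by rewrite mulnS iterD.
    have orbit i : (i <= q)%N -> cyl n.+1 w (iter (k * i) T x) /\
        `|iter (k * i) T x - iter (k * i.+1) T x| <= La ^+ i * r.
      elim: i => [|i IH] iq.
        by rewrite muln0 muln1 expr0 mul1r; split => //; exact: ltW.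
      have [Ci di] := IH (ltnW iq).
      have Ci1 : cyl n.+1 w (iter (k * i.+1) T x).
        apply: contrapT => N; apply: (NWi i iq); apply: (HW _ _ Ci N).
        by apply: le_trans di _; apply: Lie; exact: ltnW.
      split => //; rewrite [iter (k * i.+1) T x]stepD [iter (k * i.+2) T x]stepD.
      apply: le_trans (lip _ _ Ci Ci1) _.
      by rewrite exprS -mulrA ler_pM2l.
    apply: NR; split => //=.
    have tot i : (i <= q)%N -> `|x - iter (k * i) T x| <= i%:R * rho.
      elim: i => [|i IH] iq; first by rewrite muln0 subrr normr0 mul0r.
      have := IH (ltnW iq); have [_ di] := orbit i (ltnW iq).
      have := Lie i (ltnW iq) => h1 h2.
      have -> : x - iter (k * i.+1) T x = (x - iter (k * i) T x) +
         (iter (k * i) T x - iter (k * i.+1) T x) by ring.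
      apply: le_trans (ler_normD _ _) _; rewrite -[i.+1%:R]natr1 mulrDl mul1r.
      by apply: lerD => //; exact: le_trans di h1.
    apply: le_lt_trans (tot q (leqnn q)) _.
    rewrite /rq /Kq -mulrA -/rho ltr_pM2r ?ltr_nat//.
    exact: mulr_gt0.
  have mV i : measurable (vis (k * i) W : set (measurableTypeR R)) by exact: mvis.
  have : prob (B `&` cyl n.+1 w) <= q%:R * (2 * K1 * rho).
    apply: le_trans (prob_mono mu (measurableI _ _ mB mC) _ cover) _.
      by apply: bigsetU_measurable => i _.
    apply: le_trans (prob_bigU_le _ _ _ (fun i : 'I_q => mV i)) _.
    have -> : q%:R * (2 * K1 * rho) = \sum_(i < q) 2 * K1 * rho.
      by rewrite sumr_const card_ord mulr_natl.
    by apply: ler_sum => i _; rewrite pvis.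
  move=> h; apply: le_trans h _.
  apply: (@le_trans _ _ (Kb * r * ds)).
    by rewrite /Kb /rho; apply: le_of_eq; field; rewrite gt_eqF.
  apply: ler_pM; [exact: mulr_ge0 (ltW Kb0) (ltW r0)|exact: ltW| |exact: ltW].
  by rewrite ler_wpM2r ?(ltW r0)// lerDr ltW.
have mR := mret rq (k * q)%N.
rewrite [X in X <= _](probDI mu (mret r k) mR).
have h : prob (ret r k `&` ret rq (k * q)) <= prob (ret rq (k * q)).
  apply: prob_mono; [exact: measurableI (mret r k) mR|exact: mR|by move=> x []].
move: HB dq; rewrite /B /rq; lra.
Qed.

End absolutely_continuous.

(** * Shortest distances within orbits *)

Theorem theorem1p2 (R : realType) (a b : R) (T : R -> R) (P : set (set R))
    (mu : probability (measurableTypeR R) R)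
    (hab : a < b)
    (hT : gibbs_markov `[a, b]%classic T P)
    (hmu : gibbs_measure `[a, b]%classic T P mu)
    (hdecay : exp_decay_BV_L1 a b T mu) :
  let X := `[a, b]%classic in
  ((0 < upper_correlation_dim X mu)%E ->
    {ae mu, forall x, repeller X T P x ->
      (2%:E / upper_correlation_dim X mu <=
       limn_einf (shortest_distance_rate T x))%E}) /\
  (mu `<< @lebesgue_measure R ->
    [/\ lower_correlation_dim X mu = 1%E,
        upper_correlation_dim X mu = 1%E &
        {ae mu, forall x, X x ->
          shortest_distance_rate T x n @[n --> \oo] -->
            (2%:E / upper_correlation_dim X mu)%E}]).
Proof.
move=> X.
have TX := pe_map (gm_expanding hT).
have mT := gb_measurable hmu.
have muX : mu X = 1%E := gb_carrier hmu.
have muT := gb_invariant hmu.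
have gb := gb_bound hmu.
have [C [c [C0 c0 mix]]] := decay_intervals TX mT muX hab hdecay.
have D1 := upper_correlation_dim_le1 hab muX.
split.
  move=> D0.
  have [d dE] : exists d : R, upper_correlation_dim X mu = d%:E.
    exists (fine (upper_correlation_dim X mu)); rewrite fineK// fin_numE.
    by rewrite gt_eqF ?(lt_trans _ D0)//= lt_eqF// (le_lt_trans D1)// ltry.
  rewrite dE in D0 D1 *; rewrite lte_fin in D0; rewrite lee_fin in D1.
  have := ae_rate_lower_bounds TX mT muX muT C0 c0 mix hab dE D0 D1.
  apply: ae_imply => x H [Xx _].
  rewrite inver gt_eqF// -EFinM; apply: limn_einf_ge; exact: H.
move=> ac.
have [K1 K10 dens] := density_bound hab hT mT muX muT gb C0 c0 mix ac.
have [Kr Kr0 Hret] := return_prob hab hT mT muX muT gb C0 c0 mix K10 dens.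
have [lo up] := correlation_dims_eq1 hab muX K10 dens.
split => //; rewrite up.
have L := ae_rate_lower_bounds TX mT muX muT C0 c0 mix hab up ltr01 (lexx 1).
have U j : {ae mu, forall x, exists n0, forall n, (n0 <= n)%N -> X x ->
    far a b T n (n%:R `^ (- (2 + j.+1%:R^-1))) x}.
  apply: (eventually_far TX mT muX muT Kr0 Hret).
  by rewrite ltrDl invr_gt0 ltr0n.
have := ae_foralln U; case: L => [N1 [mN1 N10 sub1]] [N2 [mN2 N20 sub2]].
exists (N1 `|` N2); split; first exact: measurableU.
  by rewrite null_set_setU.
move=> x nx; apply: contrapT => /not_orP[n1 n2]; apply: nx => Xx.
have {sub1 n1}H1 : forall j : nat, exists n0, forall n, (n0 <= n)%N ->
    ((2 / 1 - j.+1%:R^-1)%:E <= shortest_distance_rate T x n)%E.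
  by apply: contrapT => nh; apply: n1; apply: sub1 => /(_ Xx).
have {sub2 n2}H2 : forall j : nat, exists n0, forall n, (n0 <= n)%N -> X x ->
    far a b T n (n%:R `^ (- (2 + j.+1%:R^-1))) x.
  by apply: contrapT => nh; apply: n2; apply: sub2.
have rate_bounds e : 0 < e -> exists n0, forall n, (n0 <= n)%N ->
    ((2 - e)%:E <= shortest_distance_rate T x n <= (2 + e)%:E)%E.
  move=> e0; have [j Hj] := archi_nat e^-1.
  have je : (j.+1%:R^-1 : R) <= e.
    rewrite -[leRHS]invrK lef_pV2 ?posrE ?invr_gt0//; exact: Hj.
  have [n1 h1] := H1 j; have [n2 h2] := H2 j.
  exists (maxn 2 (maxn n1 n2)) => n; rewrite !geq_max => /and3P[n2' n1n n2n].
  apply/andP; split.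
    by apply: le_trans (h1 n n1n); rewrite divr1 lee_fin lerD2l lerN2.
  by apply: le_trans (rate_le n2' (h2 n n2n Xx)) _; rewrite lee_fin lerD2l.
have -> : (2%:E / 1 = 2%:E :> \bar R)%E by rewrite inve1 mule1.
have fin1 : \forall n \near \oo, shortest_distance_rate T x n \is a fin_num.
  have [n0 H] := rate_bounds 1 ltr01; exists n0 => // n /= /H /andP[h1 h2].
  by rewrite fin_numE gt_eqF ?(lt_le_trans _ h1) ?ltNyr//= lt_eqF// (le_lt_trans h2)// ltry.
apply/fine_cvgP; split => //; apply/cvgrPdist_le => e e0.
have [n0 H] := rate_bounds e e0; have [n1 _ F1] := fin1.
exists (maxn n0 n1) => // n /=; rewrite geq_max => /andP[/H + /F1 /= fn].
rewrite -(fineK fn) !lee_fin => /andP[h1 h2] /=.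
by rewrite ler_norml; apply/andP; split; lra.
Qed.
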